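(* Let $z\in\mathbb{C}$ and let $s,a$ be parameters for which $\Phi(z,s,a)$ and $\Gamma(s)$ are defined. If the integral converges, then \[ \Phi(z,s,a)\,\Gamma(s)=\int_0^1\!\!\int_0^1\frac{-s\,(xy)^{a-1}\left(-\log(y)\right)^{s-1}}{(1-zxy)\log(xy)}\,dx\,dy, \] and \[ \zeta(s)\,\Gamma(s)=\int_0^1\!\!\int_0^1\frac{-s\left(-\log(y)\right)^{s-1}}{(1-xy)\log(xy)}\,dx\,dy. \]
   Context: The Lerch transcendent is $\Phi(z,s,a)=\sum_{k=0}^\infty \frac{z^k}{(k+a)^s}$ (where this series converges); $\Gamma$ is Euler's gamma function and $\zeta$ the Riemann zeta function. *)

(* Defs.v *)
From Stdlib Require Import Reals List.
Import ListNotations.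
From Coquelicot Require Export Coquelicot.
Open Scope R_scope.

Definition Cexp (w : C) : C :=
  (exp (Re w) * cos (Im w), exp (Re w) * sin (Im w)).

Definition Carg (w : C) : R :=
  let x := Re w in let y := Im w in
  match Rlt_dec 0 x with
  | left _ => atan (y / x)
  | right _ =>
    match Rlt_dec x 0 with
    | left _ => match Rle_dec 0 y with
                | left _ => atan (y / x) + PI
                | right _ => atan (y / x) - PI
                end
    | right _ =>
      match Rlt_dec 0 y with
      | left _ => PI / 2
      | right _ => - (PI / 2)
      end
    end
  end.

(* Principal logarithm (for w <> 0). *)
Definition CLog (w : C) : C := (ln (Cmod w), Carg w).

(* Principal complex power w^s = exp(s Log w) (w <> 0). *)
Definition Cpow (w s : C) : C := Cexp (s * CLog w).

(* Power of a positive real base: t^s = exp(s ln t), for t > 0. *)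
Definition Rcpow (t : R) (s : C) : C := Cexp (s * RtoC (ln t)).

(* "Phi(z,s,a) is defined (by its series) and equals L":
   no term has k + a = 0 and sum_{k>=0} z^k / (k+a)^s converges to L. *)
Definition is_Lerch (z s a L : C) : Prop :=
  (forall k : nat, (RtoC (INR k) + a <> 0)%C) /\
  is_series (fun k : nat => (z ^ k / Cpow (RtoC (INR k) + a) s)%C) L.

(* "zeta(s) is defined (by its series) and equals Z":
   sum_{n>=1} 1/n^s converges to Z. *)
Definition is_zeta (s Z : C) : Prop :=
  is_series (fun n : nat => (/ Rcpow (INR (S n)) s)%C) Z.

(* "Gamma(s) is defined and equals G": s is not a non-positive integer and
   Gauss's product formula  n! n^s / (s (s+1) ... (s+n))  tends to G. *)
Definition is_Gamma (s G : C) : Prop :=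
  (forall k : nat, s <> RtoC (- INR k)) /\
  filterlim
    (fun n : nat =>
       (RtoC (INR (Factorial.fact n)) * Rcpow (INR n) s /
        fold_right Cmult 1%C (map (fun k => s + RtoC (INR k)) (seq 0 (S n))))%C)
    eventually (locally G).

Definition is_dblint01 (f : R -> R -> C) (I : C) : Prop :=
  exists g : R -> C,
    (forall y, 0 < y < 1 -> is_RInt_gen (V := C_R_NormedModule)
                              (fun x => f x y) (at_right 0) (at_left 1) (g y)) /\
    is_RInt_gen (V := C_R_NormedModule) g (at_right 0) (at_left 1) I.

Definition lerch_integrand (z s a : C) (x y : R) : C :=
  ((- s) * Rcpow (x * y) (a - 1) * Rcpow (- ln y) (s - 1)
   / ((1 - z * RtoC x * RtoC y) * RtoC (ln (x * y))))%C.

Definition zeta_integrand (s : C) (x y : R) : C :=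
  ((- s) * Rcpow (- ln y) (s - 1)
   / ((1 - RtoC x * RtoC y) * RtoC (ln (x * y))))%C.

(* Main.v *)
Require Import Defs.
From Stdlib Require Import Reals Lra Lia List ClassicalEpsilon.
From Coquelicot Require Import Coquelicot.

(** Substituting [x y = exp (- w)] and [y = exp (- v)] turns the double integral into the
    integral over [v > 0] of [s v^(s-1) H v], where [H v] is the integral of
    [phi w = exp (- a w) / ((1 - z exp (- w)) w)] over [w > v].  Integrating by parts leaves the
    integral of [v^(s-1) exp (- a v) / (1 - z exp (- v))], and expanding the geometric series
    gives [Gamma s] times the Lerch series.

    Convergence of the integrals is a hypothesis and must itself yield the range of parameters:
    the series forces [|z| <= 1], the inner integral forces [0 <= Re a], and the outer one forces
    [0 < Re s] ([1 < Re s] if [z = 1]).  On the boundary [Re a = 0] both integrals may converge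
    only conditionally, and the boundary term of the integration by parts need not vanish at
    infinity; a factor [exp (- e v)] with [e -> 0+] (Abel summation) handles all cases at once.

    Improper integrals over [(0, oo)] are treated as differences of limits of primitives. *)

(** The hypotheses give an iterated, possibly conditional integral and a Gauss limit [G], so Fubini
    is not at hand. Convergence of an oscillating integral does not bound its integrand either: the
    necessary conditions on [a] and [s] are found by testing against explicit functions, and they
    must come first, since Gauss's product is identified with Euler's integral only for [0 < Re s].

    For complex [b] the integral of [v^(s-1) exp (- b v)] still has to be matched with the principal
    power [b^(-s)], a question of branches and not only of scaling. When [Re a = 0] the term [k = 0]
    is not an absolutely convergent integral; it is therefore split off before [e -> 0+], where
    continuity of the principal power from the right suffices. The remaining terms start at [a + 1],
    of real part at least 1, and are dominated.

    One device replaces dominated convergence and differentiation under the integral: comparison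
    with [M * dom t], whose primitive increases by at most 1, so that a pointwise constant is also a
    bound for the integral. *)

Lemma C_eq (z w : C) : Re z = Re w -> Im z = Im w -> z = w.
Proof. destruct z, w; simpl; intros -> ->; reflexivity. Qed.

Lemma im_le_Cmod (z : C) : Rabs (Im z) <= Cmod z.
Proof. eapply Rle_trans; [apply Rmax_r | apply Rmax_Cmod]. Qed.

Lemma Cmod_le_Re_Im (z : C) : Cmod z <= Rabs (Re z) + Rabs (Im z).
Proof.
replace z with (RtoC (Re z) + Ci * RtoC (Im z))%C at 1
  by (apply C_eq; simpl; ring).
eapply Rle_trans; [apply Cmod_triangle |].
rewrite Cmod_mult, Cmod_Ci, !Cmod_R; lra.
Qed.

Lemma Cmod_minus_sym (z w : C) : Cmod (z - w) = Cmod (w - z).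
Proof. rewrite <- Cmod_opp; f_equal; ring. Qed.

Lemma Cmod_triangle_minus (z w : C) : Cmod (z - w) <= Cmod z + Cmod w.
Proof. rewrite <- (Cmod_opp w). apply Cmod_triangle. Qed.

Lemma Cmod_triangle_inv (z w : C) : Cmod z - Cmod w <= Cmod (z - w).
Proof.
replace z with ((z - w) + w)%C at 1 by ring.
generalize (Cmod_triangle (z - w) w); lra.
Qed.

(** * Exponentials and powers *)

Lemma Cexp_0 : Cexp 0 = 1.
Proof.
unfold Cexp; apply C_eq; simpl; rewrite exp_0, ?cos_0, ?sin_0; ring.
Qed.

Lemma Cexp_plus (z w : C) : Cexp (z + w) = (Cexp z * Cexp w)%C.
Proof.
unfold Cexp; apply C_eq; unfold Re, Im; simpl; rewrite exp_plus, ?cos_plus, ?sin_plus; ring.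
Qed.

Lemma Cmod_Cexp (z : C) : Cmod (Cexp z) = exp (Re z).
Proof.
replace (Cexp z) with (RtoC (exp (Re z)) * (cos (Im z), sin (Im z)))%C
  by (apply C_eq; simpl; ring).
rewrite Cmod_mult, Cmod_R, Rabs_pos_eq by apply Rlt_le, exp_pos.
unfold Cmod; simpl.
generalize (sin2_cos2 (Im z)); unfold Rsqr; intros H.
replace (_ + _)%R with 1 by lra.
rewrite sqrt_1; ring.
Qed.

Lemma Cexp_neq_0 (z : C) : Cexp z <> 0.
Proof. apply Cmod_gt_0; rewrite Cmod_Cexp; apply exp_pos. Qed.

Lemma Cexp_opp (z : C) : Cexp (- z) = (/ Cexp z)%C.
Proof.
assert (H : (Cexp (- z) * Cexp z = 1)%C).
{ rewrite <- Cexp_plus, <- Cexp_0; f_equal; ring. }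
replace (Cexp (- z)) with (Cexp (- z) * Cexp z / Cexp z)%C
  by (field; apply Cexp_neq_0).
rewrite H; field; apply Cexp_neq_0.
Qed.

Lemma Cexp_RtoC (x : R) : Cexp x = exp x.
Proof. unfold Cexp; apply C_eq; simpl; rewrite ?cos_0, ?sin_0; ring. Qed.

Lemma Rcpow_plus (t : R) (p q : C) : Rcpow t (p + q) = (Rcpow t p * Rcpow t q)%C.
Proof. unfold Rcpow; rewrite <- Cexp_plus; f_equal; ring. Qed.

Lemma Rcpow_neq_0 (t : R) (p : C) : Rcpow t p <> 0.
Proof. apply Cexp_neq_0. Qed.

Lemma Rcpow_0 (t : R) : Rcpow t 0 = 1.
Proof. unfold Rcpow; rewrite <- Cexp_0; f_equal; ring. Qed.

Lemma Rcpow_1 (t : R) : 0 < t -> Rcpow t 1 = t.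
Proof.
intros Ht; unfold Rcpow.
rewrite Cmult_1_l, Cexp_RtoC, exp_ln; auto.
Qed.

Lemma Rcpow_1_l (p : C) : Rcpow 1 p = 1.
Proof. unfold Rcpow; rewrite ln_1, <- Cexp_0; f_equal; ring. Qed.

Lemma Rcpow_mult (t u : R) (p : C) : 0 < t -> 0 < u ->
  Rcpow (t * u) p = (Rcpow t p * Rcpow u p)%C.
Proof.
intros Ht Hu; unfold Rcpow; rewrite <- Cexp_plus, ln_mult, RtoC_plus by auto.
f_equal; ring.
Qed.

Lemma Rcpow_pred (t : R) (p : C) : 0 < t -> (Rcpow t (p - 1) * t = Rcpow t p)%C.
Proof.
intros Ht.
transitivity (Rcpow t (p - 1) * Rcpow t 1)%C; [rewrite Rcpow_1 by exact Ht; reflexivity |].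
rewrite <- Rcpow_plus; f_equal; ring.
Qed.

Lemma Cmod_Rcpow (t : R) (p : C) : Cmod (Rcpow t p) = Rpower t (Re p).
Proof.
unfold Rcpow, Rpower; rewrite Cmod_Cexp; f_equal; unfold Re; simpl; ring.
Qed.

(** * Derivatives of complex-valued functions of a real variable *)

(** Componentwise, so that the real mean value theorem and the real Riemann integral apply to each
    part separately. *)
Definition Cderiv (f : R -> C) (x : R) (l : C) : Prop :=
  is_derive (fun t => Re (f t)) x (Re l) /\ is_derive (fun t => Im (f t)) x (Im l).

Lemma Cderiv_eq f x l l' : Cderiv f x l -> l = l' -> Cderiv f x l'.
Proof. intros H <-; exact H. Qed.

Lemma is_derive_Rmult (f g : R -> R) x df dg : is_derive f x df -> is_derive g x dg ->
  is_derive (fun t => f t * g t) x (df * g x + f x * dg).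
Proof. intros Hf Hg; apply (is_derive_mult f g x df dg Hf Hg Rmult_comm). Qed.

Lemma is_derive_eq (f : R -> R) (x l l' : R) : is_derive f x l -> l = l' -> is_derive f x l'.
Proof. intros H <-; exact H. Qed.

Lemma Cderiv_const (c : C) x : Cderiv (fun _ => c) x 0.
Proof. split; apply (is_derive_const (K := R_AbsRing) (V := R_NormedModule)). Qed.

Lemma Cderiv_RtoC (f : R -> R) x l : is_derive f x l -> Cderiv (fun t => RtoC (f t)) x l.
Proof.
intros H; split; simpl; [exact H |].
apply (is_derive_const (K := R_AbsRing) (V := R_NormedModule)).
Qed.

Lemma Cderiv_plus f g x df dg : Cderiv f x df -> Cderiv g x dg ->
  Cderiv (fun t => f t + g t)%C x (df + dg).
Proof.
intros [H1 H2] [H3 H4]; split; simpl.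
- apply (is_derive_plus (K := R_AbsRing) (V := R_NormedModule) _ _ _ _ _ H1 H3).
- apply (is_derive_plus (K := R_AbsRing) (V := R_NormedModule) _ _ _ _ _ H2 H4).
Qed.

Lemma Cderiv_opp f x df : Cderiv f x df -> Cderiv (fun t => - f t)%C x (- df).
Proof.
intros [H1 H2]; split; simpl.
- apply (is_derive_opp (K := R_AbsRing) (V := R_NormedModule) _ _ _ H1).
- apply (is_derive_opp (K := R_AbsRing) (V := R_NormedModule) _ _ _ H2).
Qed.

Lemma Cderiv_minus f g x df dg : Cderiv f x df -> Cderiv g x dg ->
  Cderiv (fun t => f t - g t)%C x (df - dg).
Proof. intros H1 H2; apply Cderiv_plus; [exact H1 | apply Cderiv_opp, H2]. Qed.

Lemma Cderiv_mult f g x df dg : Cderiv f x df -> Cderiv g x dg ->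
  Cderiv (fun t => f t * g t)%C x (df * g x + f x * dg).
Proof.
intros [H1 H2] [H3 H4]; split; simpl.
- eapply is_derive_eq.
  + apply (is_derive_minus (K := R_AbsRing) (V := R_NormedModule)).
    * apply is_derive_Rmult; [exact H1 | exact H3].
    * apply is_derive_Rmult; [exact H2 | exact H4].
  + unfold minus, plus, opp, Re, Im; simpl; ring.
- eapply is_derive_eq.
  + apply (is_derive_plus (K := R_AbsRing) (V := R_NormedModule)).
    * apply is_derive_Rmult; [exact H1 | exact H4].
    * apply is_derive_Rmult; [exact H2 | exact H3].
  + unfold plus, Re, Im; simpl; ring.
Qed.

Lemma C_sqr_pos (z : C) : z <> 0 -> Re z * Re z + Im z * Im z <> 0.
Proof.
intros Hz H; apply Hz; apply C_eq; simpl.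
- generalize (Rle_0_sqr (Im z)) (Rle_0_sqr (Re z)); unfold Rsqr; intros.
  apply Rsqr_0_uniq; unfold Rsqr; lra.
- generalize (Rle_0_sqr (Im z)) (Rle_0_sqr (Re z)); unfold Rsqr; intros.
  apply Rsqr_0_uniq; unfold Rsqr; lra.
Qed.

Lemma Cderiv_inv f x df : Cderiv f x df -> f x <> 0 ->
  Cderiv (fun t => / f t)%C x (- df / (f x * f x)).
Proof.
intros [H1 H2] Hf.
assert (N := C_sqr_pos _ Hf).
assert (S : is_derive (fun t => Re (f t) * Re (f t) + Im (f t) * Im (f t)) x
   (2 * (Re df * Re (f x) + Im df * Im (f x)))).
{ eapply is_derive_eq.
  - apply (is_derive_plus (K := R_AbsRing) (V := R_NormedModule)).
    + apply is_derive_Rmult; exact H1.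
    + apply is_derive_Rmult; exact H2.
  - unfold plus; simpl; ring. }
apply is_derive_inv in S; [| exact N].
(* This is the squared modulus of [(a + b i)^2], the denominator created by dividing by
   [f x * f x]. *)
assert (N2 : forall a b : R, a * a + b * b <> 0 -> (a * a - b * b) ^ 2 + (a * b + b * a) ^ 2 <> 0).
{ intros a b Hab. replace (_ ^ 2 + _)%R with ((a * a + b * b) ^ 2)%R by ring. now apply pow_nonzero. }
specialize (N2 _ _ N).
split.
- eapply is_derive_ext; [| eapply is_derive_eq].
  2: { apply is_derive_Rmult; [exact H1 | exact S]. }
  + intros t; unfold Cinv, Re, Im, Rdiv; simpl; f_equal; f_equal; ring.
  + clear S H1 H2 Hf. unfold Cinv, Cdiv, Cmult, Re, Im, Rdiv in *; simpl in *.
    destruct (f x) as [u v]; destruct df as [p q]; simpl in *.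
    field; simpl; split; [| exact N]. contradict N2; rewrite <- N2; ring.
- eapply is_derive_ext; [| eapply is_derive_eq].
  2: { apply is_derive_Rmult; [apply (is_derive_opp (K := R_AbsRing) (V := R_NormedModule) _ _ _ H2) | exact S]. }
  + intros t; unfold Cinv, Re, Im, Rdiv, opp; simpl; f_equal; f_equal; ring.
  + clear S H1 H2 Hf. unfold Cinv, Cdiv, Cmult, Re, Im, Rdiv, opp in *; simpl in *.
    destruct (f x) as [u v]; destruct df as [p q]; simpl in *.
    field; simpl; split; [| exact N]. contradict N2; rewrite <- N2; ring.
Qed.

Lemma Cderiv_comp f g x df dg : Cderiv f (g x) df -> is_derive g x dg ->
  Cderiv (fun t => f (g t)) x (RtoC dg * df).
Proof.
intros [H1 H2] H3; split.
- eapply is_derive_eq; [apply (is_derive_comp (fun t => Re (f t)) g x _ _ H1 H3) |].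
  unfold scal; simpl; unfold mult, Re, Im; simpl; ring.
- eapply is_derive_eq; [apply (is_derive_comp (fun t => Im (f t)) g x _ _ H2 H3) |].
  unfold scal; simpl; unfold mult, Re, Im; simpl; ring.
Qed.

Lemma Cderiv_Cexp f x df : Cderiv f x df -> Cderiv (fun t => Cexp (f t)) x (df * Cexp (f x)).
Proof.
intros [H1 H2].
assert (He : is_derive (fun t => exp (Re (f t))) x (Re df * exp (Re (f x)))).
{ eapply is_derive_eq; [apply (is_derive_comp exp _ x _ _ (is_derive_exp _) H1) | reflexivity]. }
split; unfold Cexp; simpl.
- eapply is_derive_eq.
  + apply is_derive_Rmult; [exact He |].
    apply (is_derive_comp cos _ x _ _ (is_derive_cos _) H2).
  + unfold scal; simpl; unfold mult, Re, Im; simpl; ring.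
- eapply is_derive_eq.
  + apply is_derive_Rmult; [exact He |].
    apply (is_derive_comp sin _ x _ _ (is_derive_sin _) H2).
  + unfold scal; simpl; unfold mult, Re, Im; simpl; ring.
Qed.

Lemma Cderiv_Rcpow (p : C) x : 0 < x ->
  Cderiv (fun t => Rcpow t p) x (p * Rcpow x (p - 1)).
Proof.
intros Hx; unfold Rcpow.
eapply Cderiv_eq.
- apply Cderiv_Cexp, Cderiv_mult; [apply Cderiv_const |].
  apply Cderiv_RtoC, is_derive_ln, Hx.
- cbv beta; change (Cexp (p * RtoC (ln x))) with (Rcpow x p).
  change (Cexp ((p - 1) * RtoC (ln x))) with (Rcpow x (p - 1)).
  rewrite <- (Rcpow_pred x p Hx), RtoC_inv by lra.
  field; intros E; apply RtoC_inj in E; lra.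
Qed.

Lemma Cderiv_exp_lin (c : C) x :
  Cderiv (fun t => Cexp (c * RtoC t)) x (c * Cexp (c * RtoC x)).
Proof.
eapply Cderiv_eq.
- apply Cderiv_Cexp, Cderiv_mult; [apply Cderiv_const |].
  apply Cderiv_RtoC, (is_derive_id (K := R_AbsRing)).
- unfold one; simpl; ring.
Qed.

Lemma Cderiv_id x : Cderiv (fun t => RtoC t) x 1.
Proof. apply Cderiv_RtoC, (is_derive_id (K := R_AbsRing)). Qed.

Lemma Cderiv_continuity f x l : Cderiv f x l ->
  continuity_pt (fun t => Re (f t)) x /\ continuity_pt (fun t => Im (f t)) x.
Proof.
intros [H1 H2]; split; apply continuity_pt_filterlim.
- apply (ex_derive_continuous (fun t => Re (f t))); eexists; exact H1.
- apply (ex_derive_continuous (fun t => Im (f t))); eexists; exact H2.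
Qed.

Lemma derive_nonneg_le (G g : R -> R) p q : p <= q ->
  (forall x, p <= x <= q -> is_derive G x (g x)) ->
  (forall x, p <= x <= q -> 0 <= g x) -> G p <= G q.
Proof.
intros Hpq HG Hg.
destruct (MVT_gen G p q g) as [c [Hc E]].
- rewrite Rmin_left, Rmax_right by lra; intros x Hx; apply HG; lra.
- rewrite Rmin_left, Rmax_right by lra; intros x Hx.
  apply continuity_pt_filterlim, (ex_derive_continuous G); exists (g x); apply HG, Hx.
- rewrite Rmin_left, Rmax_right in Hc by lra.
  generalize (Rmult_le_pos (g c) (q - p) (Hg c Hc)); lra.
Qed.

(* Project [F] on the direction of [F q - F p] and apply the real mean value theorem. *)
Lemma Cmod_increment_le F f G g p q : p <= q ->
  (forall x, p <= x <= q -> Cderiv F x (f x)) ->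
  (forall x, p <= x <= q -> is_derive G x (g x)) ->
  (forall x, p <= x <= q -> Cmod (f x) <= g x) ->
  Cmod (F q - F p) <= G q - G p.
Proof.
intros Hpq HF HG Hle.
assert (G1 : G p <= G q).
{ apply derive_nonneg_le with g; auto.
  intros x Hx; apply Rle_trans with (2 := Hle x Hx); apply Cmod_ge_0. }
set (D := (F q - F p)%C).
destruct (Rle_lt_or_eq_dec 0 (Cmod D) (Cmod_ge_0 D)) as [HD | <-]; [| lra].
apply Rmult_le_reg_l with (1 := HD).
assert (K : Cmod D * G p - (Re D * Re (F p) + Im D * Im (F p)) <=
            Cmod D * G q - (Re D * Re (F q) + Im D * Im (F q))).
{ apply derive_nonneg_le with
    (G := fun x => Cmod D * G x - (Re D * Re (F x) + Im D * Im (F x)))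
    (g := fun x => Cmod D * g x - (Re D * Re (f x) + Im D * Im (f x))); auto.
  - intros x Hx; destruct (HF x Hx) as [H1 H2].
    apply (is_derive_minus (K := R_AbsRing) (V := R_NormedModule)).
    + apply (is_derive_scal (fun x => G x)), HG, Hx.
    + apply (is_derive_plus (K := R_AbsRing) (V := R_NormedModule)).
      * apply (is_derive_scal (fun x => Re (F x))), H1.
      * apply (is_derive_scal (fun x => Im (F x))), H2.
  - intros x Hx.
    assert (Re D * Re (f x) + Im D * Im (f x) <= Cmod D * Cmod (f x)).
    { rewrite <- (Cmod_conj D), <- Cmod_mult.
      replace (_ + _) with (Re (Cconj D * f x)%C) by (unfold Re, Im; simpl; ring).
      eapply Rle_trans; [apply Rle_abs | apply re_le_Cmod]. }
    generalize (Rmult_le_compat_l (Cmod D) _ _ (Rlt_le _ _ HD) (Hle x Hx)); lra. }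
assert (E : Cmod D * Cmod D =
   (Re D * Re (F q) + Im D * Im (F q)) - (Re D * Re (F p) + Im D * Im (F p))).
{ replace (Cmod D * Cmod D) with (Cmod D ^ 2) by ring.
  rewrite Cmod2_alt; unfold D, Re, Im; simpl; ring. }
lra.
Qed.

Lemma Cderiv_zero_const F p q : p <= q ->
  (forall x, p <= x <= q -> Cderiv F x 0) -> F q = F p.
Proof.
intros Hpq H.
assert (K : Cmod (F q - F p) <= 0 - 0).
{ apply (Cmod_increment_le F (fun _ => 0%C) (fun _ => 0) (fun _ => 0)); auto.
  - intros x _; apply (is_derive_const (K := R_AbsRing) (V := R_NormedModule)).
  - intros x _; rewrite Cmod_0; lra. }
assert (E : (F q - F p = 0)%C).
{ apply Cmod_eq_0, Rle_antisym; [lra | apply Cmod_ge_0]. }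
replace (F q) with (F q - F p + F p)%C by ring; rewrite E; ring.
Qed.

(** Differentiability stands in for continuity: the derivative rules propagate it through products
    and inverses, and it yields the antiderivatives below. *)
Definition smooth_pos (f : R -> C) : Prop := forall v, 0 < v -> exists l, Cderiv f v l.

Lemma is_derive_RInt_pos (f : R -> R) : (forall v, 0 < v -> continuous f v) ->
  forall v, 0 < v -> is_derive (fun v => RInt f 1 v) v (f v).
Proof.
intros Hf v Hv.
apply (is_derive_RInt (V := R_NormedModule) f _ 1 v); [| apply Hf, Hv].
exists (mkposreal v Hv); intros t Ht.
unfold ball in Ht; simpl in Ht; unfold AbsRing_ball, abs, minus, plus, opp in Ht; simpl in Ht.
apply Rabs_def2 in Ht.
apply (RInt_correct (V := R_CompleteNormedModule)), ex_RInt_continuous.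
intros u Hu; apply Hf.
revert Hu; unfold Rmin; destruct (Rle_dec 1 t); lra.
Qed.

Lemma antiderivative_exists (f : R -> C) : smooth_pos f ->
  exists F, forall v, 0 < v -> Cderiv F v (f v).
Proof.
intros Hf.
exists (fun v => (RInt (fun t => Re (f t)) 1 v, RInt (fun t => Im (f t)) 1 v)).
intros v Hv; split; simpl.
- apply (is_derive_RInt_pos (fun t => Re (f t))); auto; intros u Hu.
  destruct (Hf u Hu) as [l [H _]]; apply (ex_derive_continuous (fun t => Re (f t))); eexists; exact H.
- apply (is_derive_RInt_pos (fun t => Im (f t))); auto; intros u Hu.
  destruct (Hf u Hu) as [l [_ H]]; apply (ex_derive_continuous (fun t => Im (f t))); eexists; exact H.
Qed.

(** * Limits of complex-valued functions *)

(** Limits are measured by the modulus, which is multiplicative; the balls of the product uniform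
    structure on [C] are squares. [Clim_of_filterlim] translates. *)
Definition Clim {T} (F : (T -> Prop) -> Prop) (f : T -> C) (l : C) : Prop :=
  forall eps, 0 < eps -> F (fun x => Cmod (f x - l) < eps).

Notation pinf := (Rbar_locally p_infty).

Lemma at_right_pos (d : R) : 0 < d -> at_right 0 (fun v => 0 < v < d).
Proof.
intros Hd; exists (mkposreal d Hd); intros v Hv Hv0.
unfold ball in Hv; simpl in Hv; unfold AbsRing_ball, abs, minus, plus, opp in Hv; simpl in Hv.
apply Rabs_def2 in Hv; lra.
Qed.

Lemma at_right_elim (P : R -> Prop) : at_right 0 P ->
  exists d, 0 < d /\ forall v, 0 < v < d -> P v.
Proof.
intros [d Hd]; exists d; split; [apply cond_pos |].
intros v Hv; apply Hd; [| lra].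
unfold ball; simpl; unfold AbsRing_ball, abs, minus, plus, opp; simpl.
apply Rabs_def1; lra.
Qed.

Lemma pinf_elim (P : R -> Prop) : pinf P ->
  exists N, 0 < N /\ forall v, N <= v -> P v.
Proof.
intros [N HN]; exists (Rmax N 0 + 1).
generalize (Rmax_l N 0) (Rmax_r N 0); intros; split; [lra |].
intros v Hv; apply HN; lra.
Qed.

Lemma pinf_gt (N : R) : pinf (fun v => N < v).
Proof. exists N; auto. Qed.

Section Clim_theory.
Context {T : Type} {F : (T -> Prop) -> Prop} {FF : ProperFilter F}.

Lemma Clim_ext_ev f g l : F (fun x => f x = g x) -> Clim F f l -> Clim F g l.
Proof.
intros E H eps He; specialize (H eps He).
generalize (filter_and _ _ E H); apply filter_imp; intros x [<- ?]; assumption.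
Qed.

Lemma Clim_const c : Clim F (fun _ => c) c.
Proof.
intros eps He; apply filter_forall; intros _.
replace (c - c)%C with (RtoC 0) by ring; rewrite Cmod_0; exact He.
Qed.

Lemma Clim_plus f g l m : Clim F f l -> Clim F g m -> Clim F (fun x => f x + g x)%C (l + m).
Proof.
intros Hf Hg eps He.
assert (P : 0 < eps / 2) by lra.
generalize (filter_and _ _ (Hf _ P) (Hg _ P)).
apply filter_imp; intros x [H1 H2].
replace (f x + g x - (l + m))%C with ((f x - l) + (g x - m))%C by ring.
eapply Rle_lt_trans; [apply Cmod_triangle | lra].
Qed.

Lemma Clim_mult_l c f l : Clim F f l -> Clim F (fun x => c * f x)%C (c * l).
Proof.
intros Hf eps He.
assert (P : 0 < Cmod c + 1) by (generalize (Cmod_ge_0 c); lra).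
assert (Q : 0 < eps / (Cmod c + 1)) by (apply Rdiv_lt_0_compat; lra).
generalize (Hf _ Q).
apply filter_imp; intros x H.
replace (c * f x - c * l)%C with (c * (f x - l))%C by ring.
rewrite Cmod_mult.
apply Rle_lt_trans with ((Cmod c + 1) * Cmod (f x - l)).
- apply Rmult_le_compat_r; [apply Cmod_ge_0 | lra].
- apply Rmult_lt_compat_l with (r := Cmod c + 1) in H; [| exact P].
  replace eps with ((Cmod c + 1) * (eps / (Cmod c + 1))) by (field; lra); exact H.
Qed.

Lemma Clim_opp f l : Clim F f l -> Clim F (fun x => - f x)%C (- l).
Proof.
intros H eps He; generalize (H eps He); apply filter_imp; intros x Hx.
rewrite <- Cmod_opp; replace (- (- f x - - l))%C with (f x - l)%C by ring; exact Hx.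
Qed.

Lemma Clim_minus f g l m : Clim F f l -> Clim F g m -> Clim F (fun x => f x - g x)%C (l - m).
Proof. intros H1 H2; apply Clim_plus; [exact H1 | apply Clim_opp, H2]. Qed.

Lemma Clim_unique f l m : Clim F f l -> Clim F f m -> l = m.
Proof.
intros H1 H2.
destruct (Req_dec (Cmod (l - m)) 0) as [E | E].
- apply Cmod_eq_0 in E; replace l with (l - m + m)%C by ring; rewrite E; ring.
- exfalso.
  assert (P : 0 < Cmod (l - m) / 2) by (generalize (Cmod_ge_0 (l - m)); lra).
  destruct (filter_ex _ (filter_and _ _ (H1 _ P) (H2 _ P))) as [x [K1 K2]].
  assert (Cmod (l - m) <= Cmod (f x - l) + Cmod (f x - m)).
  { replace (l - m)%C with ((f x - m) - (f x - l))%C by ring.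
    rewrite Rplus_comm; apply Cmod_triangle_minus. }
  lra.
Qed.

Lemma Clim_0_le f (r : T -> R) : F (fun x => Cmod (f x) <= r x) ->
  filterlim r F (locally 0) -> Clim F f 0.
Proof.
intros H1 H2 eps He.
assert (H3 : F (fun x => r x < eps)).
{ apply (H2 (fun y => y < eps)).
  exists (mkposreal eps He); intros y Hy.
  unfold ball in Hy; simpl in Hy; unfold AbsRing_ball, abs, minus, plus, opp in Hy; simpl in Hy.
  apply Rabs_def2 in Hy; lra. }
generalize (filter_and _ _ H1 H3); apply filter_imp; intros x [K1 K2].
replace (f x - 0)%C with (f x) by ring; lra.
Qed.

Lemma Clim_of_parts f l : filterlim (fun x => Re (f x)) F (locally (Re l)) ->
  filterlim (fun x => Im (f x)) F (locally (Im l)) -> Clim F f l.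
Proof.
intros H1 H2 eps He.
assert (P : 0 < eps / 2) by lra.
generalize (filter_and _ _
  (proj1 (filterlim_locally (fun x => Re (f x)) (Re l)) H1 (mkposreal _ P))
  (proj1 (filterlim_locally (fun x => Im (f x)) (Im l)) H2 (mkposreal _ P))).
apply filter_imp; intros x [K1 K2].
unfold ball in K1, K2; simpl in K1, K2.
unfold AbsRing_ball, abs, minus, plus, opp in K1, K2; simpl in K1, K2.
eapply Rle_lt_trans; [apply Cmod_le_Re_Im |].
replace (Re (f x - l)) with (Re (f x) + - Re l) by (unfold Re, Im; simpl; ring).
replace (Im (f x - l)) with (Im (f x) + - Im l) by (unfold Re, Im; simpl; ring).
lra.
Qed.

Lemma Clim_parts f l : Clim F f l ->
  filterlim (fun x => Re (f x)) F (locally (Re l)) /\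
  filterlim (fun x => Im (f x)) F (locally (Im l)).
Proof.
intros H; split; apply filterlim_locally; intros eps;
  generalize (H eps (cond_pos eps)); apply filter_imp; intros x Hx;
  unfold ball; simpl; unfold AbsRing_ball, abs, minus, plus, opp; simpl;
  eapply Rle_lt_trans; try exact Hx.
- apply (re_le_Cmod (f x - l)).
- apply (im_le_Cmod (f x - l)).
Qed.

Lemma Clim_of_filterlim (f : T -> C) (l : C) :
  filterlim f F (locally (T := C_UniformSpace) l) -> Clim F f l.
Proof.
intros H; apply Clim_of_parts;
 apply filterlim_locally; intros eps;
 generalize (proj1 (filterlim_locally (U := C_UniformSpace) f l) H eps);
 apply filter_imp; intros x [K1 K2]; assumption.
Qed.

Lemma Clim_cauchy f :
  (forall eps, 0 < eps -> exists P, F P /\ forall u v, P u -> P v -> Cmod (f u - f v) < eps) ->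
  exists l, Clim F f l.
Proof.
intros H.
assert (K : forall p : C -> R, (forall z w, Rabs (p z - p w) <= Cmod (z - w)) ->
   exists y, filterlim (fun x => p (f x)) F (locally y)).
{ intros p Hp; apply (filterlim_locally_cauchy (U := R_CompleteSpace)).
  intros eps; destruct (H eps (cond_pos eps)) as [P [HP HPe]].
  exists P; split; [exact HP |]; intros u v Hu Hv.
  unfold ball; simpl; unfold AbsRing_ball, abs, minus, plus, opp; simpl.
  eapply Rle_lt_trans; [apply Hp | apply HPe; assumption]. }
destruct (K Re) as [x Hx].
{ intros z w; replace (Re z - Re w) with (Re (z - w)%C) by (unfold Re, Im; simpl; ring); apply re_le_Cmod. }
destruct (K Im) as [y Hy].
{ intros z w; replace (Im z - Im w) with (Im (z - w)%C) by (unfold Re, Im; simpl; ring); apply im_le_Cmod. }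
exists (x, y); apply Clim_of_parts; assumption.
Qed.

Lemma Clim_bounded f l : Clim F f l -> F (fun x => Cmod (f x) <= Cmod l + 1).
Proof.
intros H; generalize (H 1 Rlt_0_1); apply filter_imp; intros x Hx.
generalize (Cmod_triangle_inv (f x) l); lra.
Qed.

Lemma Clim_norm_le f l B : Clim F f l -> F (fun x => Cmod (f x) <= B) -> Cmod l <= B.
Proof.
intros H HB; apply le_epsilon; intros eps He.
destruct (filter_ex _ (filter_and _ _ (H eps He) HB)) as [x [K1 K2]].
generalize (Cmod_triangle_inv l (f x)); rewrite Cmod_minus_sym; lra.
Qed.

End Clim_theory.

Lemma Clim_deriv f x l : Cderiv f x l -> Clim (locally x) f (f x).
Proof.
intros [H1 H2]; apply (Clim_of_parts (F := locally x)).
- apply (ex_derive_continuous (fun t => Re (f t))); eexists; exact H1.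
- apply (ex_derive_continuous (fun t => Im (f t))); eexists; exact H2.
Qed.

Lemma Rpower_lim_0 (p : R) : 0 < p -> filterlim (fun v => Rpower v p) (at_right 0) (locally 0).
Proof.
intros Hp; apply filterlim_locally; intros eps.
assert (P : 0 < Rpower eps (/ p)) by apply exp_pos.
generalize (at_right_pos _ P); apply filter_imp; intros v [Hv1 Hv2].
unfold ball; simpl; unfold AbsRing_ball, abs, minus, plus, opp; simpl.
rewrite Ropp_0, Rplus_0_r, Rabs_pos_eq by apply Rlt_le, exp_pos.
apply Rlt_le_trans with (Rpower (Rpower eps (/ p)) p).
- apply Rlt_Rpower_l; lra.
- rewrite Rpower_mult, Rinv_l, Rpower_1 by (try apply cond_pos; lra); lra.
Qed.

(** * Closure properties of differentiable functions on the positive half-line *)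

Lemma smooth_const c : smooth_pos (fun _ => c).
Proof. intros v Hv; eexists; apply Cderiv_const. Qed.

Lemma smooth_id : smooth_pos (fun v => RtoC v).
Proof. intros v Hv; eexists; apply Cderiv_id. Qed.

Lemma smooth_plus f g : smooth_pos f -> smooth_pos g -> smooth_pos (fun v => f v + g v)%C.
Proof.
intros Hf Hg v Hv; destruct (Hf v Hv), (Hg v Hv).
eexists; apply Cderiv_plus; eassumption.
Qed.

Lemma smooth_opp f : smooth_pos f -> smooth_pos (fun v => - f v)%C.
Proof. intros Hf v Hv; destruct (Hf v Hv); eexists; apply Cderiv_opp; eassumption. Qed.

Lemma smooth_mult f g : smooth_pos f -> smooth_pos g -> smooth_pos (fun v => f v * g v)%C.
Proof.
intros Hf Hg v Hv; destruct (Hf v Hv), (Hg v Hv).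
eexists; apply Cderiv_mult; eassumption.
Qed.

Lemma smooth_inv f : smooth_pos f -> (forall v, 0 < v -> f v <> 0) ->
  smooth_pos (fun v => / f v)%C.
Proof.
intros Hf Hn v Hv; destruct (Hf v Hv).
eexists; apply Cderiv_inv; [eassumption | auto].
Qed.

Lemma smooth_Rcpow p : smooth_pos (fun v => Rcpow v p).
Proof. intros v Hv; eexists; apply Cderiv_Rcpow, Hv. Qed.

Lemma smooth_exp_lin c : smooth_pos (fun v => Cexp (c * RtoC v)).
Proof. intros v Hv; eexists; apply Cderiv_exp_lin. Qed.

(** * A dominating family with bounded primitive *)

(** The derivative of [- 1 / (1 + v^t)]. For [0 < t] it behaves like [t v^(t-1)] at 0 and like
    [t v^(-t-1)] at infinity, while its primitive only climbs from -1 to 0: total mass 1 for every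
    [t]. *)
Definition dom (t v : R) : R := t * Rpower v (t - 1) / (1 + Rpower v t) ^ 2.
Definition dom_prim (t v : R) : R := - / (1 + Rpower v t).

Lemma Rpower_pos x y : 0 < Rpower x y.
Proof. apply exp_pos. Qed.

Lemma is_derive_Rpower t v : 0 < v -> is_derive (fun v => Rpower v t) v (t * Rpower v (t - 1)).
Proof. intros Hv; apply is_derive_Reals, derivable_pt_lim_power, Hv. Qed.

Lemma is_derive_dom_prim t v : 0 < v -> is_derive (dom_prim t) v (dom t v).
Proof.
intros Hv; unfold dom_prim, dom.
assert (P := Rpower_pos v t).
eapply is_derive_eq.
- apply (is_derive_opp (K := R_AbsRing) (V := R_NormedModule)), is_derive_inv; [| lra].
  apply (is_derive_plus (K := R_AbsRing) (V := R_NormedModule)).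
  + apply (is_derive_const (K := R_AbsRing) (V := R_NormedModule)).
  + apply is_derive_Rpower, Hv.
- unfold opp, plus, zero; simpl; field; lra.
Qed.

Lemma dom_prim_le_l t p q : 0 < t -> 0 < q -> dom_prim t q - dom_prim t p <= Rpower q t.
Proof.
intros Ht Hq; unfold dom_prim.
assert (P := Rpower_pos p t); assert (Q := Rpower_pos q t).
set (a := Rpower p t) in *; set (b := Rpower q t) in *.
assert (/ (1 + a) <= 1) by (rewrite <- Rinv_1; apply Rinv_le_contravar; lra).
assert (1 - b <= / (1 + b)).
{ apply Rmult_le_reg_r with (1 + b); [lra |]. rewrite Rinv_l by lra; nra. }
lra.
Qed.

Lemma dom_prim_le_r t p q : 0 < t -> 0 < p -> dom_prim t q - dom_prim t p <= Rpower p (- t).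
Proof.
intros Ht Hp; unfold dom_prim.
rewrite Rpower_Ropp.
assert (P := Rpower_pos p t); assert (Q := Rpower_pos q t).
set (a := Rpower p t) in *; set (b := Rpower q t) in *.
assert (/ (1 + a) <= / a) by (apply Rinv_le_contravar; lra).
assert (0 < / (1 + b)) by (apply Rinv_0_lt_compat; lra).
lra.
Qed.

Lemma dom_prim_le_1 t p q : dom_prim t q - dom_prim t p <= 1.
Proof.
unfold dom_prim.
assert (P := Rpower_pos p t); assert (Q := Rpower_pos q t).
set (a := Rpower p t) in *; set (b := Rpower q t) in *.
assert (/ (1 + a) <= 1) by (rewrite <- Rinv_1; apply Rinv_le_contravar; lra).
assert (0 < / (1 + b)) by (apply Rinv_0_lt_compat; lra).
lra.
Qed.

Lemma dom_pos t v : 0 < t -> 0 < dom t v.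
Proof.
intros Ht; unfold dom.
assert (P := Rpower_pos v t); assert (Q := Rpower_pos v (t - 1)).
apply Rdiv_lt_0_compat; [nra |]. apply pow_lt; lra.
Qed.

Lemma Rpower_lim_pinf t : 0 < t -> filterlim (fun v => Rpower v (- t)) pinf (locally 0).
Proof.
intros Ht; apply filterlim_locally; intros eps.
exists (Rpower eps (- / t)); intros v Hv.
assert (P := Rpower_pos eps (- / t)).
unfold ball; simpl; unfold AbsRing_ball, abs, minus, plus, opp; simpl.
rewrite Ropp_0, Rplus_0_r, Rabs_pos_eq by apply Rlt_le, exp_pos.
apply Rlt_le_trans with (Rpower (Rpower eps (- / t)) (- t)).
- rewrite !Rpower_Ropp; apply Rinv_0_lt_contravar; [apply exp_pos |].
  apply Rlt_Rpower_l; rewrite <- ?Rpower_Ropp; lra.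
- rewrite Rpower_mult. replace (- / t * - t) with 1 by (field; lra).
  rewrite Rpower_1 by apply cond_pos; lra.
Qed.

Lemma ln_le_sub_1 x : 0 < x -> ln x <= x - 1.
Proof. intros Hx; generalize (exp_ineq1_le (ln x)); rewrite exp_ln by exact Hx; lra. Qed.

(** The witness is the exact maximum [(p / b)^p exp (- p)], attained at [v = p / b]; it comes from
    [ln x <= x - 1] at [x = v / (p / b)]. *)
Lemma Rpower_exp_bound p b : 0 < p -> 0 < b ->
  exists M, 0 < M /\ forall v, 0 < v -> Rpower v p * exp (- (b * v)) <= M.
Proof.
intros Hp Hb; exists (exp (p * ln (p / b) - p)); split; [apply exp_pos |].
intros v Hv; unfold Rpower; rewrite <- exp_plus.
assert (Q : 0 < p / b) by (apply Rdiv_lt_0_compat; lra).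
assert (K : ln (v / (p / b)) <= v / (p / b) - 1) by (apply ln_le_sub_1, Rdiv_lt_0_compat; lra).
rewrite ln_div in K by lra.
assert (K2 : p * (ln v - ln (p / b)) <= p * (v / (p / b) - 1)) by (apply Rmult_le_compat_l; lra).
replace (p * (v / (p / b) - 1)) with (b * v - p) in K2 by (field; lra).
destruct (Rle_lt_or_eq_dec (p * ln v + - (b * v)) (p * ln (p / b) - p)) as [h | h]; [lra | |].
- apply Rlt_le, exp_increasing, h.
- rewrite h; lra.
Qed.

Lemma exp_le_1 x : x <= 0 -> exp x <= 1.
Proof.
intros [H | ->]; [| rewrite exp_0; lra].
rewrite <- exp_0; apply Rlt_le, exp_increasing, H.
Qed.

(** After clearing the denominator of [dom], the product [(1 + v^t)^2 exp (- b v)] expands into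
    three terms, bounded by 1, [2 * M1] and [M2]. *)
Lemma Rpower_exp_le_dom t b : 0 < t -> 0 < b ->
  exists M, 0 < M /\ forall v, 0 < v -> Rpower v (t - 1) * exp (- (b * v)) <= M * dom t v.
Proof.
intros Ht Hb.
destruct (Rpower_exp_bound t b Ht Hb) as [M1 [P1 H1]].
destruct (Rpower_exp_bound (t + t) b) as [M2 [P2 H2]]; [lra | exact Hb |].
exists ((1 + 2 * M1 + M2) / t); split; [apply Rdiv_lt_0_compat; lra |].
intros v Hv; specialize (H1 v Hv); specialize (H2 v Hv); rewrite Rpower_plus in H2.
assert (E : exp (- (b * v)) <= 1) by (apply exp_le_1; nra).
unfold dom.
assert (P := Rpower_pos v t); assert (Q := Rpower_pos v (t - 1)).
assert (S : 0 < (1 + Rpower v t) ^ 2) by (apply pow_lt; lra).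
replace (_ * (t * _ / _)) with (Rpower v (t - 1) * ((1 + 2 * M1 + M2) / (1 + Rpower v t) ^ 2))
  by (field; lra).
apply Rmult_le_compat_l; [lra |].
apply Rmult_le_reg_r with (1 := S).
replace ((1 + 2 * M1 + M2) / (1 + Rpower v t) ^ 2 * (1 + Rpower v t) ^ 2)
  with (1 + 2 * M1 + M2) by (field; lra).
replace (exp (- (b * v)) * (1 + Rpower v t) ^ 2) with
 (exp (- (b * v)) + 2 * (Rpower v t * exp (- (b * v))) + Rpower v t * Rpower v t * exp (- (b * v)))
  by ring.
lra.
Qed.

(** * Improper integrals over the positive half-line *)

Definition is_int (f : R -> C) (l : C) : Prop :=
  exists F A B, (forall v, 0 < v -> Cderiv F v (f v)) /\
    Clim (at_right 0) F A /\ Clim pinf F B /\ l = (B - A)%C.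

Lemma is_int_deriv F f A B : (forall v, 0 < v -> Cderiv F v (f v)) ->
  Clim (at_right 0) F A -> Clim pinf F B -> is_int f (B - A).
Proof. intros; exists F, A, B; auto. Qed.

Lemma is_int_ext f g l : (forall v, 0 < v -> f v = g v) -> is_int f l -> is_int g l.
Proof.
intros E (F & A & B & H1 & H2 & H3 & H4); exists F, A, B; repeat split; auto;
 rewrite <- E by assumption; apply H1; assumption.
Qed.

Lemma is_int_plus f g l m : is_int f l -> is_int g m -> is_int (fun v => f v + g v)%C (l + m).
Proof.
intros (F & A & B & H1 & H2 & H3 & ->) (F' & A' & B' & H1' & H2' & H3' & ->).
exists (fun v => F v + F' v)%C, (A + A')%C, (B + B')%C; repeat apply conj.
- intros v Hv; apply Cderiv_plus; auto.
- apply Clim_plus; auto.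
- apply Clim_plus; auto.
- ring.
Qed.

Lemma is_int_mult_l c f l : is_int f l -> is_int (fun v => c * f v)%C (c * l).
Proof.
intros (F & A & B & H1 & H2 & H3 & ->).
exists (fun v => c * F v)%C, (c * A)%C, (c * B)%C; repeat apply conj.
- intros v Hv; eapply Cderiv_eq; [apply Cderiv_mult; [apply Cderiv_const | apply H1, Hv] | cbv beta; ring].
- apply Clim_mult_l; auto.
- apply Clim_mult_l; auto.
- ring.
Qed.

Lemma is_int_minus f g l m : is_int f l -> is_int g m -> is_int (fun v => f v - g v)%C (l - m).
Proof.
intros Hf Hg.
replace (l - m)%C with (l + (- (1)) * m)%C by ring.
apply is_int_ext with (fun v => f v + (- (1)) * g v)%C; [intros; ring |].
apply is_int_plus, is_int_mult_l; assumption.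
Qed.

Lemma increment_le_dom F f M t p q : 0 < t -> 0 < p <= q ->
  (forall v, p <= v <= q -> Cderiv F v (f v)) ->
  (forall v, p <= v <= q -> Cmod (f v) <= M * dom t v) ->
  Cmod (F q - F p) <= M * (dom_prim t q - dom_prim t p).
Proof.
intros Ht Hpq HF Hf.
replace (M * (dom_prim t q - dom_prim t p)) with (M * dom_prim t q - M * dom_prim t p) by ring.
apply (Cmod_increment_le F f (fun v => M * dom_prim t v) (fun v => M * dom t v)); auto.
- apply Hpq.
- intros v Hv; apply (is_derive_scal (dom_prim t)), is_derive_dom_prim; lra.
Qed.

(** Since [dom t] has mass at most 1 whatever [t] is, the constant [M] passes unchanged from the
    integrand to the integral. *)
Lemma is_int_norm_le f l M t : 0 < t -> 0 <= M -> is_int f l ->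
  (forall v, 0 < v -> Cmod (f v) <= M * dom t v) -> Cmod l <= M.
Proof.
intros Ht HM (F & A & B & H1 & H2 & H3 & ->) Hf.
assert (K : forall p, 0 < p -> Cmod (B - F p) <= M).
{ intros p Hp.
  apply (Clim_norm_le (F := pinf) (fun v => F v - F p)%C).
  - apply Clim_minus; [exact H3 | apply Clim_const].
  - exists p; intros q Hq.
    eapply Rle_trans; [apply (increment_le_dom F f M t p q) |].
    + exact Ht.
    + lra.
    + intros; apply H1; lra.
    + intros; apply Hf; lra.
    + generalize (dom_prim_le_1 t p q); nra. }
apply (Clim_norm_le (F := at_right 0) (fun v => B - F v)%C).
- apply Clim_minus; [apply Clim_const | exact H2].
- generalize (at_right_pos 1 Rlt_0_1); apply filter_imp; intros p Hp; apply K; lra.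
Qed.

Lemma Clim_unif_scal (r : R -> R) (F : (R -> Prop) -> Prop) {FF : ProperFilter F} M eps :
  filterlim r F (locally 0) -> 0 <= M -> 0 < eps -> F (fun v => M * r v < eps).
Proof.
intros H HM He.
apply (H (fun y => M * y < eps)).
assert (P : 0 < eps / (M + 1)) by (apply Rdiv_lt_0_compat; lra).
exists (mkposreal _ P); intros y Hy.
unfold ball in Hy; simpl in Hy; unfold AbsRing_ball, abs, minus, plus, opp in Hy; simpl in Hy.
apply Rabs_def2 in Hy; destruct Hy as [Hy _].
apply Rle_lt_trans with (M * (eps / (M + 1))); [apply Rmult_le_compat_l; lra |].
apply Rmult_lt_reg_r with (M + 1); [lra |].
replace (M * (eps / (M + 1)) * (M + 1)) with (M * eps) by (field; lra); nra.
Qed.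

(** Cauchy criterion: the increment of [F] over [[u, v]] is at most [M * v^t], small near 0. At
    infinity the same role is played by [M * u^(-t)]. *)
Lemma primitive_cvg_at_0 F f M t : 0 < t -> 0 <= M ->
  (forall v, 0 < v -> Cderiv F v (f v)) ->
  at_right 0 (fun v => Cmod (f v) <= M * dom t v) ->
  exists A, Clim (at_right 0) F A.
Proof.
intros Ht HM HF Hf.
apply at_right_elim in Hf; destruct Hf as [d [Hd Hf]].
apply Clim_cauchy; intros eps He.
exists (fun v => 0 < v < d /\ M * Rpower v t < eps); split.
{ apply filter_and; [apply at_right_pos, Hd |].
  exact (Clim_unif_scal _ (at_right 0) M eps (Rpower_lim_0 t Ht) HM He). }
assert (K : forall u v, u <= v -> 0 < u < d -> 0 < v < d -> M * Rpower v t < eps ->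
   Cmod (F v - F u) < eps).
{ intros u v Huv Hu Hv Hev.
  eapply Rle_lt_trans; [apply (increment_le_dom F f M t u v) |].
  - exact Ht.
  - lra.
  - intros; apply HF; lra.
  - intros; apply Hf; lra.
  - generalize (dom_prim_le_l t u v Ht); nra. }
intros u v [Hu Hu'] [Hv Hv'].
destruct (Rle_dec u v); [rewrite Cmod_minus_sym |]; apply K; auto; lra.
Qed.

Lemma primitive_cvg_at_pinf F f M t : 0 < t -> 0 <= M ->
  (forall v, 0 < v -> Cderiv F v (f v)) ->
  pinf (fun v => Cmod (f v) <= M * dom t v) ->
  exists B, Clim pinf F B.
Proof.
intros Ht HM HF Hf.
apply pinf_elim in Hf; destruct Hf as [d [Hd Hf]].
apply Clim_cauchy; intros eps He.
exists (fun v => d < v /\ M * Rpower v (- t) < eps); split.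
{ apply filter_and; [apply pinf_gt |].
  exact (Clim_unif_scal _ pinf M eps (Rpower_lim_pinf t Ht) HM He). }
assert (K : forall u v, u <= v -> d < u -> d < v -> M * Rpower u (- t) < eps ->
   Cmod (F v - F u) < eps).
{ intros u v Huv Hu Hv Hev.
  eapply Rle_lt_trans; [apply (increment_le_dom F f M t u v) |].
  - exact Ht.
  - lra.
  - intros; apply HF; lra.
  - intros; apply Hf; lra.
  - generalize (dom_prim_le_r t u v Ht); nra. }
intros u v [Hu Hu'] [Hv Hv'].
destruct (Rle_dec u v); [rewrite Cmod_minus_sym |]; apply K; auto; lra.
Qed.

Lemma is_int_exists f M t : 0 < t -> 0 <= M -> smooth_pos f ->
  (forall v, 0 < v -> Cmod (f v) <= M * dom t v) -> exists l, is_int f l.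
Proof.
intros Ht HM Hs Hf.
destruct (antiderivative_exists f Hs) as [F HF].
destruct (primitive_cvg_at_0 F f M t Ht HM HF) as [A HA].
{ generalize (at_right_pos 1 Rlt_0_1); apply filter_imp; intros v Hv; apply Hf; lra. }
destruct (primitive_cvg_at_pinf F f M t Ht HM HF) as [B HB].
{ generalize (pinf_gt 0); apply filter_imp; intros v Hv; apply Hf; lra. }
exists (B - A)%C; apply is_int_deriv with F; assumption.
Qed.

Lemma is_int_unique f l m : is_int f l -> is_int f m -> l = m.
Proof.
intros (F & A & B & H1 & H2 & H3 & ->) (F' & A' & B' & H1' & H2' & H3' & ->).
assert (K : forall v, 0 < v -> (F v - F' v = F 1 - F' 1)%C).
{ assert (K0 : forall p q, 0 < p <= q -> (F q - F' q = F p - F' p)%C).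
  { intros p q Hpq; apply (Cderiv_zero_const (fun v => F v - F' v)%C); [lra |].
    intros x Hx; eapply Cderiv_eq; [apply Cderiv_minus; [apply H1 | apply H1']; lra | ring]. }
  intros v Hv; destruct (Rle_dec v 1); [symmetry |]; apply K0; lra. }
assert (E1 : (A - A' = F 1 - F' 1)%C).
{ apply (Clim_unique (F := at_right 0) (fun v => F v - F' v)%C); [apply Clim_minus; assumption |].
  apply Clim_ext_ev with (fun _ => F 1 - F' 1)%C; [| apply Clim_const].
  generalize (at_right_pos 1 Rlt_0_1); apply filter_imp; intros v Hv; symmetry; apply K; lra. }
assert (E2 : (B - B' = F 1 - F' 1)%C).
{ apply (Clim_unique (F := pinf) (fun v => F v - F' v)%C); [apply Clim_minus; assumption |].
  apply Clim_ext_ev with (fun _ => F 1 - F' 1)%C; [| apply Clim_const].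
  generalize (pinf_gt 0); apply filter_imp; intros v Hv; symmetry; apply K; lra. }
replace (B - A)%C with ((B - B') - (A - A') + (B' - A'))%C by ring.
rewrite E1, E2; ring.
Qed.

(** * Euler's integral for the Gamma function *)

Lemma RtoC_neq_0 (x : R) : x <> 0 -> RtoC x <> 0.
Proof. intros H E; apply H, RtoC_inj, E. Qed.

Lemma C_neq_0_Re (z : C) : 0 < Re z -> z <> 0.
Proof. intros H ->; simpl in H; lra. Qed.

Lemma Rcpow_lim_0 (p : C) : 0 < Re p -> Clim (at_right 0) (fun v => Rcpow v p) 0.
Proof.
intros Hp; apply Clim_0_le with (fun v => Rpower v (Re p)); [| apply Rpower_lim_0, Hp].
apply filter_forall; intros v; rewrite Cmod_Rcpow; lra.
Qed.

(** The product [s (s+1) ... (s+n)], with [n + 1] factors, spelled as in [is_Gamma] so that the two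
    limits agree by conversion. *)
Definition rising (s : C) (n : nat) : C :=
  fold_right Cmult 1%C (map (fun k => s + RtoC (INR k))%C (seq 0 (S n))).

Lemma rising_0 s : rising s 0 = s.
Proof. unfold rising; simpl; ring. Qed.

(** The first factor is split off, not the last, because the induction for the Beta integral moves
    from [s] to [s + 1]. *)
Lemma rising_S s n : rising s (S n) = (s * rising (s + 1) n)%C.
Proof.
unfold rising.
change (seq 0 (S (S n))) with (0%nat :: seq 1 (S n)).
rewrite <- (seq_shift (S n) 0), map_cons, map_map.
change (fold_right Cmult 1%C ((s + RtoC (INR 0))%C ::
  map (fun x => (s + RtoC (INR (S x)))%C) (seq 0 (S n)))) with
  ((s + RtoC (INR 0)) * fold_right Cmult 1%C (map (fun x => (s + RtoC (INR (S x)))%C) (seq 0 (S n))))%C.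
f_equal; [simpl; ring |].
f_equal; apply map_ext; intros k; rewrite S_INR, RtoC_plus; ring.
Qed.

Lemma rising_neq_0 n : forall s, 0 < Re s -> rising s n <> 0.
Proof.
induction n as [| n IH]; intros s Hs.
- rewrite rising_0; apply C_neq_0_Re, Hs.
- rewrite rising_S; apply Cmult_neq_0; [apply C_neq_0_Re, Hs |].
  apply IH; unfold Re in *; simpl in *; lra.
Qed.

(** The Beta integral of [u^(s-1) (1-u)^n] over [[0, 1]]. Integration by parts trades exponent
    [n + 1] at [s] for exponent [n] at [s + 1], hence the quantification over [s] inside the
    induction. As [T] tends to 0 at 0, [T 1] is the value of the integral. *)
Lemma beta_primitive n : forall s, 0 < Re s -> exists T,
  (forall u, 0 < u -> Cderiv T u (Rcpow u (s - 1) * RtoC ((1 - u) ^ n))) /\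
  Clim (at_right 0) T 0 /\ T 1 = (RtoC (INR (Factorial.fact n)) / rising s n)%C.
Proof.
induction n as [| n IH]; intros s Hs; assert (Ns := C_neq_0_Re s Hs).
- exists (fun u => / s * Rcpow u s)%C; repeat apply conj.
  + intros u Hu; eapply Cderiv_eq.
    * apply Cderiv_mult; [apply Cderiv_const | apply Cderiv_Rcpow, Hu].
    * cbv beta; simpl; field; exact Ns.
  + replace (RtoC 0) with (/ s * 0)%C by ring; apply Clim_mult_l, Rcpow_lim_0, Hs.
  + rewrite Rcpow_1_l, rising_0; simpl; field; exact Ns.
- destruct (IH (s + 1)%C) as (T & H1 & H2 & H3); [unfold Re in *; simpl in *; lra |].
  exists (fun u => / s * (Rcpow u s * RtoC ((1 - u) ^ S n) + RtoC (INR (S n)) * T u))%C.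
  repeat apply conj.
  + intros u Hu; eapply Cderiv_eq.
    * apply Cderiv_mult; [apply Cderiv_const |].
      apply Cderiv_plus.
      -- apply Cderiv_mult; [apply Cderiv_Rcpow, Hu |].
         apply Cderiv_RtoC with (l := - INR (S n) * (1 - u) ^ n).
         apply is_derive_Reals; auto_derive; [exact I |]. change (match n with O => 1 | S _ => INR n + 1 end) with (INR (S n)); unfold Rminus. ring.
      -- apply Cderiv_mult; [apply Cderiv_const | apply H1, Hu].
    * cbv beta. replace (s + 1 - 1)%C with s by ring.
      rewrite RtoC_mult, RtoC_opp; field; exact Ns.
  + replace (RtoC 0) with (/ s * (0 + RtoC (INR (S n)) * 0))%C by ring.
    apply Clim_mult_l, Clim_plus; [| apply Clim_mult_l, H2].
    apply Clim_0_le with (fun v => Rpower v (Re s)); [| apply Rpower_lim_0, Hs].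
    generalize (at_right_pos 1 Rlt_0_1); apply filter_imp; intros v Hv.
    rewrite Cmod_mult, Cmod_Rcpow, Cmod_R, Rabs_pos_eq by (apply pow_le; lra).
    assert ((1 - v) ^ S n <= 1) by (eapply Rle_trans; [apply (pow_incr _ 1); lra | rewrite pow1; lra]).
    assert (0 <= (1 - v) ^ S n) by (apply pow_le; lra).
    generalize (Rpower_pos v (Re s)); nra.
  + rewrite H3, rising_S, Rcpow_1_l.
    replace ((1 - 1) ^ S n) with 0 by (simpl; ring).
    change (Factorial.fact (S n)) with (S n * Factorial.fact n)%nat.
    rewrite mult_INR, RtoC_mult; field; split; [apply rising_neq_0; unfold Re in *; simpl in *; lra | exact Ns].
Qed.

Lemma bernoulli x n : 0 <= x <= 1 -> 1 - INR n * x <= (1 - x) ^ n.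
Proof.
intros Hx; induction n as [| n IH]; [unfold Re in *; simpl in *; lra |].
assert (0 <= (1 - x) ^ n) by (apply pow_le; lra).
rewrite S_INR, <- tech_pow_Rmult.
assert (0 <= INR n) by apply pos_INR. nra.
Qed.

(** With [x = v / n], the upper bound on the power is [1 - x <= exp (- x)]. For the lower one,
    [1 + x <= exp x] gives [(1 - x^2)^n <= exp v (1 - x)^n], and Bernoulli's inequality bounds the
    left side below by [1 - v^2 / n]. *)
Lemma exp_minus_pow_bound v n : (0 < n)%nat -> 0 <= v <= INR n ->
  Rabs (exp (- v) - (1 - v / INR n) ^ n) <= v ^ 2 * exp (- v) / INR n.
Proof.
intros Hn Hv.
assert (Pn : 0 < INR n) by (apply lt_0_INR; exact Hn).
set (x := v / INR n).
assert (Hx : 0 <= x <= 1).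
{ unfold x; split; [apply Rdiv_le_0_compat; lra |].
  apply Rmult_le_reg_r with (1 := Pn); unfold Rdiv; rewrite Rmult_assoc, Rinv_l; lra. }
assert (Ev : v = INR n * x) by (unfold x; field; lra).
assert (Ep : forall y, exp (INR n * y) = exp y ^ n).
{ intros y; rewrite <- Rpower_pow by apply exp_pos; unfold Rpower; rewrite ln_exp; reflexivity. }
assert (U : (1 - x) ^ n <= exp (- v)).
{ replace (- v) with (INR n * - x) by (rewrite Ev; ring); rewrite Ep.
  apply pow_incr; generalize (exp_ineq1_le (- x)); lra. }
assert (L : exp (- v) * (1 - v ^ 2 / INR n) <= (1 - x) ^ n).
{ assert (K : (1 - x ^ 2) ^ n <= exp v * (1 - x) ^ n).
  { rewrite Ev, Ep, <- Rpow_mult_distr; apply pow_incr; split; [nra |].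
    generalize (exp_ineq1_le x); nra. }
  assert (K2 : 1 - INR n * x ^ 2 <= (1 - x ^ 2) ^ n) by (apply bernoulli; nra).
  replace (INR n * x ^ 2) with (v ^ 2 / INR n) in K2 by (unfold x; field; lra).
  apply Rmult_le_reg_l with (exp v); [apply exp_pos |].
  rewrite <- Rmult_assoc, <- exp_plus, Rplus_opp_r, exp_0; lra. }
rewrite Rabs_pos_eq by lra.
replace (v ^ 2 * exp (- v) / INR n) with (exp (- v) * (v ^ 2 / INR n)) by (field; lra).
lra.
Qed.

(** The integrand of [Gamma s / b^s]. *)
Definition gker (s b : C) (v : R) : C := (Rcpow v (s - 1) * Cexp (- b * RtoC v))%C.

Lemma smooth_gker s b : smooth_pos (gker s b).
Proof. apply smooth_mult; [apply smooth_Rcpow | apply smooth_exp_lin]. Qed.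

Lemma Cmod_gker s b v :
  Cmod (gker s b v) = Rpower v (Re s - 1) * exp (- (Re b * v)).
Proof.
unfold gker; rewrite Cmod_mult, Cmod_Rcpow, Cmod_Cexp.
f_equal; f_equal; unfold Re; simpl; ring.
Qed.

Lemma gker_int_exists s b : 0 < Re s -> 0 < Re b -> exists l, is_int (gker s b) l.
Proof.
intros Hs Hb; destruct (Rpower_exp_le_dom (Re s) (Re b) Hs Hb) as [M [HM H]].
apply is_int_exists with M (Re s); auto; [lra | apply smooth_gker |].
intros v Hv; rewrite Cmod_gker; auto.
Qed.

Lemma Rpower_plus_2 v p : 0 < v -> Rpower v (p + 2 - 1) = Rpower v (p - 1) * v ^ 2.
Proof.
intros Hv; replace (p + 2 - 1) with (p - 1 + INR 2) by (simpl; ring).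
rewrite Rpower_plus, Rpower_pow by exact Hv; reflexivity.
Qed.

(** Gauss's product is the integral of [v^(s-1) (1 - v/n)^n] over [[0, n]]. By the previous bound it
    differs from the integral of [v^(s-1) exp (- v)] over [[0, n]] by at most the integral of
    [v^(Re s + 1) exp (- v) / n], which is [O(1/n)]; the extra [v^2] explains the exponent
    [Re s + 2]. *)
Lemma Gauss_limit s G : 0 < Re s -> is_int (gker s 1) G ->
  Clim eventually (fun n => RtoC (INR (Factorial.fact n)) * Rcpow (INR n) s / rising s n)%C G.
Proof.
intros Hs (Y & A & B & HY & HA & HB & ->).
destruct (Rpower_exp_le_dom (Re s + 2) 1) as [M [HM H]]; [lra | lra |].
assert (K : forall n, (0 < n)%nat ->
  Cmod (Y (INR n) - A - RtoC (INR (Factorial.fact n)) * Rcpow (INR n) s / rising s n) <= M / INR n).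
{ intros n Hn.
  assert (Pn : 0 < INR n) by (apply lt_0_INR; exact Hn).
  destruct (beta_primitive n s Hs) as (T & T1 & T2 & T3).
  (* The substitution [u = v / n]: [X] is a primitive of [v^(s-1) (1 - v/n)^n] vanishing at 0, and
     [X n] is Gauss's product. *)
  set (X := fun v : R => (Rcpow (INR n) s * T (v / INR n)%R)%C).
  assert (XP : forall v, 0 < v -> Cderiv X v (Rcpow v (s - 1) * RtoC ((1 - v / INR n) ^ n))).
  { intros v Hv; unfold X; eapply Cderiv_eq.
    - apply Cderiv_mult; [apply Cderiv_const |].
      eapply (Cderiv_comp T (fun v => v / INR n) v _ (/ INR n)).
      + apply T1, Rdiv_lt_0_compat; assumption.
      + apply is_derive_Reals; auto_derive; [exact I | ring].
    - cbv beta. set (r := RtoC ((1 - v / INR n) ^ n)).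
      assert (E : Rcpow v (s - 1) = (Rcpow (INR n) (s - 1) * Rcpow (v / INR n) (s - 1))%C).
      { rewrite <- Rcpow_mult; [| exact Pn | apply Rdiv_lt_0_compat; assumption].
        f_equal; field; lra. }
      rewrite E, <- (Rcpow_pred (INR n) s Pn), RtoC_inv by lra.
      field; apply RtoC_neq_0; lra. }
  assert (X0 : Clim (at_right 0) X 0).
  { intros eps He.
    assert (L : Clim (at_right 0) (fun u => Rcpow (INR n) s * T u)%C 0).
    { replace (RtoC 0) with (Rcpow (INR n) s * 0)%C by ring; apply Clim_mult_l, T2. }
    destruct (at_right_elim _ (L eps He)) as [d [Hd Ld]].
    assert (P : 0 < d * INR n) by (apply Rmult_lt_0_compat; assumption).
    generalize (at_right_pos _ P); apply filter_imp; intros v Hv; apply Ld.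
    split; [apply Rdiv_lt_0_compat; lra |].
    apply Rmult_lt_reg_r with (1 := Pn); unfold Rdiv; rewrite Rmult_assoc, Rinv_l; lra. }
  replace (Y (INR n) - A - RtoC (INR (Factorial.fact n)) * Rcpow (INR n) s / rising s n)%C
    with (Y (INR n) - X (INR n) - (A - 0))%C.
  2: { unfold X; replace (INR n / INR n) with 1 by (field; lra).
       rewrite T3; field; apply rising_neq_0, Hs. }
  apply (Clim_norm_le (F := at_right 0)
    (fun p => Y (INR n) - X (INR n) - (Y p - X p))%C).
  { apply Clim_minus; [apply Clim_const | apply Clim_minus; assumption]. }
  generalize (at_right_pos _ Pn); apply filter_imp; intros p Hp.
  eapply Rle_trans.
  - apply (increment_le_dom (fun v => Y v - X v)%C
      (fun v => gker s 1 v - Rcpow v (s - 1) * RtoC ((1 - v / INR n) ^ n))%C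
      (M / INR n) (Re s + 2)); [lra | lra | |].
    + intros v Hv; apply Cderiv_minus; [apply HY | apply XP]; lra.
    + intros v Hv; unfold gker.
      replace (_ - _)%C with (Rcpow v (s - 1) * RtoC (exp (- v) - (1 - v / INR n) ^ n))%C.
      2: { rewrite RtoC_minus, <- Cexp_RtoC.
           replace (- (1) * RtoC v)%C with (RtoC (- v)) by (rewrite RtoC_opp; ring). ring. }
      rewrite Cmod_mult, Cmod_Rcpow, Cmod_R.
      replace (Re (s - 1)) with (Re s - 1) by (unfold Re; simpl; ring).
      eapply Rle_trans; [apply Rmult_le_compat_l; [apply Rlt_le, Rpower_pos |] |].
      * apply exp_minus_pow_bound; [exact Hn | lra].
      * specialize (H v ltac:(lra)); rewrite Rpower_plus_2, Rmult_1_l in H by lra.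
        replace (_ * (_ / _)) with (Rpower v (Re s - 1) * v ^ 2 * exp (- v) / INR n) by (field; lra).
        replace (M / INR n * _) with (M * dom (Re s + 2) v / INR n) by (field; lra).
        apply Rmult_le_compat_r; [apply Rlt_le, Rinv_0_lt_compat, Pn | exact H].
  - generalize (dom_prim_le_1 (Re s + 2) p (INR n)).
    assert (0 < M / INR n) by (apply Rdiv_lt_0_compat; assumption). nra. }
intros eps He.
assert (Q : 0 < eps / 2) by lra.
destruct (pinf_elim _ (HB _ Q)) as [N1 [PN1 HN1]].
destruct (pinf_elim _ (pinf_gt (2 * M / eps))) as [N2 [PN2 HN2]].
destruct (nfloor_ex (N1 + N2)) as [m Hm]; [lra |].
exists (S m); intros n Hn.
assert (Hn' : INR (S m) <= INR n) by (apply le_INR; exact Hn).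
rewrite S_INR in Hn'.
specialize (K n ltac:(lia)); specialize (HN1 (INR n) ltac:(lra)); specialize (HN2 (INR n) ltac:(lra)).
assert (M / INR n < eps / 2).
{ assert (Pn : 0 < INR n) by lra.
  apply Rmult_lt_reg_r with (1 := Pn); unfold Rdiv at 1; rewrite Rmult_assoc, Rinv_l by lra.
  apply Rmult_lt_compat_r with (r := eps / 2) in HN2; [| lra].
  replace (2 * M / eps * (eps / 2)) with M in HN2 by (field; lra). lra. }
match goal with |- Cmod (?x - _) < _ =>
  replace (x - (B - A))%C with ((Y (INR n) - B) - (Y (INR n) - A - x))%C by ring end.
eapply Rle_lt_trans; [apply Cmod_triangle_minus | lra].
Qed.

Lemma gker_lim_pinf s b : 0 < Re b -> Clim pinf (fun v => Rcpow v s * Cexp (- b * RtoC v))%C 0.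
Proof.
intros Hb.
(* For [v >= 1] one has [v^(Re s) <= v^(p-1)], and a bound on [v^p exp (- Re b v)] then leaves
   [M / v]. *)
set (p := Rabs (Re s) + 1).
assert (Hp : 0 < p) by (generalize (Rabs_pos (Re s)); unfold p; lra).
destruct (Rpower_exp_bound p (Re b) Hp Hb) as [M [HM H]].
assert (L : filterlim (fun v => M * Rpower v (- (1))) pinf (locally 0)).
{ replace 0 with (M * 0) by ring.
  apply (filterlim_comp _ _ _ (fun v => Rpower v (- (1))) (fun y => M * y) _ (locally 0)).
  - apply Rpower_lim_pinf, Rlt_0_1.
  - apply (filterlim_scal_r (K := R_AbsRing) (V := R_NormedModule) M 0). }
apply Clim_0_le with (2 := L).
exists 1; intros v Hv.
rewrite Cmod_mult, Cmod_Rcpow, Cmod_Cexp.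
replace (Re (- b * RtoC v)) with (- (Re b * v)) by (unfold Re; simpl; ring).
apply Rle_trans with (Rpower v (p + - (1)) * exp (- (Re b * v))).
- apply Rmult_le_compat_r; [apply Rlt_le, exp_pos |].
  apply Rle_Rpower; [lra |]; unfold p; generalize (Rle_abs (Re s)); lra.
- rewrite Rpower_plus, (Rmult_comm (Rpower v p)), Rmult_assoc, (Rmult_comm M).
  apply Rmult_le_compat_l; [apply Rlt_le, Rpower_pos |]; apply H; lra.
Qed.

(** The derivative of [v^s exp (- b v)] is [s * gker s b - b * gker (s + 1) b], and both of its
    boundary values are 0. *)
Lemma gker_succ s b l : 0 < Re s -> 0 < Re b -> is_int (gker s b) l ->
  is_int (gker (s + 1) b) (s / b * l).
Proof.
intros Hs Hb H.
assert (Nb := C_neq_0_Re b Hb).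
assert (P : is_int (fun v => s * gker s b v - b * gker (s + 1) b v)%C (0 - 0)).
{ apply is_int_deriv with (fun v => Rcpow v s * Cexp (- b * RtoC v))%C.
  - intros v Hv; eapply Cderiv_eq.
    + apply Cderiv_mult; [apply Cderiv_Rcpow, Hv | apply Cderiv_exp_lin].
    + unfold gker; cbv beta; replace (s + 1 - 1)%C with s by ring; ring.
  - apply Clim_0_le with (fun v => Rpower v (Re s)); [| apply Rpower_lim_0, Hs].
    generalize (at_right_pos 1 Rlt_0_1); apply filter_imp; intros v Hv.
    rewrite Cmod_mult, Cmod_Rcpow, Cmod_Cexp.
    assert (exp (Re (- b * RtoC v)) <= 1).
    { apply exp_le_1; unfold Re in *; simpl; nra. }
    generalize (Rpower_pos v (Re s)); nra.
  - apply gker_lim_pinf, Hb. }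
replace (s / b * l)%C with (/ b * (s * l - (0 - 0)))%C by (field; exact Nb).
apply is_int_ext with
  (fun v => / b * (s * gker s b v - (s * gker s b v - b * gker (s + 1) b v)))%C.
- intros v Hv; field; exact Nb.
- apply is_int_mult_l, is_int_minus; [apply is_int_mult_l, H | exact P].
Qed.

Lemma gker_int_Rscale s x l : 0 < x -> is_int (gker s 1) l ->
  is_int (gker s x) (l / Rcpow x s).
Proof.
intros Hx (F & A & B & HF & HA & HB & ->).
assert (N := Rcpow_neq_0 x s).
replace ((B - A) / Rcpow x s)%C with (/ Rcpow x s * B - / Rcpow x s * A)%C by (field; exact N).
apply is_int_deriv with (fun v => / Rcpow x s * F (x * v)%R)%C.
- intros v Hv; eapply Cderiv_eq.
  + apply Cderiv_mult; [apply Cderiv_const |].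
    eapply (Cderiv_comp F (fun v => x * v) v _ x).
    * apply HF, Rmult_lt_0_compat; assumption.
    * apply is_derive_Reals; auto_derive; [exact I | ring].
  + unfold gker; cbv beta.
    rewrite Rcpow_mult, RtoC_mult by assumption.
    replace (- (1) * (RtoC x * RtoC v))%C with (- RtoC x * RtoC v)%C by ring.
    rewrite <- (Rcpow_pred x s Hx); field.
    split; [apply RtoC_neq_0; lra | apply Rcpow_neq_0].
- apply Clim_mult_l; intros eps He.
  destruct (at_right_elim _ (HA eps He)) as [d [Hd Ld]].
  assert (P : 0 < d / x) by (apply Rdiv_lt_0_compat; assumption).
  generalize (at_right_pos _ P); apply filter_imp; intros v Hv; apply Ld.
  split; [apply Rmult_lt_0_compat; lra |].
  replace d with (x * (d / x)) by (field; lra); apply Rmult_lt_compat_l; lra.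
- apply Clim_mult_l; intros eps He.
  destruct (pinf_elim _ (HB eps He)) as [d [Hd Ld]].
  exists (d / x); intros v Hv; apply Ld.
  replace d with (x * (d / x)) by (field; lra); apply Rmult_le_compat_l; lra.
Qed.

Lemma Cexp_taylor_1 (y : R) : Cmod (Cexp (Ci * RtoC y) - 1) <= Rabs y.
Proof.
set (F := fun t : R => Cexp (Ci * RtoC y * RtoC t)%C).
assert (D : forall t, Cderiv F t (Ci * RtoC y * F t)).
{ intros t; apply Cderiv_exp_lin. }
replace (Cexp (Ci * RtoC y) - 1)%C with (F 1 - F 0)%C.
2: { unfold F; rewrite Cmult_1_r, Cmult_0_r, Cexp_0; reflexivity. }
replace (Rabs y) with (Rabs y * 1 - Rabs y * 0) by ring.
apply (Cmod_increment_le F _ (fun t => Rabs y * t) (fun _ => Rabs y) 0 1 Rle_0_1 (fun t _ => D t)).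
- intros t _; apply is_derive_Reals; auto_derive; [exact I | ring].
- intros t _; unfold F; rewrite !Cmod_mult, Cmod_Ci, Cmod_R, Cmod_Cexp.
  replace (Re (Ci * RtoC y * RtoC t)) with 0 by (unfold Re; simpl; ring).
  rewrite exp_0; lra.
Qed.

Lemma Cexp_taylor_2 (y : R) : Cmod (Cexp (Ci * RtoC y) - 1 - Ci * RtoC y) <= y ^ 2.
Proof.
set (F := fun t : R => (Cexp (Ci * RtoC y * RtoC t) - Ci * RtoC y * RtoC t)%C).
replace (Cexp (Ci * RtoC y) - 1 - Ci * RtoC y)%C with (F 1 - F 0)%C.
2: { unfold F; rewrite !Cmult_1_r, !Cmult_0_r, Cexp_0; ring. }
replace (y ^ 2) with (y ^ 2 * 1 - y ^ 2 * 0) by ring.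
apply (Cmod_increment_le F (fun t => Ci * RtoC y * (Cexp (Ci * RtoC (y * t)) - 1))%C
   (fun t => y ^ 2 * t) (fun _ => y ^ 2) 0 1 Rle_0_1).
- intros t _; eapply Cderiv_eq.
  + apply Cderiv_minus; [apply Cderiv_exp_lin |].
    apply Cderiv_mult; [apply Cderiv_const | apply Cderiv_id].
  + cbv beta; rewrite RtoC_mult, Cmult_assoc; ring.
- intros t _; apply is_derive_Reals; auto_derive; [exact I | ring].
- intros t Ht; rewrite !Cmod_mult, Cmod_Ci, Cmod_R.
  eapply Rle_trans; [apply Rmult_le_compat_l; [| apply Cexp_taylor_1] |].
  + generalize (Rabs_pos y); lra.
  + rewrite Rabs_mult, (Rabs_pos_eq t), <- (pow2_abs y) by lra.
    generalize (Rabs_pos y); nra.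
Qed.

(** The substitute for differentiation under the integral sign: a quadratic remainder in the
    integrand, dominated uniformly in [h], integrates to a quadratic remainder of the integral. *)
Lemma Cderiv_of_quadratic e t l M : 0 <= M ->
  (forall h : R, Cmod (e (t + h)%R - e t - RtoC h * l) <= M * h ^ 2) -> Cderiv e t l.
Proof.
intros HM H.
assert (K : forall p : C -> R, (forall z, Rabs (p z) <= Cmod z) ->
   (forall h : R, p (e (t + h)%R - e t - RtoC h * l)%C = p (e (t + h)%R) - p (e t) - h * p l) ->
   is_derive (fun t => p (e t)) t (p l)).
{ intros p Hp Hl; apply is_derive_Reals; intros eps He.
  assert (P : 0 < eps / (M + 1)) by (apply Rdiv_lt_0_compat; lra).
  exists (mkposreal _ P); intros h Hh Hd; simpl in Hd.
  replace ((p (e (t + h)%R) - p (e t)) / h - p l) with (p (e (t + h)%R - e t - RtoC h * l)%C / h)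
    by (rewrite Hl; field; exact Hh).
  assert (Ph : 0 < Rabs h) by (apply Rabs_pos_lt, Hh).
  unfold Rdiv; rewrite Rabs_mult, Rabs_inv.
  apply Rmult_lt_reg_r with (1 := Ph); rewrite Rmult_assoc, Rinv_l, Rmult_1_r by lra.
  eapply Rle_lt_trans; [apply Hp |]; eapply Rle_lt_trans; [apply H |].
  rewrite <- pow2_abs.
  assert ((M + 1) * Rabs h < eps).
  { replace eps with ((M + 1) * (eps / (M + 1))) by (field; lra).
    apply Rmult_lt_compat_l; lra. }
  nra. }
split.
- apply K; [apply re_le_Cmod | intros h; unfold Re; simpl; ring].
- apply K; [apply im_le_Cmod | intros h; unfold Im; simpl; ring].
Qed.

(* Along the vertical segment from [Re b] to [b], both the integral and [b ^ (- s)]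
   solve [e' = - i y (s / b) e]. *)
Lemma gker_int s b G : 0 < Re s -> 0 < Re b -> is_int (gker s 1) G ->
  is_int (gker s b) (G / Defs.Cpow b s).
Proof.
intros Hs Hb HG.
set (x := Re b); set (y := Im b); fold x in Hb.
set (c := fun t : R => (x, t * y)%R : C).
assert (Hc : forall t, 0 < Re (c t)) by (intros t; exact Hb).
(* The value of the integral at the point [c t] of the segment from [x] to [b]; choice turns
   existence at each [t] into a function that can be differentiated. *)
set (e := fun t => epsilon (inhabits (RtoC 0)) (is_int (gker s (c t)))).
assert (He : forall t, is_int (gker s (c t)) (e t)).
{ intros t; apply epsilon_spec, gker_int_exists; auto. }
destruct (Rpower_exp_le_dom (Re s + 2) x) as [M [HM HMd]]; [lra | exact Hb |].
assert (De : forall t, Cderiv e t (- (Ci * RtoC y) * (s / c t * e t))).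
{ intros t; apply Cderiv_of_quadratic with (y ^ 2 * M); [nra |].
  intros h.
  apply is_int_norm_le with (t := Re s + 2) (f := fun v =>
    (gker s (c (t + h)%R) v - gker s (c t) v
      - (RtoC h * - (Ci * RtoC y)) * gker (s + 1) (c t) v)%C).
  - lra.
  - apply Rmult_le_pos; [apply Rmult_le_pos; [apply pow2_ge_0 | lra] | apply pow2_ge_0].
  - replace (RtoC h * (- (Ci * RtoC y) * (s / c t * e t)))%C
      with (RtoC h * - (Ci * RtoC y) * (s / c t * e t))%C by ring.
    apply is_int_minus; [apply is_int_minus; apply He |].
    apply is_int_mult_l, gker_succ; auto.
  - intros v Hv.
    (* Moving from [t] to [t + h] multiplies the integrand by [exp (- i h y v)], so what remains is
       a second-order Taylor remainder of size [(h y v)^2]. The factor [v^2] again raises the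
       exponent to [Re s + 2]. *)
    replace (_ - _ - _)%C with
      (gker s (c t) v * (Cexp (Ci * RtoC (- (h * y * v))) - 1 - Ci * RtoC (- (h * y * v))))%C.
    2: { unfold gker.
         replace (- c (t + h)%R * RtoC v)%C with (- c t * RtoC v + Ci * RtoC (- (h * y * v)))%C
           by (unfold c; apply C_eq; unfold Re, Im; simpl; ring).
         rewrite Cexp_plus; replace (s + 1 - 1)%C with s by ring.
         rewrite <- (Rcpow_pred v s Hv), RtoC_opp, !RtoC_mult; ring. }
    rewrite Cmod_mult, Cmod_gker.
    eapply Rle_trans; [apply Rmult_le_compat_l; [| apply Cexp_taylor_2] |].
    + apply Rlt_le, Rmult_lt_0_compat; [apply Rpower_pos | apply exp_pos].
    + specialize (HMd v Hv); rewrite Rpower_plus_2 in HMd by exact Hv.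
      change (Re (c t)) with x.
      replace (_ * _ * _ ^ 2) with
       ((y * h) ^ 2 * (Rpower v (Re s - 1) * v ^ 2 * exp (- (x * v)))) by ring.
      replace (_ * M * _ * _) with ((y * h) ^ 2 * (M * dom (Re s + 2) v)) by ring.
      apply Rmult_le_compat_l; [apply pow2_ge_0 | exact HMd]. }
assert (Nc : forall t, c t <> 0) by (intros t; apply C_neq_0_Re, Hc).
(* An explicit form of the principal logarithm along the segment: the real part stays equal to
   [x > 0], so [Carg] keeps its [atan] branch and no cut is crossed. *)
set (lg := fun t : R => ((/ 2 * ln (x * x + t * y * (t * y)))%R, atan (t * y / x)) : C).
assert (Pq : forall t, 0 < x * x + t * y * (t * y)).
{ intros t; generalize (Rle_0_sqr (t * y)); unfold Rsqr; nra. }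
assert (Dl : forall t, Cderiv lg t (Ci * RtoC y / c t)).
{ intros t; specialize (Pq t).
  assert (Q2 : x * (x * 1) + t * y * (t * y * 1) <> 0) by nra.
  split.
  - apply is_derive_Reals; unfold lg; simpl; auto_derive; [exact Pq |].
    unfold c, Re; simpl; field; nra.
  - apply is_derive_Reals; unfold lg; simpl; auto_derive; [lra |].
    unfold c, Im; simpl; field; repeat split; try exact Q2; try lra; nra. }
assert (Lg : forall t, lg t = CLog (c t)).
{ intros t; unfold lg, CLog, Carg, c; simpl.
  destruct (Rlt_dec 0 x) as [_ | n]; [| contradiction].
  apply C_eq; simpl; [| reflexivity].
  unfold Cmod; simpl.
  replace (x * (x * 1) + t * y * (t * y * 1)) with (x * x + t * y * (t * y)) by ring.
  rewrite <- Rpower_sqrt by apply Pq; unfold Rpower; rewrite ln_exp; reflexivity. }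
(* The logarithmic derivatives of [e] and of [c^s] are opposite, so their product is constant. At
   [t = 0] the base is real and scaling gives its value [G]. *)
assert (E : (e 1 * Cexp (s * lg 1) = e 0 * Cexp (s * lg 0))%C).
{ apply (Cderiv_zero_const (fun t => e t * Cexp (s * lg t))%C); [lra |].
  intros t _; eapply Cderiv_eq.
  - apply Cderiv_mult; [apply De |].
    apply Cderiv_Cexp, Cderiv_mult; [apply Cderiv_const | apply Dl].
  - cbv beta; field; apply Nc. }
assert (E0 : e 0 = (G / Rcpow x s)%C).
{ apply is_int_unique with (gker s (c 0)); [apply He |].
  replace (c 0) with (RtoC x) by (unfold c; apply C_eq; simpl; ring).
  apply gker_int_Rscale; assumption. }
assert (E1 : Cexp (s * lg 0) = Rcpow x s).
{ unfold Rcpow; do 2 f_equal; unfold lg, RtoC; f_equal.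
  - replace (x * x + 0 * y * (0 * y)) with (x * x) by ring.
    rewrite ln_mult by exact Hb; field.
  - replace (0 * y / x) with 0 by (field; lra); apply atan_0. }
assert (Eb : c 1 = b) by (unfold c; apply C_eq; simpl; [reflexivity | unfold y; ring]).
assert (F := He 1); rewrite Eb in F.
replace (G / Defs.Cpow b s)%C with (e 1); [exact F |].
unfold Defs.Cpow; rewrite <- Eb, <- Lg.
assert (N1 := Cexp_neq_0 (s * lg 1)).
replace (e 1) with (e 1 * Cexp (s * lg 1) / Cexp (s * lg 1))%C by (field; exact N1).
rewrite E, E0, E1; field; split; [exact N1 | apply Rcpow_neq_0].
Qed.

(** * The Lerch kernel *)

Definition lerch_den (z : C) (w : R) : C := (1 - z * Cexp (- (1) * RtoC w))%C.

Definition lerch_ker (z a : C) (w : R) : C :=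
  (Cexp (- a * RtoC w) / (lerch_den z w * RtoC w))%C.

Lemma Cexp_opp_RtoC w : Cexp (- (1) * RtoC w) = RtoC (exp (- w)).
Proof. rewrite <- Cexp_RtoC, RtoC_opp; f_equal; ring. Qed.

Lemma exp_opp_lt_1 w : 0 < w -> exp (- w) < 1.
Proof. intros Hw; rewrite <- exp_0; apply exp_increasing; lra. Qed.

Lemma lerch_den_neq_0 z w : Cmod z <= 1 -> 0 < w -> lerch_den z w <> 0.
Proof.
intros Hz Hw; unfold lerch_den; rewrite Cexp_opp_RtoC; apply Cmod_gt_0.
generalize (Cmod_triangle_inv 1 (z * RtoC (exp (- w)))) (exp_pos (- w)) (exp_opp_lt_1 w Hw).
rewrite Cmod_mult, Cmod_1, Cmod_R, Rabs_pos_eq by apply Rlt_le, exp_pos.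
generalize (Cmod_ge_0 z); nra.
Qed.

Lemma Cderiv_lerch_den z w : Cderiv (lerch_den z) w (z * Cexp (- (1) * RtoC w)).
Proof.
unfold lerch_den; eapply Cderiv_eq.
- apply Cderiv_minus; [apply Cderiv_const |].
  apply Cderiv_mult; [apply Cderiv_const | apply Cderiv_exp_lin].
- cbv beta; ring.
Qed.

Lemma smooth_lerch_den z : smooth_pos (lerch_den z).
Proof. intros w _; eexists; apply Cderiv_lerch_den. Qed.

Lemma smooth_lerch_ker z a : Cmod z <= 1 -> smooth_pos (lerch_ker z a).
Proof.
intros Hz; apply smooth_mult; [apply smooth_exp_lin |].
apply (smooth_inv (fun w => lerch_den z w * RtoC w)%C).
- apply smooth_mult; [apply smooth_lerch_den | apply smooth_id].
- intros w Hw; apply Cmult_neq_0; [apply lerch_den_neq_0; assumption | apply RtoC_neq_0; lra].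
Qed.

Lemma Cmod_lerch_exp_le z w : Cmod z <= 1 -> 0 < w -> Cmod (z * Cexp (- (1) * RtoC w)) <= 1.
Proof.
intros Hz Hw; rewrite Cexp_opp_RtoC, Cmod_mult, Cmod_R, Rabs_pos_eq by apply Rlt_le, exp_pos.
generalize (exp_pos (- w)) (exp_opp_lt_1 w Hw) (Cmod_ge_0 z); nra.
Qed.

Lemma Cmod_lerch_den_le z w : Cmod z <= 1 -> 0 < w -> Cmod (lerch_den z w) <= 2.
Proof.
intros Hz Hw; unfold lerch_den; eapply Rle_trans; [apply Cmod_triangle_minus |].
generalize (Cmod_lerch_exp_le z w Hz Hw); rewrite Cmod_1; lra.
Qed.

(* [m] is the order of vanishing of [lerch_den z] at [0]. *)
Definition den_order (z : C) (m : R) : Prop :=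
  (m = 0 \/ m = 1) /\
  (forall w, 0 < w <= 1 -> Cmod (lerch_den z w) <= 2 * Rpower w m) /\
  (exists M, 0 < M /\ forall w, 0 < w -> / Cmod (lerch_den z w) <= M * (1 + w) * Rpower w (- m)).

Lemma den_order_exists z : Cmod z <= 1 -> exists m, den_order z m.
Proof.
intros Hz; destruct (Req_dec (Cmod (1 - z)) 0) as [E | E].
- apply Cmod_eq_0 in E.
  assert (Ez : z = RtoC 1) by (replace z with (1 - (1 - z))%C by ring; rewrite E; ring).
  subst z; exists 1.
  assert (F : forall w, 0 < w -> Cmod (lerch_den 1 w) = 1 - exp (- w)).
  { intros w Hw; unfold lerch_den; rewrite Cexp_opp_RtoC, <- RtoC_mult, <- RtoC_minus, Cmod_R.
    generalize (exp_opp_lt_1 w Hw); intros; rewrite Rabs_pos_eq; lra. }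
  split; [right; reflexivity | split].
  + intros w Hw; rewrite F, Rpower_1 by lra; generalize (exp_ineq1_le (- w)); lra.
  + exists 1; split; [lra |]; intros w Hw; rewrite F, Rpower_Ropp, Rpower_1 by lra.
    (* Equivalent to [exp (- w) <= 1 / (1 + w)]. This is the source of the factor [1 + w] in
       [den_order]: one estimate serves both small and large [w]. *)
    assert (P : w / (1 + w) <= 1 - exp (- w)).
    { assert (exp (- w) <= / (1 + w)).
      { rewrite exp_Ropp; apply Rinv_le_contravar; [lra | apply exp_ineq1_le]. }
      replace (w / (1 + w)) with (1 - / (1 + w)) by (field; lra); lra. }
    replace (1 * (1 + w) * / w) with (/ (w / (1 + w))) by (field; lra).
    apply Rinv_le_contravar; [apply Rdiv_lt_0_compat; lra | exact P].
- exists 0.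
  assert (P : 0 < Cmod (1 - z)) by (generalize (Cmod_ge_0 (1 - z)); lra).
  split; [left; reflexivity | split].
  + intros w Hw; rewrite Rpower_O by lra.
    generalize (Cmod_lerch_den_le z w Hz); lra.
  + exists (2 / Cmod (1 - z)); split; [apply Rdiv_lt_0_compat; lra |].
    intros w Hw; rewrite Ropp_0, Rpower_O by lra.
    (* Two lower bounds, [1 - r] and [|1 - z| - (1 - r)], add up to [|1 - z|], so one of them is at
       least half of it. This covers the points of the unit circle other than 1. *)
    assert (Q : Cmod (1 - z) / 2 <= Cmod (lerch_den z w)).
    { unfold lerch_den; rewrite Cexp_opp_RtoC; set (r := exp (- w)).
      assert (0 < r < 1) by (split; [apply exp_pos | apply exp_opp_lt_1, Hw]).
      assert (1 - r <= Cmod (1 - z * RtoC r)).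
      { generalize (Cmod_triangle_inv 1 (z * RtoC r)).
        rewrite Cmod_mult, Cmod_1, Cmod_R, Rabs_pos_eq by lra.
        generalize (Cmod_ge_0 z); nra. }
      assert (Cmod (1 - z) - (1 - r) <= Cmod (1 - z * RtoC r)).
      { replace (1 - z)%C with ((1 - z * RtoC r) - z * RtoC (1 - r))%C
          by (rewrite RtoC_minus; ring).
        generalize (Cmod_triangle_minus (1 - z * RtoC r) (z * RtoC (1 - r))).
        rewrite (Cmod_mult z), (Cmod_R (1 - r)), (Rabs_pos_eq (1 - r)) by lra.
        generalize (Cmod_ge_0 z); nra. }
      lra. }
    apply Rle_trans with (2 / Cmod (1 - z)).
    * replace (2 / Cmod (1 - z)) with (/ (Cmod (1 - z) / 2)) by (field; lra).
      apply Rinv_le_contravar; lra.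
    * assert (0 < 2 / Cmod (1 - z)) by (apply Rdiv_lt_0_compat; lra). nra.
Qed.

(** * Restrictions on the parameters forced by convergence *)

Lemma exp_ge_sqr x : 0 <= x -> (x / 2) ^ 2 <= exp x.
Proof.
intros Hx; replace x with (x / 2 + x / 2) at 2 by field; rewrite exp_plus.
generalize (exp_ineq1_le (x / 2)); nra.
Qed.

(* Integrating [w q(w) lerch_ker = exp (- a w)] by parts bounds the exponential by a linear
   function as soon as the primitive is bounded. *)
Lemma lerch_ker_primitive_Re_nonneg (z a : C) Psi B : Cmod z <= 1 -> a <> 0 ->
  (forall v, 0 < v -> Cderiv Psi v (lerch_ker z a v)) ->
  Clim pinf Psi B -> 0 <= Re a.
Proof.
intros Hz Ha HP HB.
destruct (Rle_dec 0 (Re a)) as [h | h]; [exact h | exfalso].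
set (be := - Re a); assert (Hbe : 0 < be) by (unfold be; lra).
destruct (pinf_elim _ (Clim_bounded _ _ HB)) as [N [HN HNb]].
set (b := Cmod B + 1) in *.
assert (Hb : 0 <= b) by (unfold b; generalize (Cmod_ge_0 B); lra).
(* The derivative of [F] is [- (w q)' Psi] with [q = lerch_den z]; the exponential has dropped out,
   and the rest is bounded because [Psi] converges. *)
set (F := fun w => (Cexp (- a * RtoC w) / (- a) - lerch_den z w * RtoC w * Psi w)%C).
set (E1 := fun w : R => (z * Cexp (- (1) * RtoC w))%C).
assert (Pa : 0 < Cmod a) by (apply Cmod_gt_0, Ha).
assert (DF : forall w, 0 < w -> Cderiv F w (- (E1 w * RtoC w + lerch_den z w) * Psi w)).
{ intros w Hw; unfold F; eapply Cderiv_eq.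
  - apply Cderiv_minus.
    + apply Cderiv_mult; [apply Cderiv_exp_lin | apply Cderiv_const].
    + apply Cderiv_mult; [| apply HP, Hw].
      apply Cderiv_mult; [apply Cderiv_lerch_den | apply Cderiv_id].
  - cbv beta; unfold lerch_ker, E1; field; repeat split.
    + apply RtoC_neq_0; lra.
    + apply lerch_den_neq_0; assumption.
    + contradict Ha; replace a with (- - a)%C by ring; rewrite Ha; ring. }
(* The coefficient [5 * b] adds [3 * b] for the growth of [F] and [2 * b] for the boundary term
   [W q(W) Psi(W)]. *)
assert (K : forall W, N <= W -> exp (be * W) <= Cmod a * (Cmod (F N) + 5 * b * W)).
{ intros W HW.
  assert (I1 : Cmod (F W - F N) <= 3 * b * W - 3 * b * N).
  { apply (Cmod_increment_le F (fun w => - (E1 w * RtoC w + lerch_den z w) * Psi w)%C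
      (fun w => 3 * b * w) (fun _ => 3 * b)); [exact HW | | |].
    - intros x Hx; apply DF; lra.
    - intros x _; apply is_derive_Reals; auto_derive; [exact I | ring].
    - intros x Hx; rewrite Cmod_mult, Cmod_opp.
      apply Rmult_le_compat; try apply Cmod_ge_0; [| apply HNb; lra].
      eapply Rle_trans; [apply Cmod_triangle |].
      assert (Cmod (E1 x * RtoC x) <= 1).
      { unfold E1; rewrite Cexp_opp_RtoC, !Cmod_mult, !Cmod_R, !Rabs_pos_eq
          by (try apply Rlt_le, exp_pos; lra).
        assert (exp (- x) * x <= 1).
        { rewrite exp_Ropp.
          generalize (exp_ineq1_le x) (exp_pos x); intros.
          apply Rmult_le_reg_l with (exp x); [assumption |].
          rewrite <- Rmult_assoc, Rinv_r by lra; lra. }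
        generalize (Cmod_ge_0 z) (exp_pos (- x)); nra. }
      generalize (Cmod_lerch_den_le z x Hz); lra. }
  assert (I2 : Cmod (lerch_den z W * RtoC W * Psi W) <= 2 * W * b).
  { rewrite !Cmod_mult, Cmod_R, Rabs_pos_eq by lra.
    apply Rmult_le_compat; [| apply Cmod_ge_0 | | apply HNb, HW].
    - generalize (Cmod_ge_0 (lerch_den z W)); nra.
    - apply Rmult_le_compat_r; [lra | apply Cmod_lerch_den_le; [exact Hz | lra]]. }
  assert (E : exp (be * W) = Cmod a * Cmod (Cexp (- a * RtoC W) / - a)).
  { rewrite <- Cmod_mult, <- Cmod_opp.
    replace (- (a * (Cexp (- a * RtoC W) / - a)))%C with (Cexp (- a * RtoC W)).
    - rewrite Cmod_Cexp; f_equal; unfold be, Re; simpl; ring.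
    - field; contradict Ha; replace a with (- - a)%C by ring; rewrite Ha; ring. }
  rewrite E; apply Rmult_le_compat_l; [lra |].
  replace (Cexp (- a * RtoC W) / - a)%C with
    (F N + (F W - F N) + lerch_den z W * RtoC W * Psi W)%C by (unfold F; ring).
  eapply Rle_trans; [apply Cmod_triangle |].
  eapply Rle_trans; [apply Rplus_le_compat_r, Cmod_triangle |]. nra. }
set (A0 := Cmod a * Cmod (F N)); set (A1 := Cmod a * (5 * b)).
assert (HA0 : 0 <= A0) by (apply Rmult_le_pos; apply Cmod_ge_0).
assert (HA1 : 0 <= A1) by (apply Rmult_le_pos; lra).
(* Chosen so that [be^2 W >= 4 (A0 + A1 + 1)]; then the minorant [(be W / 2)^2] of the exponential
   exceeds [A0 + A1 W]. *)
set (W := N + 1 + 4 * (A0 + A1 + 1) / be ^ 2).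
assert (Q : 0 < 4 * (A0 + A1 + 1) / be ^ 2) by (apply Rdiv_lt_0_compat; [lra | nra]).
assert (HW : 1 <= W) by (unfold W; lra).
specialize (K W ltac:(unfold W; lra)).
assert (K1 : (be * W / 2) ^ 2 <= exp (be * W)) by (apply exp_ge_sqr; nra).
assert (K2 : (be * W / 2) ^ 2 <= A0 + A1 * W) by (unfold A0, A1; lra).
assert (K3 : 4 * (A0 + A1 + 1) <= be ^ 2 * W).
{ replace (4 * (A0 + A1 + 1)) with (be ^ 2 * (4 * (A0 + A1 + 1) / be ^ 2)) by (field; lra).
  apply Rmult_le_compat_l; [nra | unfold W; lra]. }
assert (K4 : 4 * (A0 + A1 + 1) * W <= be ^ 2 * W * W) by (apply Rmult_le_compat_r; lra).
nra.
Qed.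

Lemma Clim_exp_lin_0 c : Clim (at_right 0) (fun v => Cexp (c * RtoC v)) 1.
Proof.
assert (H : Clim (locally 0) (fun v => Cexp (c * RtoC v)) (Cexp (c * 0))).
{ apply (Clim_deriv (fun v => Cexp (c * RtoC v)) 0 (c * Cexp (c * 0))), Cderiv_exp_lin. }
rewrite Cmult_0_r, Cexp_0 in H.
intros eps He; specialize (H eps He); unfold at_right, within.
revert H; apply filter_imp; intros v Hv _; exact Hv.
Qed.

(* Test the relation [(v q) (v^(1-s) K')' = - s exp (- a v)] against the bump
   [(v - d)^2 (2 d - v)^2] on [d, 2 d]; after two integrations by parts only the small quantity
   [K - K0] is left, while the right-hand side is of exact order [d^5]. *)
Lemma lerch_order_lt_Re_s (z s a : C) m Psi B K K0 : Cmod z <= 1 -> s <> 0 -> den_order z m ->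
  (forall v, 0 < v -> Cderiv Psi v (lerch_ker z a v)) ->
  (forall v, 0 < v -> Cderiv K v (s * Rcpow v (s - 1) * (B - Psi v))) ->
  Clim (at_right 0) K K0 -> m < Re s.
Proof.
intros Hz Ns (Hm & Hq & _) HP HK HK0.
destruct (Rlt_dec m (Re s)) as [h | h]; [exact h | exfalso].
assert (Ps : 0 < Cmod s) by (apply Cmod_gt_0, Ns).
set (D := Cmod (1 - s)).
assert (HD : 0 <= D) by apply Cmod_ge_0.
(* In units of [d^4 v^m], the terms of [v P2] are bounded by 16, 24 and 3, and those of [P1] by 8
   and 3. The choice of [eta] makes the error term at most [d^4 / 120] pointwise. *)
set (C0 := 43 + 11 * D).
set (eta := Cmod s / (120 * C0)).
assert (Heta : 0 < eta) by (apply Rdiv_lt_0_compat; unfold C0; lra).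
assert (Hhalf : 0 < / 2) by lra.
destruct (at_right_elim _ (filter_and _ _ (HK0 eta Heta) (Clim_exp_lin_0 (- a) (/ 2) Hhalf)))
  as [d0 [Hd0 Hd]].
set (d := Rmin (d0 / 4) (/ 4)).
assert (Pd : 0 < d /\ 2 * d < d0 /\ 2 * d <= 1).
{ unfold d; generalize (Rmin_l (d0 / 4) (/ 4)) (Rmin_r (d0 / 4) (/ 4)); intros.
  split; [apply Rmin_glb_lt; lra | lra]. }
destruct Pd as (Pd & Pd0 & Pd1).
set (chi := fun v => (v - d) ^ 2 * (2 * d - v) ^ 2).
set (chi1 := fun v => 2 * (v - d) * (2 * d - v) * (3 * d - 2 * v)).
set (chi2 := fun v => 2 * d ^ 2 - 12 * d * (v - d) + 12 * (v - d) ^ 2).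
assert (Dchi : forall v, is_derive chi v (chi1 v)).
{ intros v; apply is_derive_Reals; unfold chi, chi1; auto_derive; [exact I | ring]. }
assert (Dchi1 : forall v, is_derive chi1 v (chi2 v)).
{ intros v; apply is_derive_Reals; unfold chi1, chi2; auto_derive; [exact I | ring]. }
assert (Bchi : forall v, d <= v <= 2 * d -> 0 <= chi v <= d ^ 4).
{ intros v Hv; unfold chi.
  assert (0 <= (v - d) * (2 * d - v) <= d ^ 2) by nra.
  replace (_ ^ 2 * _ ^ 2) with (((v - d) * (2 * d - v)) ^ 2) by ring.
  split; [apply pow2_ge_0 |].
  replace (d ^ 4) with ((d ^ 2) ^ 2) by ring; apply pow_incr; assumption. }
assert (Bchi1 : forall v, d <= v <= 2 * d -> Rabs (chi1 v) <= 2 * d ^ 3).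
{ intros v Hv; unfold chi1; rewrite !Rabs_mult.
  rewrite (Rabs_pos_eq 2), (Rabs_pos_eq (v - d)), (Rabs_pos_eq (2 * d - v)) by lra.
  assert (Rabs (3 * d - 2 * v) <= d) by (apply Rabs_le; lra).
  assert (0 <= (v - d) * (2 * d - v) <= d ^ 2) by nra.
  replace (2 * (v - d) * (2 * d - v) * _) with (2 * ((v - d) * (2 * d - v) * Rabs (3 * d - 2 * v))) by ring.
  replace (2 * d ^ 3) with (2 * (d ^ 2 * d)) by ring.
  apply Rmult_le_compat_l; [lra |].
  apply Rmult_le_compat; try lra; apply Rabs_pos. }
assert (Bchi2 : forall v, d <= v <= 2 * d -> Rabs (chi2 v) <= 2 * d ^ 2).
{ intros v Hv; unfold chi2; apply Rabs_le.
  generalize (pow2_ge_0 (2 * (v - d) - d)) (Rmult_le_pos (v - d) (2 * d - v)); intros; split; nra. }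
set (E1 := fun w : R => (z * Cexp (- (1) * RtoC w))%C).
set (Q := fun v : R => (lerch_den z v * RtoC v)%C).
set (Q1 := fun v : R => (E1 v * RtoC v + lerch_den z v)%C).
set (Q2 := fun v : R => (2 * E1 v - E1 v * RtoC v)%C).
assert (DE1 : forall v, Cderiv E1 v (- E1 v)).
{ intros v; unfold E1; eapply Cderiv_eq;
   [apply Cderiv_mult; [apply Cderiv_const | apply Cderiv_exp_lin] | cbv beta; ring]. }
assert (DQ : forall v, Cderiv Q v (Q1 v)).
{ intros v; unfold Q, Q1; eapply Cderiv_eq;
   [apply Cderiv_mult; [apply Cderiv_lerch_den | apply Cderiv_id] | unfold E1; ring]. }
assert (DQ1 : forall v, Cderiv Q1 v (Q2 v)).
{ intros v; unfold Q1, Q2; eapply Cderiv_eq;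
   [apply Cderiv_plus; [apply Cderiv_mult; [apply DE1 | apply Cderiv_id] | apply Cderiv_lerch_den]
   | unfold E1; ring]. }
(* [v^m] absorbs [v^(- Re s)], since [Re s <= m] *)
assert (Pw : forall v, 0 < v <= 1 -> Rpower v m * Rpower v (- Re s) <= 1).
{ intros v Hv; rewrite <- Rpower_plus; unfold Rpower.
  apply exp_le_1.
  assert (ln v <= 0) by (rewrite <- ln_1; apply ln_le; lra).
  nra. }
assert (Pm : forall v, 0 < v <= 1 -> v <= Rpower v m <= 1).
{ intros v Hv; destruct Hm as [-> | ->]; rewrite ?Rpower_O, ?Rpower_1; lra. }
assert (BQ : forall v, 0 < v <= 1 -> Cmod (Q v) <= 2 * (v * Rpower v m)).
{ intros v Hv; unfold Q; rewrite Cmod_mult, Cmod_R, Rabs_pos_eq by lra.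
  generalize (Hq v Hv); nra. }
assert (BQ1 : forall v, 0 < v <= 1 -> Cmod (Q1 v) <= 3 * Rpower v m).
{ intros v Hv; unfold Q1; eapply Rle_trans; [apply Cmod_triangle |].
  rewrite Cmod_mult, Cmod_R, Rabs_pos_eq by lra.
  assert (Cmod (E1 v) <= 1) by (apply Cmod_lerch_exp_le; lra).
  generalize (Hq v Hv) (Pm v Hv) (Cmod_ge_0 (E1 v)); nra. }
(* [Q2] is only known to be bounded; the factor [v] supplies [v^m], as [m <= 1]. *)
assert (BQ2 : forall v, 0 < v <= 1 -> v * Cmod (Q2 v) <= 3 * Rpower v m).
{ intros v Hv; unfold Q2.
  assert (Cmod (2 * E1 v - E1 v * RtoC v) <= 3).
  { replace (2 * E1 v - E1 v * RtoC v)%C with (E1 v * RtoC (2 - v))%C by (rewrite RtoC_minus; ring).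
    rewrite Cmod_mult, Cmod_R, Rabs_pos_eq by lra.
    assert (Cmod (E1 v) <= 1) by (apply Cmod_lerch_exp_le; lra).
    generalize (Cmod_ge_0 (E1 v)); nra. }
  generalize (Pm v Hv); nra. }
set (P1 := fun v => (RtoC (chi1 v) * Q v + RtoC (chi v) * Q1 v)%C).
set (P2 := fun v => (RtoC (chi2 v) * Q v + 2 * RtoC (chi1 v) * Q1 v + RtoC (chi v) * Q2 v)%C).
assert (DP1 : forall v, Cderiv P1 v (P2 v)).
{ intros v; unfold P1, P2; eapply Cderiv_eq.
  - apply Cderiv_plus; apply Cderiv_mult; try apply DQ; try apply DQ1; apply Cderiv_RtoC;
      [apply Dchi1 | apply Dchi].
  - cbv beta; ring. }
set (P' := fun v => (P2 v * Rcpow v (1 - s) + (1 - s) * P1 v * Rcpow v (- s))%C).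
assert (BP' : forall v, d <= v <= 2 * d -> Cmod (P' v) <= C0 * d ^ 4).
{ intros v Hv.
  assert (V1 : 0 < v <= 1) by lra.
  assert (E : P' v = ((P2 v * RtoC v + (1 - s) * P1 v) * Rcpow v (- s))%C).
  { unfold P'; replace (1 - s)%C with (- s + 1)%C at 1 by ring.
    rewrite Rcpow_plus, Rcpow_1 by lra; ring. }
  rewrite E, Cmod_mult, Cmod_Rcpow.
  replace (Re (- s)) with (- Re s) by (unfold Re; simpl; ring).
  specialize (Pw v V1); specialize (Pm v V1).
  specialize (BQ v V1); specialize (BQ1 v V1); specialize (BQ2 v V1).
  specialize (Bchi v Hv); specialize (Bchi1 v Hv); specialize (Bchi2 v Hv).
  assert (X : Cmod (P2 v * RtoC v + (1 - s) * P1 v) <= C0 * d ^ 4 * Rpower v m).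
  { set (r := Rpower v m) in *.
    assert (A1 : Cmod (P2 v * RtoC v) <= 43 * d ^ 4 * r).
    { unfold P2.
      replace ((RtoC (chi2 v) * Q v + 2 * RtoC (chi1 v) * Q1 v + RtoC (chi v) * Q2 v) * RtoC v)%C
       with (RtoC (chi2 v * v) * Q v + RtoC (2 * chi1 v * v) * Q1 v + RtoC (chi v) * (RtoC v * Q2 v))%C
       by (rewrite !RtoC_mult; ring).
      eapply Rle_trans; [apply Cmod_triangle |].
      eapply Rle_trans; [apply Rplus_le_compat_r, Cmod_triangle |].
      rewrite !Cmod_mult, !Cmod_R, !Rabs_mult, (Rabs_pos_eq v), (Rabs_pos_eq 2),
        (Rabs_pos_eq (chi v)) by lra.
      assert (T1 : Rabs (chi2 v) * v * Cmod (Q v) <= 2 * d ^ 2 * (2 * d) * (2 * (2 * d * r))).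
      { apply Rmult_le_compat; [| apply Cmod_ge_0 | |].
        - apply Rmult_le_pos; [apply Rabs_pos | lra].
        - apply Rmult_le_compat; try lra; apply Rabs_pos.
        - nra. }
      assert (T2 : 2 * Rabs (chi1 v) * v * Cmod (Q1 v) <= 2 * (2 * d ^ 3) * (2 * d) * (3 * r)).
      { apply Rmult_le_compat; [| apply Cmod_ge_0 | | assumption].
        - generalize (Rabs_pos (chi1 v)); nra.
        - apply Rmult_le_compat; try lra. generalize (Rabs_pos (chi1 v)); lra. }
      assert (T3 : chi v * (v * Cmod (Q2 v)) <= d ^ 4 * (3 * r)).
      { apply Rmult_le_compat; try lra. generalize (Cmod_ge_0 (Q2 v)); nra. }
      nra. }
    assert (A2 : Cmod (P1 v) <= 11 * d ^ 4 * r).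
    { unfold P1; eapply Rle_trans; [apply Cmod_triangle |].
      rewrite !Cmod_mult, !Cmod_R, (Rabs_pos_eq (chi v)) by lra.
      assert (T1 : Rabs (chi1 v) * Cmod (Q v) <= 2 * d ^ 3 * (2 * (2 * d * r))).
      { apply Rmult_le_compat; [apply Rabs_pos | apply Cmod_ge_0 | assumption | nra]. }
      assert (T3 : chi v * Cmod (Q1 v) <= d ^ 4 * (3 * r)).
      { apply Rmult_le_compat; try lra. apply Cmod_ge_0. }
      nra. }
    eapply Rle_trans; [apply Cmod_triangle |].
    rewrite (Cmod_mult (1 - s)); fold D.
    apply Rmult_le_compat_l with (r := D) in A2; [| exact HD].
    unfold C0; lra. }
  apply Rle_trans with (C0 * d ^ 4 * Rpower v m * Rpower v (- Re s)).
  - apply Rmult_le_compat_r; [apply Rlt_le, Rpower_pos | exact X].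
  - rewrite Rmult_assoc. rewrite <- (Rmult_1_r (C0 * d ^ 4)) at 2.
    apply Rmult_le_compat_l; [| exact Pw].
    apply Rmult_le_pos; [unfold C0; lra | apply pow_le; lra]. }
(* Both integrations by parts at once. The derivative of [chi Q] times [B - Psi] cancels against the
   derivative of [K], so only [chi exp (- a v)] and a multiple of [K - K0] survive. [W] vanishes at
   [d] and [2 d] because [chi] has double zeros there. *)
set (W := fun v => (RtoC (chi v) * Q v * (B - Psi v)
                     - / s * (P1 v * Rcpow v (1 - s) * (K v - K0)))%C).
assert (DW : forall v, 0 < v ->
   Cderiv W v (- RtoC (chi v) * Cexp (- a * RtoC v) - / s * (P' v * (K v - K0)))).
{ intros v Hv; unfold W; eapply Cderiv_eq.
  - apply Cderiv_minus.
    + apply Cderiv_mult.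
      * apply Cderiv_mult; [apply Cderiv_RtoC, Dchi | apply DQ].
      * apply Cderiv_minus; [apply Cderiv_const | apply HP, Hv].
    + apply Cderiv_mult; [apply Cderiv_const |].
      apply Cderiv_mult; [apply Cderiv_mult; [apply DP1 | apply Cderiv_Rcpow, Hv] |].
      apply Cderiv_minus; [apply HK, Hv | apply Cderiv_const].
  - cbv beta; unfold P'.
    replace (1 - s - 1)%C with (- s)%C by ring.
    assert (E : (Rcpow v (1 - s) * Rcpow v (s - 1) = 1)%C).
    { rewrite <- Rcpow_plus, <- (Rcpow_0 v); f_equal; ring. }
    assert (E2 : (Q v * lerch_ker z a v = Cexp (- a * RtoC v))%C).
    { unfold Q, lerch_ker; field; split; [apply RtoC_neq_0; lra | apply lerch_den_neq_0; assumption]. }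
    rewrite <- E2.
    transitivity ((RtoC (chi1 v) * Q v + RtoC (chi v) * Q1 v) * (B - Psi v)
       - RtoC (chi v) * (Q v * lerch_ker z a v)
       - / s * (P2 v * Rcpow v (1 - s) + (1 - s) * P1 v * Rcpow v (- s)) * (K v - K0)
       - (/ s * s) * (Rcpow v (1 - s) * Rcpow v (s - 1)) * P1 v * (B - Psi v))%C; [ring |].
    rewrite E, Cinv_l by exact Ns; unfold P1; ring. }
assert (W1 : W d = 0).
{ unfold W, P1; replace (chi d) with 0 by (unfold chi; ring);
   replace (chi1 d) with 0 by (unfold chi1; ring); ring. }
assert (W2 : W (2 * d) = 0).
{ unfold W, P1; replace (chi (2 * d)) with 0 by (unfold chi; ring);
   replace (chi1 (2 * d)) with 0 by (unfold chi1; ring); ring. }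
set (X := fun v => d ^ 2 * (v - d) ^ 3 / 3 - d * (v - d) ^ 4 / 2 + (v - d) ^ 5 / 5).
assert (DX : forall v, is_derive X v (chi v)).
{ intros v; apply is_derive_Reals; unfold X, chi; auto_derive; [exact I | field]. }
(* The bump has integral [d^5 / 30]. As [Re (exp (- a v)) >= 1/2] near 0, the main term contributes
   at least [d^5 / 60], and the error at most [d^5 / 120]: impossible with both boundary values
   0. *)
assert (Fin : - Re (W d) - / 2 * X d + d ^ 4 / 120 * d <=
              - Re (W (2 * d)) - / 2 * X (2 * d) + d ^ 4 / 120 * (2 * d)).
{ apply derive_nonneg_le with (G := fun v => - Re (W v) - / 2 * X v + d ^ 4 / 120 * v)
    (g := fun v => - Re (- RtoC (chi v) * Cexp (- a * RtoC v) - / s * (P' v * (K v - K0)))%C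
                   - / 2 * chi v + d ^ 4 / 120).
  - lra.
  - intros v Hv; destruct (DW v ltac:(lra)) as [DWr _].
    apply (is_derive_plus (K := R_AbsRing) (V := R_NormedModule)).
    + apply (is_derive_minus (K := R_AbsRing) (V := R_NormedModule)).
      * apply (is_derive_opp (K := R_AbsRing) (V := R_NormedModule)), DWr.
      * apply (is_derive_scal X), DX.
    + apply is_derive_Reals; auto_derive; [exact I | field].
  - intros v Hv.
    destruct (Hd v ltac:(lra)) as [Hk He].
    specialize (BP' v Hv); specialize (Bchi v Hv).
    set (u := Cexp (- a * RtoC v)) in *; set (t := (/ s * (P' v * (K v - K0)))%C).
    replace (Re (- RtoC (chi v) * u - t)) with (- (chi v * Re u) - Re t) by (unfold Re; simpl; ring).
    assert (Hu : / 2 <= Re u).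
    { generalize (re_le_Cmod (u - 1)); unfold Rabs; destruct (Rcase_abs _);
       replace (Re (u - 1)) with (Re u - 1) in * by (unfold Re; simpl; ring); lra. }
    assert (Ht : - (d ^ 4 / 120) <= Re t).
    { assert (Cmod t <= d ^ 4 / 120).
      { unfold t; rewrite !Cmod_mult, Cmod_inv by exact Ns.
        apply Rmult_le_reg_l with (Cmod s); [exact Ps |].
        rewrite <- Rmult_assoc, Rinv_r, Rmult_1_l by lra.
        replace (Cmod s * (d ^ 4 / 120)) with (C0 * d ^ 4 * eta)
          by (unfold eta; field; unfold C0; lra).
        apply Rmult_le_compat; try apply Cmod_ge_0; lra. }
      generalize (re_le_Cmod t); unfold Rabs; destruct (Rcase_abs _); lra. }
    nra. }
rewrite W1, W2 in Fin.
assert (P5 : 0 < d ^ 5) by (apply pow_lt; lra).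
unfold X in Fin; simpl Re in Fin. nra.
Qed.

(** * The boundary term at 0 and Abel summation *)

Lemma Cmod_exp_lin_le_1 (a : C) v : 0 <= Re a -> 0 <= v -> Cmod (Cexp (- a * RtoC v)) <= 1.
Proof.
intros Ha Hv; rewrite Cmod_Cexp; apply exp_le_1; unfold Re in *; simpl; nra.
Qed.

Lemma lerch_boundary_term_0 (z s a : C) m Psi B : Cmod z <= 1 -> 0 <= Re a -> den_order z m ->
  m < Re s -> (forall v, 0 < v -> Cderiv Psi v (lerch_ker z a v)) ->
  Clim (at_right 0) (fun v => Rcpow v s * (B - Psi v))%C 0.
Proof.
intros Hz Ha (Hm & _ & M & HM & HMq) Hs HP.
(* The kernel is [O(w^(-m-1))], whose primitive is a logarithm when [m = 0]. Weakening the exponent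
   from [m] to [p = m + eta] avoids the case distinction and still leaves [v^(Re s - p) = v^eta],
   which tends to 0. *)
set (eta := (Re s - m) / 2).
assert (Heta : 0 < eta) by (unfold eta; lra).
assert (Hm0 : 0 <= m) by (destruct Hm as [-> | ->]; lra).
set (p := m + eta); assert (Hp : 0 < p) by (unfold p; lra).
assert (Inc : forall v, 0 < v <= 1 -> Cmod (Psi 1 - Psi v) <= 2 * M / p * Rpower v (- p)).
{ intros v Hv.
  apply Rle_trans with (- (2 * M / p) * Rpower 1 (- p) - - (2 * M / p) * Rpower v (- p)).
  - apply (Cmod_increment_le Psi (lerch_ker z a) (fun w => - (2 * M / p) * Rpower w (- p))
      (fun w => 2 * M * Rpower w (- p - 1))).
    + lra.
    + intros w Hw; apply HP; lra.
    + intros w Hw; eapply is_derive_eq.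
      * apply (is_derive_scal (fun w => Rpower w (- p))), is_derive_Rpower; lra.
      * field; lra.
    + intros w Hw; unfold lerch_ker.
      assert (Nq := lerch_den_neq_0 z w Hz ltac:(lra)).
      rewrite Cmod_div, Cmod_mult, Cmod_R, Rabs_pos_eq
        by (try apply Cmult_neq_0; try apply RtoC_neq_0; try assumption; lra).
      assert (U1 := Cmod_exp_lin_le_1 a w Ha ltac:(lra)).
      assert (U2 := HMq w ltac:(lra)).
      assert (U3 : Rpower w (- m) * / w <= Rpower w (- p - 1)).
      { rewrite <- (Rpower_1 w) at 2 by lra; rewrite <- Rpower_Ropp, <- Rpower_plus.
        unfold Rpower.
        assert (ln w <= 0) by (rewrite <- ln_1; apply ln_le; lra).
        destruct (Req_dec ((- m + - (1)) * ln w) ((- p - 1) * ln w)) as [-> | Ne]; [lra |].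
        apply Rlt_le, exp_increasing; unfold p in *; nra. }
      unfold Rdiv; rewrite Rinv_mult.
      assert (Qi : 0 < / Cmod (lerch_den z w)) by (apply Rinv_0_lt_compat, Cmod_gt_0, Nq).
      assert (Wi : 0 < / w) by (apply Rinv_0_lt_compat; lra).
      apply Rle_trans with (1 * (M * 2 * Rpower w (- m) * / w)).
      * apply Rmult_le_compat; try assumption; [apply Cmod_ge_0 | nra |].
        apply Rmult_le_compat_r; [lra |].
        eapply Rle_trans; [exact U2 |].
        apply Rmult_le_compat_r; [apply Rlt_le, Rpower_pos |]; nra.
      * nra.
  - assert (0 < 2 * M / p) by (apply Rdiv_lt_0_compat; lra).
    generalize (Rpower_pos 1 (- p)); nra. }
replace (RtoC 0) with ((B - Psi 1) * 0 + 0)%C by ring.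
apply Clim_ext_ev with (fun v => (B - Psi 1) * Rcpow v s + Rcpow v s * (Psi 1 - Psi v))%C.
{ apply filter_forall; intros v; ring. }
apply Clim_plus; [apply Clim_mult_l, Rcpow_lim_0; lra |].
assert (L : filterlim (fun v => 2 * M / p * Rpower v eta) (at_right 0) (locally 0)).
{ replace 0 with (2 * M / p * 0) at 2 by ring.
  apply (filterlim_comp _ _ _ (fun v => Rpower v eta) (fun y => 2 * M / p * y) _ (locally 0)).
  - apply Rpower_lim_0, Heta.
  - apply (filterlim_scal_r (K := R_AbsRing) (V := R_NormedModule) (2 * M / p) 0). }
apply Clim_0_le with (2 := L).
generalize (at_right_pos 1 Rlt_0_1); apply filter_imp; intros v Hv.
rewrite Cmod_mult, Cmod_Rcpow.
replace (Rpower v eta) with (Rpower v (Re s) * Rpower v (- p)).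
- replace (2 * M / p * _) with (Rpower v (Re s) * (2 * M / p * Rpower v (- p))) by ring.
  apply Rmult_le_compat_l; [apply Rlt_le, Rpower_pos | apply Inc; lra].
- rewrite <- Rpower_plus; f_equal; unfold p, eta; field.
Qed.

(** Near 0 the limit gives the bound, on the remaining compact interval continuity does. The squared
    modulus is maximised, and [|x| <= 1 + x^2] recovers the modulus. *)
Lemma smooth_bounded_near_0 K K0 V : smooth_pos K -> Clim (at_right 0) K K0 -> 0 < V ->
  exists b, 0 < b /\ forall v, 0 < v <= V -> Cmod (K v) <= b.
Proof.
intros HK H0 HV.
destruct (at_right_elim _ (Clim_bounded _ _ H0)) as [d [Hd Hb]].
set (p := Rmin (d / 2) V).
assert (Pp : 0 < p <= V) by (split; [apply Rmin_glb_lt; lra | apply Rmin_r]).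
assert (Pd : p < d) by (generalize (Rmin_l (d / 2) V); unfold p; lra).
set (N := fun v => Re (K v) * Re (K v) + Im (K v) * Im (K v)).
destruct (continuity_ab_maj N p V) as [Mx [HM _]]; [lra | |].
{ intros c Hc; destruct (HK c ltac:(lra)) as [l Hl]; destruct (Cderiv_continuity _ _ _ Hl).
  unfold N; apply (continuity_pt_plus (fun v => Re (K v) * Re (K v)) (fun v => Im (K v) * Im (K v)));
    apply continuity_pt_mult; assumption. }
exists (Cmod K0 + 1 + (2 + N Mx)).
assert (0 <= N Mx) by (unfold N; nra).
generalize (Cmod_ge_0 K0); intros; split; [lra |]; intros v Hv.
destruct (Rlt_dec v d) as [h | h].
- generalize (Hb v ltac:(lra)); lra.
- specialize (HM v ltac:(lra)); unfold N in HM at 1.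
  assert (Q : forall x, Rabs x <= 1 + x * x).
  { intros x; unfold Rabs; destruct (Rcase_abs x); nra. }
  generalize (Cmod_le_Re_Im (K v)) (Q (Re (K v))) (Q (Im (K v))); lra.
Qed.

(** The integrand left by the integration by parts; [lker z s (a + RtoC e)] is its version damped by
    [exp (- e v)]. *)
Definition lker (z s b : C) (v : R) : C := (gker s b v / lerch_den z v)%C.

Lemma smooth_lker z s b : Cmod z <= 1 -> smooth_pos (lker z s b).
Proof.
intros Hz; apply smooth_mult; [apply smooth_gker |].
apply smooth_inv; [apply smooth_lerch_den | intros; apply lerch_den_neq_0; assumption].
Qed.

Lemma Cexp_shift (a : C) (e v : R) :
  Cexp (- (a + RtoC e) * RtoC v) = (Cexp (- a * RtoC v) * RtoC (exp (- (e * v))))%C.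
Proof.
rewrite <- Cexp_RtoC, <- Cexp_plus; f_equal; rewrite RtoC_opp, RtoC_mult; ring.
Qed.

Lemma exp_lin_bound x : 0 <= x -> (1 + x) * exp (- x) <= 2 * exp (- (x / 2)).
Proof.
intros Hx; replace (- x) with (- (x / 2) + - (x / 2)) by field.
rewrite exp_plus, <- Rmult_assoc; apply Rmult_le_compat_r; [apply Rlt_le, exp_pos |].
rewrite exp_Ropp; apply Rmult_le_reg_r with (exp (x / 2)); [apply exp_pos |].
rewrite Rmult_assoc, Rinv_l by (generalize (exp_pos (x / 2)); lra).
generalize (exp_ineq1_le (x / 2)); lra.
Qed.

(* Abel's theorem for the double integral: damping by [exp (- e v)] and integrating by parts
   expresses the damped single integral through [K - KI] and the derivative of
   [th v = exp (- e v) (1 - e v / s)], which has total variation [O(1)] uniformly in [e]. *)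
Lemma lerch_abel_limit (z s a : C) m Psi B K K0 KI J : Cmod z <= 1 -> s <> 0 -> 0 <= Re a ->
  den_order z m -> m < Re s ->
  (forall v, 0 < v -> Cderiv Psi v (lerch_ker z a v)) -> Clim pinf Psi B ->
  (forall v, 0 < v -> Cderiv K v (s * Rcpow v (s - 1) * (B - Psi v))) ->
  Clim (at_right 0) K K0 -> Clim pinf K KI ->
  (forall e, 0 < e -> is_int (lker z s (a + RtoC e)) (J e)) ->
  Clim (at_right 0) J (KI - K0).
Proof.
intros Hz Ns Ha Hm Hs HP HB HK HK0 HKI HJ tol Htol.
assert (Ps : 0 < Cmod s) by (apply Cmod_gt_0, Ns).
(* Makes [|1 - e v / s + 1 / s| <= c (1 + e v)], hence a bound on the derivative of [th] whose
   integral is [O(c)] uniformly in [e]. *)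
set (c := 1 + / Cmod s).
assert (Hc : 1 < c) by (unfold c; generalize (Rinv_0_lt_compat _ Ps); lra).
set (eta := tol / (16 * c)).
assert (Heta : 0 < eta) by (apply Rdiv_lt_0_compat; lra).
destruct (pinf_elim _ (HKI eta Heta)) as [V [HV HVb]].
destruct (smooth_bounded_near_0 (fun v => K v - KI)%C (K0 - KI) V) as [b [Hb Kb]].
{ intros v Hv; eexists; apply Cderiv_minus; [apply HK, Hv | apply Cderiv_const]. }
{ apply Clim_minus; [exact HK0 | apply Clim_const]. }
{ exact HV. }
(* [V] is fixed first, so that [K - KI] is below [eta] beyond it. Then [e] is taken so small that
   the contribution of [(0, V]], at most [2 c e b V], is below [tol / 4]. *)
assert (He0 : 0 < tol / (8 * b * c * V)).
{ apply Rdiv_lt_0_compat; [exact Htol |]; repeat apply Rmult_lt_0_compat; lra. }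
generalize (at_right_pos _ He0); apply filter_imp; intros e He.
destruct (HJ e (proj1 He)) as (Y & YA & YB & HY & HYA & HYB & ->).
set (ex := fun v => Cexp (- RtoC e * RtoC v)).
set (th := fun v : R => (ex v * (1 - RtoC e / s * RtoC v))%C).
set (th1 := fun v : R => (- RtoC e * ex v * (1 - RtoC e / s * RtoC v + / s))%C).
assert (Mex : forall v, Cmod (ex v) = exp (- (e * v))).
{ intros v; unfold ex; rewrite Cmod_Cexp; f_equal; unfold Re; simpl; ring. }
assert (Dth : forall v, Cderiv th v (th1 v)).
{ intros v; unfold th, th1; eapply Cderiv_eq.
  - apply Cderiv_mult; [apply Cderiv_exp_lin |].
    apply Cderiv_minus; [apply Cderiv_const |].
    apply Cderiv_mult; [apply Cderiv_const | apply Cderiv_id].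
  - cbv beta; unfold ex; field; exact Ns. }
assert (Bth1 : forall v, 0 < v -> Cmod (th1 v) <= 2 * c * e * exp (- (e * v / 2))).
{ intros v Hv; unfold th1; rewrite !Cmod_mult, Cmod_opp, Cmod_R, Rabs_pos_eq, Mex by lra.
  assert (X : Cmod (1 - RtoC e / s * RtoC v + / s) <= c * (1 + e * v)).
  { eapply Rle_trans; [apply Cmod_triangle |].
    eapply Rle_trans; [apply Rplus_le_compat_r, Cmod_triangle_minus |].
    rewrite Cmod_mult, Cmod_div, Cmod_inv, Cmod_1, !Cmod_R, !Rabs_pos_eq by (try exact Ns; lra).
    unfold c, Rdiv; generalize (Rinv_0_lt_compat _ Ps); intros; nra. }
  generalize (exp_lin_bound (e * v) ltac:(nra)) (exp_pos (- (e * v))); intros X1 X2.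
  apply Rle_trans with (e * exp (- (e * v)) * (c * (1 + e * v))).
  - apply Rmult_le_compat_l; [nra | exact X].
  - replace (e * exp (- (e * v)) * (c * (1 + e * v))) with (c * e * ((1 + e * v) * exp (- (e * v)))) by ring.
    replace (2 * c * e * exp (- (e * v / 2))) with (c * e * (2 * exp (- (e * v / 2)))) by ring.
    apply Rmult_le_compat_l; [nra | exact X1]. }
set (U := fun v : R => (Rcpow v s * (B - Psi v))%C).
(* The factor [1 - e v / s] in [th] is what absorbs [- e * ex v * U v], produced by differentiating
   the damping. All terms with [Psi] cancel, leaving [- th1 (K - KI)]. *)
set (Z := fun v : R => (Y v + ex v * U v - th v * (K v - KI))%C).
assert (DZ : forall v, 0 < v -> Cderiv Z v (- th1 v * (K v - KI))).
{ intros v Hv; unfold Z, U; eapply Cderiv_eq.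
  - apply Cderiv_minus.
    + apply Cderiv_plus; [apply HY, Hv |].
      apply Cderiv_mult; [apply Cderiv_exp_lin |].
      apply Cderiv_mult; [apply Cderiv_Rcpow, Hv |].
      apply Cderiv_minus; [apply Cderiv_const | apply HP, Hv].
    + apply Cderiv_mult; [apply Dth |].
      apply Cderiv_minus; [apply HK, Hv | apply Cderiv_const].
  - cbv beta; fold (ex v).
    assert (E : lker z s (a + RtoC e) v = (ex v * (Rcpow v s * lerch_ker z a v))%C).
    { unfold lker, gker, lerch_ker, ex; rewrite Cexp_shift, <- (Rcpow_pred v s Hv).
      replace (- RtoC e * RtoC v)%C with (RtoC (- (e * v))) by (rewrite RtoC_opp, RtoC_mult; ring).
      rewrite Cexp_RtoC; field; split; [apply RtoC_neq_0; lra | apply lerch_den_neq_0; assumption]. }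
    rewrite E; unfold th; rewrite <- (Rcpow_pred v s Hv); field; exact Ns. }
assert (Z0 : Clim (at_right 0) Z (YA + 0 - (K0 - KI))).
{ apply Clim_minus; [apply Clim_plus; [exact HYA |] |].
  - assert (L := lerch_boundary_term_0 z s a m Psi B Hz Ha Hm Hs HP).
    intros eps Heps; generalize (filter_and _ _ (L eps Heps) (at_right_pos 1 Rlt_0_1)).
    apply filter_imp; intros v [Lv Hv].
    replace (ex v * U v - 0)%C with (ex v * (Rcpow v s * (B - Psi v) - 0))%C by (unfold U; ring).
    rewrite Cmod_mult, Mex.
    assert (exp (- (e * v)) <= 1) by (apply exp_le_1; nra).
    generalize (Cmod_ge_0 (Rcpow v s * (B - Psi v) - 0)); nra.
  - apply Clim_ext_ev with (fun v => (K v - KI) + (K v - KI) * (th v - 1))%C.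
    { apply filter_forall; intros v; ring. }
    replace (K0 - KI)%C with ((K0 - KI) + 0)%C by ring.
    apply Clim_plus; [apply Clim_minus; [exact HK0 | apply Clim_const] |].
    assert (Lt : Clim (at_right 0) th 1).
    { assert (Lt : Clim (locally 0) th (th 0)) by (apply (Clim_deriv th 0 (th1 0)), Dth).
      replace (th 0) with (RtoC 1) in Lt
        by (unfold th, ex; rewrite !Cmult_0_r, Cexp_0; ring).
      intros eps Heps; specialize (Lt eps Heps); unfold at_right, within.
      revert Lt; apply filter_imp; intros v Hv _; exact Hv. }
    intros eps Heps.
    assert (Q : 0 < eps / b) by (apply Rdiv_lt_0_compat; lra).
    generalize (filter_and _ _ (Lt _ Q) (at_right_pos V HV)); apply filter_imp; intros v [L1 L2].
    replace ((K v - KI) * (th v - 1) - 0)%C with ((K v - KI) * (th v - 1))%C by ring.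
    rewrite Cmod_mult.
    apply Rle_lt_trans with (b * Cmod (th v - 1)).
    + apply Rmult_le_compat_r; [apply Cmod_ge_0 | apply Kb; lra].
    + replace eps with (b * (eps / b)) by (field; lra); apply Rmult_lt_compat_l; assumption. }
assert (ZI : Clim pinf Z (YB + 0 - 0)).
{ apply Clim_minus; [apply Clim_plus; [exact HYB |] |].
  - assert (L := gker_lim_pinf s (RtoC e) (proj1 He)).
    intros eps Heps.
    set (r := Cmod B + (Cmod B + 1) + 1).
    assert (Hr : 0 < r) by (unfold r; generalize (Cmod_ge_0 B); lra).
    assert (Q : 0 < eps / r) by (apply Rdiv_lt_0_compat; lra).
    generalize (filter_and _ _ (L _ Q) (Clim_bounded _ _ HB)).
    apply filter_imp; intros v [L1 L2].
    replace (ex v * U v - 0)%C with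
      ((Rcpow v s * Cexp (- RtoC e * RtoC v) - 0) * (B - Psi v))%C by (unfold ex, U; ring).
    rewrite Cmod_mult.
    apply Rle_lt_trans with (Cmod (Rcpow v s * Cexp (- RtoC e * RtoC v) - 0) * r).
    + apply Rmult_le_compat_l; [apply Cmod_ge_0 |].
      eapply Rle_trans; [apply Cmod_triangle_minus | unfold r; lra].
    + replace eps with (eps / r * r) by (field; lra); apply Rmult_lt_compat_r; assumption.
  - assert (Lt : Clim pinf th 0).
    { apply Clim_ext_ev with (fun v => Rcpow v 0 * Cexp (- RtoC e * RtoC v)
         + (- RtoC e / s) * (Rcpow v 1 * Cexp (- RtoC e * RtoC v)))%C.
      - generalize (pinf_gt 0); apply filter_imp; intros v Hv.
        rewrite Rcpow_0, Rcpow_1 by exact Hv; unfold th, ex; field; exact Ns.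
      - replace (RtoC 0) with (0 + - RtoC e / s * 0)%C by ring.
        apply Clim_plus; [| apply Clim_mult_l]; apply gker_lim_pinf, (proj1 He). }
    intros eps Heps.
    generalize (filter_and _ _ (Lt eps Heps) (HKI 1 Rlt_0_1)); apply filter_imp; intros v [L1 L2].
    replace (th v * (K v - KI) - 0)%C with ((th v - 0) * (K v - KI))%C by ring.
    rewrite Cmod_mult.
    generalize (Cmod_ge_0 (th v - 0)) (Cmod_ge_0 (K v - KI)); nra. }
(* The variation of [Z] is split at [V]: below it [e] is small, above it [K - KI] is small, and each
   part costs at most [tol / 4]. *)
assert (S1 : forall p, 0 < p <= V -> Cmod (Z V - Z p) <= tol / 4).
{ intros p Hp.
  apply Rle_trans with (2 * c * e * b * V - 2 * c * e * b * p).
  - apply (Cmod_increment_le Z (fun v => - th1 v * (K v - KI))%C (fun v => 2 * c * e * b * v)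
      (fun _ => 2 * c * e * b)); [lra | | |].
    + intros v Hv; apply DZ; lra.
    + intros v _; apply is_derive_Reals; auto_derive; [exact I | ring].
    + intros v Hv; rewrite Cmod_mult, Cmod_opp.
      apply Rmult_le_compat; try apply Cmod_ge_0; [| apply Kb; lra].
      eapply Rle_trans; [apply Bth1; lra |].
      assert (exp (- (e * v / 2)) <= 1) by (apply exp_le_1; nra).
      assert (0 < c * e) by nra. nra.
  - assert (X : e * (8 * b * c * V) < tol).
    { replace tol with (tol / (8 * b * c * V) * (8 * b * c * V)).
      - apply Rmult_lt_compat_r; [repeat apply Rmult_lt_0_compat; lra | lra].
      - field; repeat split; lra. }
    assert (0 < 2 * c * e * b * p) by (repeat apply Rmult_lt_0_compat; lra).
    nra. }
assert (S2 : forall q, V <= q -> Cmod (Z q - Z V) <= tol / 4).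
{ intros q Hq.
  apply Rle_trans with (- (4 * c * eta) * exp (- (e * q / 2)) - - (4 * c * eta) * exp (- (e * V / 2))).
  - apply (Cmod_increment_le Z (fun v => - th1 v * (K v - KI))%C
      (fun v => - (4 * c * eta) * exp (- (e * v / 2)))
      (fun v => 2 * c * e * exp (- (e * v / 2)) * eta)); [lra | | |].
    + intros v Hv; apply DZ; lra.
    + intros v _; apply is_derive_Reals; auto_derive; [exact I | unfold Rdiv; field].
    + intros v Hv; rewrite Cmod_mult, Cmod_opp.
      apply Rmult_le_compat; try apply Cmod_ge_0; [apply Bth1; lra |].
      apply Rlt_le, HVb; lra.
  - assert (exp (- (e * V / 2)) <= 1) by (apply exp_le_1; nra).
    assert (E4 : 4 * c * eta = tol / 4) by (unfold eta; field; lra).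
    rewrite E4; generalize (exp_pos (- (e * q / 2))); nra. }
assert (S3 : Cmod ((YB + 0 - 0) - Z V) <= tol / 4).
{ apply (Clim_norm_le (F := pinf) (fun q => Z q - Z V)%C).
  - apply Clim_minus; [exact ZI | apply Clim_const].
  - exists V; intros q Hq; apply S2; lra. }
assert (S4 : Cmod (Z V - (YA + 0 - (K0 - KI))) <= tol / 4).
{ apply (Clim_norm_le (F := at_right 0) (fun p => Z V - Z p)%C).
  - apply Clim_minus; [apply Clim_const | exact Z0].
  - generalize (at_right_pos V HV); apply filter_imp; intros p Hp; apply S1; lra. }
replace (YB - YA - (KI - K0))%C with
  (((YB + 0 - 0) - Z V) + (Z V - (YA + 0 - (K0 - KI))))%C by ring.
eapply Rle_lt_trans; [apply Cmod_triangle | lra].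
Qed.

(** * The single integral as a function of its shift *)

Lemma sqr_exp_le b v : 0 < b -> 0 < v ->
  (1 + v) ^ 2 * exp (- (b * v)) <= (1 + 4 / b) ^ 2 * exp (- (b / 2 * v)).
Proof.
intros Hb Hv.
replace (- (b * v)) with (- (b / 4 * v) + - (b / 4 * v) + - (b / 2 * v)) by field.
rewrite !exp_plus.
replace ((1 + v) ^ 2 * _) with (((1 + v) * exp (- (b / 4 * v))) ^ 2 * exp (- (b / 2 * v))) by ring.
apply Rmult_le_compat_r; [apply Rlt_le, exp_pos |].
apply pow_incr; split; [apply Rmult_le_pos; [lra | apply Rlt_le, exp_pos] |].
rewrite exp_Ropp; apply Rmult_le_reg_r with (exp (b / 4 * v)); [apply exp_pos |].
rewrite Rmult_assoc, Rinv_l by (generalize (exp_pos (b / 4 * v)); lra).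
assert (P : 0 < 4 / b) by (apply Rdiv_lt_0_compat; lra).
apply Rle_trans with ((1 + 4 / b) * (1 + b / 4 * v)).
- replace ((1 + 4 / b) * (1 + b / 4 * v)) with (1 + v + 4 / b + b / 4 * v) by (field; lra).
  nra.
- apply Rmult_le_compat_l; [lra | apply exp_ineq1_le].
Qed.

(** The free exponent [t] serves two purposes: [t = Re s - m] gives plain domination, a smaller [t]
    keeps a power of [v] to be paired with the spare decay [exp (- (Re b - be) v)]. The factor
    [1 + v] on the left leaves room for [|exp (- e v) - 1| <= e v]. *)
Lemma lker_le_dom z s m t be : Cmod z <= 1 -> den_order z m -> 0 < t -> 0 < be ->
  exists M, 0 < M /\ forall (b : C) v, 0 < v -> be <= Re b ->
    Cmod (lker z s b v) * (1 + v) <=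
      M * (Rpower v (Re s - m - t) * exp (- ((Re b - be) * v))) * dom t v.
Proof.
intros Hz (_ & _ & M1 & HM1 & H1) Ht Hbe.
destruct (Rpower_exp_le_dom t (be / 2) Ht) as [M2 [HM2 H2]]; [lra |].
set (k := (1 + 4 / be) ^ 2).
assert (Hk : 0 < k).
{ unfold k; apply pow_lt; generalize (Rdiv_lt_0_compat 4 be); lra. }
exists (M1 * k * M2); split; [apply Rmult_lt_0_compat; [apply Rmult_lt_0_compat |]; assumption |].
intros b v Hv Hb.
unfold lker; rewrite Cmod_div, Cmod_gker by (apply lerch_den_neq_0; assumption).
specialize (H1 v Hv); specialize (H2 v Hv).
assert (E := sqr_exp_le be v Hbe Hv); fold k in E; clearbody k.
set (A := Rpower v (Re s - m - t)).
set (X := exp (- ((Re b - be) * v))).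
assert (E1 : exp (- (Re b * v)) = exp (- (be * v)) * X).
{ unfold X; rewrite <- exp_plus; f_equal; ring. }
assert (E2 : Rpower v (Re s - 1) * Rpower v (- m) = A * Rpower v (t - 1)).
{ unfold A; rewrite <- !Rpower_plus; f_equal; ring. }
assert (PA : 0 < A) by apply Rpower_pos.
assert (PX : 0 < X) by apply exp_pos.
assert (Pe : 0 < exp (- (be * v))) by apply exp_pos.
assert (Pt : 0 < Rpower v (t - 1)) by apply Rpower_pos.
unfold Rdiv; rewrite E1.
apply Rle_trans with (Rpower v (Re s - 1) * (exp (- (be * v)) * X)
   * (M1 * (1 + v) * Rpower v (- m)) * (1 + v)).
{ apply Rmult_le_compat_r; [lra |]; apply Rmult_le_compat_l; [| exact H1].
  repeat apply Rmult_le_pos; try lra; apply Rlt_le, Rpower_pos. }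
replace (_ * _ * _ * _) with (M1 * X * (Rpower v (Re s - 1) * Rpower v (- m)) *
  ((1 + v) ^ 2 * exp (- (be * v)))) by ring.
rewrite E2.
apply Rle_trans with (M1 * X * (A * Rpower v (t - 1)) * (k * exp (- (be / 2 * v)))).
{ apply Rmult_le_compat_l; [| exact E]; repeat apply Rmult_le_pos; lra. }
replace (_ * _) with (M1 * X * A * k * (Rpower v (t - 1) * exp (- (be / 2 * v)))) by ring.
replace (M1 * k * M2 * (A * X) * dom t v) with (M1 * X * A * k * (M2 * dom t v)) by ring.
apply Rmult_le_compat_l; [| exact H2]; repeat apply Rmult_le_pos; lra.
Qed.

Lemma lker_le_dom_order z s m be : Cmod z <= 1 -> den_order z m -> m < Re s -> 0 < be ->
  exists M, 0 < M /\ forall (b : C) v, 0 < v -> be <= Re b ->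
    Cmod (lker z s b v) * (1 + v) <= M * dom (Re s - m) v.
Proof.
intros Hz Hm Hs Hbe.
destruct (lker_le_dom z s m (Re s - m) be Hz Hm) as [M [HM H]]; [lra | lra |].
exists M; split; [exact HM |]; intros b v Hv Hb.
eapply Rle_trans; [apply H; assumption |].
apply Rmult_le_compat_r; [apply Rlt_le, dom_pos; lra |].
replace (Re s - m - (Re s - m)) with 0 by ring; rewrite Rpower_O by exact Hv.
assert (exp (- ((Re b - be) * v)) <= 1) by (apply exp_le_1; nra). nra.
Qed.

Lemma lker_int_exists z s m b : Cmod z <= 1 -> den_order z m -> m < Re s -> 0 < Re b ->
  exists l, is_int (lker z s b) l.
Proof.
intros Hz Hm Hs Hb.
destruct (lker_le_dom_order z s m (Re b) Hz Hm Hs Hb) as [M [HM H]].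
apply is_int_exists with M (Re s - m); [lra | lra | apply smooth_lker, Hz |].
intros v Hv; eapply Rle_trans; [| apply (H b v Hv (Rle_refl _))].
generalize (Cmod_ge_0 (lker z s b v)); nra.
Qed.

(** One step of the geometric series: [1 / (1 - q) = 1 + q / (1 - q)] with [q = z exp (- v)]. *)
Lemma lker_split z s b v : Cmod z <= 1 -> 0 < v ->
  lker z s b v = (gker s b v + z * lker z s (b + 1) v)%C.
Proof.
intros Hz Hv; assert (N := lerch_den_neq_0 z v Hz Hv).
assert (E : Cexp (- (b + 1) * RtoC v) = (Cexp (- b * RtoC v) * Cexp (- (1) * RtoC v))%C).
{ rewrite <- Cexp_plus; f_equal; ring. }
unfold lker, gker; rewrite E.
transitivity (Rcpow v (s - 1) * Cexp (- b * RtoC v) *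
  (lerch_den z v + z * Cexp (- (1) * RtoC v)) / lerch_den z v)%C.
- unfold lerch_den at 2; unfold Cdiv; ring.
- field; exact N.
Qed.

Lemma lker_int_split z s b G l : Cmod z <= 1 -> 0 < Re s -> 0 < Re b -> is_int (gker s 1) G ->
  is_int (lker z s (b + 1)) l -> is_int (lker z s b) (G / Defs.Cpow b s + z * l).
Proof.
intros Hz Hs Hb HG Hl.
apply is_int_ext with (fun v => gker s b v + z * lker z s (b + 1) v)%C.
- intros v Hv; symmetry; apply lker_split; assumption.
- apply is_int_plus; [apply gker_int; assumption | apply is_int_mult_l, Hl].
Qed.

(** The two integrands differ by the factor [exp (- e v) - 1], so the weighted domination bounds the
    difference of the integrals by [e * M]. *)
Lemma lker_int_lim_right z s m (b : C) (J : R -> C) l : Cmod z <= 1 -> den_order z m -> m < Re s ->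
  0 < Re b -> is_int (lker z s b) l ->
  (forall e, 0 < e -> is_int (lker z s (b + RtoC e)) (J e)) -> Clim (at_right 0) J l.
Proof.
intros Hz Hm Hs Hb Hl HJ.
destruct (lker_le_dom_order z s m (Re b) Hz Hm Hs Hb) as [M [HM H]].
intros eps He.
assert (Q : 0 < eps / M) by (apply Rdiv_lt_0_compat; assumption).
generalize (at_right_pos _ Q); apply filter_imp; intros e Hee.
apply Rle_lt_trans with (e * M).
2: { replace eps with (eps / M * M) by (field; lra); apply Rmult_lt_compat_r; lra. }
apply is_int_norm_le with (fun v => lker z s (b + RtoC e) v - lker z s b v)%C (Re s - m).
- lra.
- nra.
- apply is_int_minus; [apply HJ; lra | exact Hl].
- intros v Hv.
  replace (lker z s (b + RtoC e) v - lker z s b v)%C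
    with (lker z s b v * RtoC (exp (- (e * v)) - 1))%C.
  2: { unfold lker, gker; rewrite Cexp_shift, RtoC_minus; unfold Cdiv; ring. }
  rewrite Cmod_mult, Cmod_R.
  assert (X : Rabs (exp (- (e * v)) - 1) <= e * v).
  { assert (exp (- (e * v)) <= 1) by (apply exp_le_1; nra).
    generalize (exp_ineq1_le (- (e * v))); intros; apply Rabs_le; nra. }
  specialize (H b v Hv (Rle_refl _)).
  apply Rle_trans with (Cmod (lker z s b v) * (e * (1 + v))).
  + apply Rmult_le_compat_l; [apply Cmod_ge_0 | nra].
  + nra.
Qed.

Lemma lker_int_shift_lim z s m (b : C) (l : nat -> C) : Cmod z <= 1 -> den_order z m -> m < Re s ->
  0 < Re b -> (forall n, is_int (lker z s (b + RtoC (INR n))) (l n)) -> Clim eventually l 0.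
Proof.
intros Hz Hm Hs Hb Hl.
(* Half of the margin pays for the domination; the other half gives [v^t exp (- n v) <= M2 n^(-t)],
   the decay in [n]. *)
set (t := (Re s - m) / 2).
assert (Ht : 0 < t) by (unfold t; lra).
destruct (lker_le_dom z s m t (Re b) Hz Hm Ht Hb) as [M [HM H]].
destruct (Rpower_exp_bound t 1 Ht Rlt_0_1) as [M2 [HM2 H2]].
assert (K : forall n, (0 < n)%nat -> Cmod (l n) <= M * M2 * Rpower (INR n) (- t)).
{ intros n Hn; assert (Pn : 0 < INR n) by (apply lt_0_INR; exact Hn).
  assert (Q := Rpower_pos (INR n) (- t)).
  apply is_int_norm_le with (lker z s (b + RtoC (INR n))) t; [exact Ht | | apply Hl |].
  { repeat apply Rmult_le_pos; lra. }
  intros v Hv.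
  assert (Rb : Re (b + RtoC (INR n)) = Re b + INR n) by (unfold Re; simpl; ring).
  specialize (H (b + RtoC (INR n))%C v Hv); rewrite Rb in H; specialize (H ltac:(lra)).
  apply Rle_trans with (Cmod (lker z s (b + RtoC (INR n)) v) * (1 + v)).
  - generalize (Cmod_ge_0 (lker z s (b + RtoC (INR n)) v)); nra.
  - eapply Rle_trans; [exact H |]; apply Rmult_le_compat_r; [apply Rlt_le, dom_pos, Ht |].
    rewrite Rmult_assoc; apply Rmult_le_compat_l; [lra |].
    replace (Re s - m - t) with t by (unfold t; field).
    replace (Re b + INR n - Re b) with (INR n) by ring.
    specialize (H2 (INR n * v) (Rmult_lt_0_compat _ _ Pn Hv)).
    rewrite <- Rpower_mult_distr, Rmult_1_l in H2 by assumption.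
    rewrite Rpower_Ropp.
    apply Rmult_le_reg_l with (Rpower (INR n) t); [apply Rpower_pos |].
    replace (Rpower (INR n) t * (M2 * / Rpower (INR n) t)) with M2
      by (field; generalize (Rpower_pos (INR n) t); lra).
    rewrite <- Rmult_assoc; exact H2. }
intros eps He.
assert (Pc : 0 < M * M2) by (apply Rmult_lt_0_compat; assumption).
destruct (pinf_elim _ (Clim_unif_scal _ pinf (M * M2) eps (Rpower_lim_pinf t Ht) (Rlt_le _ _ Pc) He))
  as [N [HN HNb]].
destruct (nfloor_ex N) as [k Hk]; [lra |].
exists (S k); intros n Hn.
assert (INR (S k) <= INR n) by (apply le_INR; exact Hn).
rewrite S_INR in *.
replace (l n - 0)%C with (l n) by ring.
eapply Rle_lt_trans; [apply K; lia | apply HNb; lra].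
Qed.

(** * Continuity of the principal power from the right *)

Lemma Clim_Cexp {T} (F : (T -> Prop) -> Prop) {FF : ProperFilter F} f l :
  Clim F f l -> Clim F (fun x => Cexp (f x)) (Cexp l).
Proof.
intros H; destruct (Clim_parts _ _ H) as [H1 H2].
assert (Hc : forall (u : R -> R), (forall x, ex_derive u x) -> forall (g : T -> R) x,
   filterlim g F (locally x) -> filterlim (fun t => u (g t)) F (locally (u x))).
{ intros u Hu g x Hg; apply (filterlim_comp _ _ _ g u _ (locally x)); [exact Hg |].
  apply (ex_derive_continuous u), Hu. }
assert (Pe := Hc exp (fun x => ex_intro _ _ (is_derive_exp x)) _ _ H1).
assert (Pc := Hc cos (fun x => ex_intro _ _ (is_derive_cos x)) _ _ H2).
assert (Ps := Hc sin (fun x => ex_intro _ _ (is_derive_sin x)) _ _ H2).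
apply Clim_of_parts; unfold Cexp; simpl.
- exact (filterlim_comp_2 _ _ _ Pe Pc (filterlim_mult (K := R_AbsRing) _ _)).
- exact (filterlim_comp_2 _ _ _ Pe Ps (filterlim_mult (K := R_AbsRing) _ _)).
Qed.

Lemma filterlim_at_right_continuous (f g : R -> R) :
  (forall e, 0 < e -> g e = f e) -> ex_derive f 0 ->
  filterlim g (at_right 0) (locally (f 0)).
Proof.
intros E H; apply filterlim_ext_loc with f.
- generalize (at_right_pos 1 Rlt_0_1); apply filter_imp; intros e He; symmetry; apply E; lra.
- eapply filterlim_filter_le_1; [apply filter_le_within |].
  apply (ex_derive_continuous f), H.
Qed.

(** For [e > 0] the point [a + e] has positive real part, so [Carg] is an [atan] all along the
    approach. The delicate case is [Re a = 0], where the limit value is given by the separate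
    clauses [PI / 2] and [- (PI / 2)]. *)
Lemma CLog_lim_right (a : C) : 0 <= Re a -> a <> 0 ->
  Clim (at_right 0) (fun e => CLog (a + RtoC e)) (CLog a).
Proof.
intros Ha Na; destruct a as [x y]; simpl in Ha.
assert (P : 0 < (x + 0) * (x + 0) + y * y).
{ generalize (C_sqr_pos _ Na); simpl; intros; nra. }
apply Clim_of_parts.
- replace (Re (CLog (x, y))) with ((fun e => / 2 * ln ((x + e) * (x + e) + y * y)) 0).
  + refine (filterlim_at_right_continuous (fun e => / 2 * ln ((x + e) * (x + e) + y * y)) _ _ _).
    * intros e He; unfold CLog, Cmod; simpl.
      replace ((x + e) * ((x + e) * 1) + (y + 0) * ((y + 0) * 1))
        with ((x + e) * (x + e) + y * y) by ring.
      rewrite <- Rpower_sqrt by nra; unfold Rpower; rewrite ln_exp; reflexivity.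
    * auto_derive; exact P.
  + cbv beta; unfold CLog, Cmod; simpl.
    replace (x * (x * 1) + y * (y * 1)) with ((x + 0) * (x + 0) + y * y) by ring.
    rewrite <- Rpower_sqrt by exact P; unfold Rpower; rewrite ln_exp; reflexivity.
- assert (E : forall e, 0 < e -> Im (CLog ((x, y) + RtoC e)) = atan (y / (x + e))).
  { intros e He; unfold CLog, Carg; simpl.
    destruct (Rlt_dec 0 (x + e)) as [h | h]; [rewrite Rplus_0_r; reflexivity | lra]. }
  destruct (Rle_lt_or_eq_dec 0 x Ha) as [Hx | Hx].
  + replace (Im (CLog (x, y))) with ((fun e => atan (y / (x + e))) 0).
    * refine (filterlim_at_right_continuous (fun e => atan (y / (x + e))) _ _ _); [exact E | auto_derive; lra].
    * cbv beta; unfold CLog, Carg; simpl; destruct (Rlt_dec 0 x); [| lra].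
      rewrite Rplus_0_r; reflexivity.
  + subst x.
    assert (Ny : y <> 0) by (intros ->; apply Na; reflexivity).
    destruct (Rlt_dec 0 y) as [Hy | Hy].
    (* The reflection [atan (1 / x) = PI / 2 - atan x] turns [atan (y / e)] into a function of [e]
       that is differentiable at 0. *)
    * replace (Im (CLog (0, y))) with ((fun e => PI / 2 - atan (e / y)) 0).
      -- refine (filterlim_at_right_continuous (fun e => PI / 2 - atan (e / y)) _ _ _).
         ++ intros e He; rewrite E by exact He.
            replace (y / (0 + e)) with (/ (e / y)) by (field; lra).
            apply atan_inv, Rdiv_lt_0_compat; lra.
         ++ auto_derive; lra.
      -- cbv beta; unfold CLog, Carg; simpl.
         destruct (Rlt_dec 0 0); [lra |]; destruct (Rlt_dec 0 y); [| lra].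
         unfold Rdiv at 2; rewrite Rmult_0_l, atan_0; ring.
    * replace (Im (CLog (0, y))) with ((fun e => - (PI / 2 - atan (e / - y))) 0).
      -- refine (filterlim_at_right_continuous (fun e => - (PI / 2 - atan (e / - y))) _ _ _).
         ++ intros e He; rewrite E by exact He.
            replace (y / (0 + e)) with (- / (e / - y)) by (field; lra).
            rewrite atan_opp; f_equal; apply atan_inv, Rdiv_lt_0_compat; lra.
         ++ auto_derive; lra.
      -- cbv beta; unfold CLog, Carg; simpl.
         destruct (Rlt_dec 0 0); [lra |]; destruct (Rlt_dec 0 y); [lra |].
         unfold Rdiv at 2; rewrite Rmult_0_l, atan_0; ring.
Qed.

Lemma Cpow_inv_lim_right (a s : C) : 0 <= Re a -> a <> 0 ->
  Clim (at_right 0) (fun e => / Defs.Cpow (a + RtoC e) s)%C (/ Defs.Cpow a s).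
Proof.
intros Ha Na; unfold Defs.Cpow; rewrite <- Cexp_opp.
apply Clim_ext_ev with (fun e => Cexp (- s * CLog (a + RtoC e))).
- apply filter_forall; intros e; rewrite <- Cexp_opp; f_equal; ring.
- replace (- (s * CLog a))%C with (- s * CLog a)%C by ring.
  apply Clim_Cexp; [exact _ |]; apply Clim_mult_l, CLog_lim_right; assumption.
Qed.

(** * Convergence of the series forces [|z| <= 1] *)

Lemma Rabs_Carg_le w : Rabs (Carg w) <= 2 * PI.
Proof.
assert (Q := PI_RGT_0); assert (A := atan_bound (Im w / Re w)).
unfold Carg; apply Rabs_le.
destruct (Rlt_dec 0 (Re w)); [lra |].
destruct (Rlt_dec (Re w) 0); [destruct (Rle_dec 0 (Im w)); lra |].
destruct (Rlt_dec 0 (Im w)); lra.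
Qed.

Lemma Clim_sum_n u L : is_series (K := C_AbsRing) (V := C_NormedModule) u L ->
  Clim eventually (fun n => sum_n (G := C_AbelianMonoid) u n) L.
Proof. intros H; apply Clim_of_filterlim; exact H. Qed.

Lemma sum_n_S (u : nat -> C) n :
  sum_n (G := C_AbelianMonoid) u (S n) = (sum_n (G := C_AbelianMonoid) u n + u (S n))%C.
Proof. exact (sum_Sn (G := C_AbelianMonoid) u n). Qed.

(** Terms of a convergent series are eventually below 2, so [|z|^k] is at most twice the modulus of
    [(k + a)^s]. That grows at most polynomially, as the argument is bounded; in logarithms, a
    linear function of [k] would be bounded by a multiple of [ln k]. *)
Lemma lerch_series_Cmod_le (z s a L : C) :
  is_series (fun k : nat => (z ^ k / Defs.Cpow (RtoC (INR k) + a) s)%C) L -> Cmod z <= 1.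
Proof.
intros H; apply Clim_sum_n in H.
destruct (Rle_dec (Cmod z) 1) as [h | h]; [exact h | exfalso].
destruct (H 1 Rlt_0_1) as [N HN].
set (u := fun k : nat => (z ^ k / Defs.Cpow (RtoC (INR k) + a) s)%C) in *.
assert (Hu : forall n, (N <= n)%nat -> Cmod (u (S n)) < 2).
{ intros n Hn.
  replace (u (S n)) with ((sum_n (G := C_AbelianMonoid) u (S n) - L)
     - (sum_n (G := C_AbelianMonoid) u n - L))%C by (rewrite sum_n_S; ring).
  eapply Rle_lt_trans; [apply Cmod_triangle_minus |].
  assert (X1 := HN n Hn); assert (X2 := HN (S n) ltac:(lia)); lra. }
set (c := ln (Cmod z)).
assert (Hc : 0 < c) by (unfold c; rewrite <- ln_1; apply ln_increasing; lra).
set (rho := Rabs (Re s) + 1).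
assert (Hrho : 0 < rho) by (unfold rho; generalize (Rabs_pos (Re s)); lra).
(* Applying [ln x <= x - 1] at [x = eta * 2 k] makes [rho * ln (2 k)] cost only [c k / 2], half of
   the linear term [c k]. *)
set (eta := c / (4 * rho)).
assert (Heta : 0 < eta) by (apply Rdiv_lt_0_compat; lra).
set (D := ln 2 - rho * ln eta + Rabs (Im s) * (2 * PI)).
assert (K : forall k, (S N <= k)%nat -> Cmod a + 1 <= INR k -> c * INR k <= 2 * D).
{ intros k Hk Hka.
  destruct k as [| n]; [lia |]; specialize (Hu n ltac:(lia)); set (k := S n) in *.
  unfold u in Hu; set (w := (RtoC (INR k) + a)%C) in *.
  unfold Defs.Cpow in Hu.
  rewrite Cmod_div, Cmod_pow, Cmod_Cexp in Hu by apply Cexp_neq_0.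
  set (x := Re (s * CLog w)) in Hu.
  assert (Pk : 0 < INR k) by (generalize (Cmod_ge_0 a); lra).
  assert (W : 1 <= Cmod w <= 2 * INR k).
  { split.
    - replace w with (RtoC (INR k) - - a)%C by (unfold w; ring).
      generalize (Cmod_triangle_inv (RtoC (INR k)) (- a)).
      rewrite Cmod_opp, Cmod_R, Rabs_pos_eq; lra.
    - unfold w; eapply Rle_trans; [apply Cmod_triangle |].
      rewrite Cmod_R, Rabs_pos_eq; lra. }
  assert (X : x <= rho * ln (2 * INR k) + Rabs (Im s) * (2 * PI)).
  { assert (E : x = Re s * ln (Cmod w) - Im s * Carg w) by (unfold x, CLog, Re, Im; simpl; ring).
    assert (L1 : 0 <= ln (Cmod w)) by (rewrite <- ln_1; apply ln_le; lra).
    assert (L2 : ln (Cmod w) <= ln (2 * INR k)) by (apply ln_le; lra).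
    assert (A1 : Re s * ln (Cmod w) <= rho * ln (2 * INR k)).
    { apply Rle_trans with (rho * ln (Cmod w)); [| apply Rmult_le_compat_l; lra].
      apply Rmult_le_compat_r; [exact L1 |]; unfold rho; generalize (Rle_abs (Re s)); lra. }
    assert (A2 : - (Im s * Carg w) <= Rabs (Im s) * (2 * PI)).
    { eapply Rle_trans; [apply Rle_abs |]; rewrite Rabs_Ropp, Rabs_mult.
      apply Rmult_le_compat_l; [apply Rabs_pos | apply Rabs_Carg_le]. }
    lra. }
  assert (Y : ln (2 * INR k) <= eta * (2 * INR k) - ln eta).
  { generalize (ln_le_sub_1 (eta * (2 * INR k)) ltac:(apply Rmult_lt_0_compat; lra)).
    rewrite (ln_mult eta) by lra; lra. }
  assert (Z : c * INR k <= ln 2 + x).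
  { assert (T : Cmod z ^ k <= 2 * exp x).
    { apply Rmult_le_reg_r with (/ exp x); [apply Rinv_0_lt_compat, exp_pos |].
      rewrite Rmult_assoc, Rinv_r by (generalize (exp_pos x); lra); unfold Rdiv in Hu; lra. }
    apply ln_le in T; [| apply pow_lt; lra].
    rewrite ln_mult, ln_exp in T by (try apply exp_pos; lra).
    rewrite <- Rpower_pow in T by lra; unfold Rpower in T; rewrite ln_exp in T; unfold c; lra. }
  assert (Y2 : rho * ln (2 * INR k) <= c * INR k / 2 - rho * ln eta).
  { replace (c * INR k / 2 - rho * ln eta) with (rho * (eta * (2 * INR k) - ln eta))
      by (unfold eta at 1; field; lra).
    apply Rmult_le_compat_l; lra. }
  unfold D; lra. }
destruct (nfloor_ex (Cmod a + Rabs (2 * D / c))) as [k Hk].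
{ generalize (Cmod_ge_0 a) (Rabs_pos (2 * D / c)); lra. }
set (n := (k + 2 + S N)%nat).
assert (Hn : Cmod a + Rabs (2 * D / c) + 1 < INR n).
{ unfold n; rewrite !plus_INR; replace (INR 2) with 2 by (simpl; ring); rewrite S_INR.
  generalize (pos_INR N); lra. }
assert (Q := K n ltac:(unfold n; lia) ltac:(generalize (Rabs_pos (2 * D / c)); lra)).
assert (2 * D / c < INR n) by (generalize (Rle_abs (2 * D / c)) (Cmod_ge_0 a); lra).
apply Rmult_lt_compat_l with (r := c) in H0; [| exact Hc].
replace (c * (2 * D / c)) with (2 * D) in H0 by (field; lra); lra.
Qed.

(** * From double improper integrals to primitives *)

(** The generalized integral is a limit over both endpoints jointly, so it yields a whole rectangle
    of endpoints. [f1] is the differentiable form of [f] on the open interval, which identifies each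
    proper integral with an increment of [F]. *)
Lemma is_RInt_gen_primitive (f f1 F : R -> C) (l : C) :
  (forall x, 0 < x < 1 -> f x = f1 x) ->
  (forall x, 0 < x < 1 -> Cderiv F x (f1 x)) ->
  (forall x, 0 < x < 1 -> exists d, Cderiv f1 x d) ->
  is_RInt_gen (V := C_R_NormedModule) f (at_right 0) (at_left 1) l ->
  forall eps, 0 < eps -> exists d, 0 < d < 1 /\
    forall u w, 0 < u < d -> 1 - d < w < 1 -> Cmod (F w - F u - l) < eps.
Proof.
intros Ef HF Hf H eps He.
assert (Pe : 0 < eps / 2) by lra.
destruct (H (fun y => Cmod (y - l) < eps)) as [P Q HP HQ HPQ].
{ exists (mkposreal _ Pe); intros y [B1 B2].
  unfold ball in B1, B2; simpl in B1, B2; unfold AbsRing_ball, abs, minus, plus, opp in B1, B2; simpl in B1, B2.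
  eapply Rle_lt_trans; [apply Cmod_le_Re_Im |].
  replace (Re (y - l)) with (fst y + - fst l) by (unfold Re; simpl; ring).
  replace (Im (y - l)) with (snd y + - snd l) by (unfold Im; simpl; ring).
  lra. }
destruct (at_right_elim _ HP) as [d1 [Hd1 Hp]].
destruct HQ as [d2 Hq].
set (d := Rmin (Rmin d1 d2) (/ 2)).
assert (Hd : 0 < d /\ d <= d1 /\ d <= d2 /\ d <= / 2).
{ unfold d; generalize (Rmin_l (Rmin d1 d2) (/ 2)) (Rmin_r (Rmin d1 d2) (/ 2))
   (Rmin_l d1 d2) (Rmin_r d1 d2) (cond_pos d2); intros.
  repeat split; try lra; repeat apply Rmin_glb_lt; lra. }
exists d; split; [lra |]; intros u w Hu Hw.
assert (Qw : Q w).
{ apply Hq; [| lra]; unfold ball; simpl; unfold AbsRing_ball, abs, minus, plus, opp; simpl.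
  apply Rabs_def1; lra. }
destruct (HPQ u w (Hp u ltac:(lra)) Qw) as [y [Hy Hyl]]; simpl in Hy.
assert (E : y = (F w - F u)%C).
{ assert (K : forall p : C -> R,
     (forall x, 0 < x < 1 -> is_derive (fun t => p (F t)) x (p (f1 x))) ->
     (forall x, 0 < x < 1 -> continuous (fun t => p (f1 t)) x) ->
     is_RInt (fun t => p (f t)) u w (p y) -> p y = p (F w) - p (F u)).
  { intros p D1 D2 D3.
    apply (is_RInt_unique (V := R_CompleteNormedModule)) in D3; rewrite <- D3.
    apply (is_RInt_unique (V := R_CompleteNormedModule)).
    apply is_RInt_ext with (fun t => p (f1 t)).
    - intros x; rewrite Rmin_left, Rmax_right by lra; intros Hx; rewrite Ef by lra; reflexivity.
    - apply (is_RInt_derive (V := R_CompleteNormedModule) (fun t => p (F t)));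
       intros x; rewrite Rmin_left, Rmax_right by lra; intros Hx; [apply D1 | apply D2]; lra. }
  apply C_eq.
  - replace (Re (F w - F u)) with (Re (F w) - Re (F u)) by (unfold Re; simpl; ring).
    apply K.
    + intros x Hx; apply HF, Hx.
    + intros x Hx; destruct (Hf x Hx) as [dd [X _]].
      apply (ex_derive_continuous (fun t => Re (f1 t))); eexists; exact X.
    + exact (is_RInt_fct_extend_fst (U := R_NormedModule) (V := R_NormedModule) f u w y Hy).
  - replace (Im (F w - F u)) with (Im (F w) - Im (F u)) by (unfold Im; simpl; ring).
    apply K.
    + intros x Hx; apply HF, Hx.
    + intros x Hx; destruct (Hf x Hx) as [dd [_ X]].
      apply (ex_derive_continuous (fun t => Im (f1 t))); eexists; exact X.
    + exact (is_RInt_fct_extend_snd (U := R_NormedModule) (V := R_NormedModule) f u w y Hy). }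
rewrite <- E; exact Hyl.
Qed.

(** With [w = - ln (x y)], the power [(x y)^(a-1)] is [exp (- a w) / (x y)], and the sign of [- s]
    is used up by [ln (x y) = - w]. The factor [1 / (x y)] is the Jacobian of the substitution. *)
Lemma lerch_integrand_eq (z s a : C) x y : Cmod z <= 1 -> 0 < x < 1 -> 0 < y < 1 ->
  lerch_integrand z s a x y =
  (s * Rcpow (- ln y) (s - 1) / RtoC (x * y) * lerch_ker z a (- ln (x * y)))%C.
Proof.
intros Hz Hx Hy.
assert (Pxy : 0 < x * y < 1) by nra.
assert (Hl : ln (x * y) < 0) by (rewrite <- ln_1; apply ln_increasing; lra).
set (w := - ln (x * y)).
assert (Ew : exp (- w) = x * y) by (unfold w; rewrite Ropp_involutive, exp_ln; lra).
assert (Nq := lerch_den_neq_0 z w Hz ltac:(unfold w; lra)).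
assert (Eq : lerch_den z w = (1 - z * RtoC x * RtoC y)%C).
{ unfold lerch_den; rewrite Cexp_opp_RtoC, Ew, RtoC_mult; ring. }
assert (Ep : (Rcpow (x * y) (a - 1) * RtoC (x * y) = Cexp (- a * RtoC w))%C).
{ rewrite Rcpow_pred by lra; unfold Rcpow, w; rewrite RtoC_opp; f_equal; ring. }
assert (Nxy : RtoC (x * y) <> 0) by (apply RtoC_neq_0; lra).
assert (Nw : RtoC w <> 0) by (apply RtoC_neq_0; unfold w; lra).
unfold lerch_integrand, lerch_ker; rewrite <- Ep, <- Eq.
replace (RtoC (ln (x * y))) with (- RtoC w)%C by (unfold w; rewrite RtoC_opp; ring).
field; repeat split; auto.
Qed.

Lemma is_derive_opp_ln x : 0 < x -> is_derive (fun t => - ln t) x (- / x).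
Proof. intros Hx; apply is_derive_Reals; auto_derive; [exact Hx | field; lra]. Qed.

Lemma opp_ln_pos x : 0 < x < 1 -> 0 < - ln x.
Proof. intros Hx; generalize (ln_increasing x 1); rewrite ln_1; lra. Qed.

(** A primitive in [x] is a nonzero multiple of [Psi (- ln (x y))]. The end [x -> 0] corresponds to
    [w -> oo] and so forces [Psi] to converge; the end [x -> 1] is harmless, since [Psi] is
    continuous at [- ln y]. *)
Lemma lerch_inner_integral (z s a : C) Psi y (g : C) : Cmod z <= 1 -> s <> 0 -> 0 < y < 1 ->
  (forall v, 0 < v -> Cderiv Psi v (lerch_ker z a v)) ->
  is_RInt_gen (V := C_R_NormedModule) (fun x => lerch_integrand z s a x y)
    (at_right 0) (at_left 1) g ->
  exists B, Clim pinf Psi B /\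
    g = (s * Rcpow (- ln y) (s - 1) / RtoC y * (B - Psi (- ln y)%R))%C.
Proof.
intros Hz Ns Hy HP H.
set (k := (s * Rcpow (- ln y) (s - 1) / RtoC y)%C).
assert (Ny : RtoC y <> 0) by (apply RtoC_neq_0; lra).
assert (Nk : k <> 0).
{ unfold k, Cdiv; repeat apply Cmult_neq_0; [exact Ns | apply Rcpow_neq_0 |].
  intros E; apply (f_equal (Cmult (RtoC y))) in E; rewrite Cinv_r in E by exact Ny.
  rewrite Cmult_0_r in E; apply RtoC_inj in E; lra. }
assert (Hv := opp_ln_pos y Hy); set (v := - ln y) in *.
assert (Dw : forall x, 0 < x -> is_derive (fun t => - ln (t * y)) x (- / x)).
{ intros x Hx; apply is_derive_Reals; auto_derive; [nra | field; lra]. }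
assert (Pw : forall x, 0 < x < 1 -> 0 < - ln (x * y)).
{ intros x Hx; apply opp_ln_pos; nra. }
set (f1 := fun x : R => (k / RtoC x * lerch_ker z a (- ln (x * y))%R)%C).
set (F := fun x : R => (- k * Psi (- ln (x * y))%R)%C).
assert (Lim := is_RInt_gen_primitive (fun x => lerch_integrand z s a x y) f1 F g).
assert (Lim' : forall eps, 0 < eps -> exists d, 0 < d < 1 /\
    forall u w, 0 < u < d -> 1 - d < w < 1 -> Cmod (F w - F u - g) < eps).
{ apply Lim; [| | | exact H].
  - intros x Hx; rewrite lerch_integrand_eq by assumption.
    unfold f1, k; rewrite RtoC_mult; fold v; field.
    split; [exact Ny | apply RtoC_neq_0; lra].
  - intros x Hx; unfold F, f1; eapply Cderiv_eq.
    + apply Cderiv_mult; [apply Cderiv_const |].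
      eapply (Cderiv_comp Psi (fun t => - ln (t * y)) x); [apply HP, Pw, Hx | apply Dw; lra].
    + cbv beta; rewrite RtoC_opp, RtoC_inv by lra; field; apply RtoC_neq_0; lra.
  - intros x Hx; destruct (smooth_lerch_ker z a Hz _ (Pw x Hx)) as [dl Hdl].
    unfold f1, Cdiv; eexists; apply Cderiv_mult.
    + apply Cderiv_mult; [apply Cderiv_const |].
      apply Cderiv_inv; [apply Cderiv_id | apply RtoC_neq_0; lra].
    + eapply (Cderiv_comp (lerch_ker z a) (fun t => - ln (t * y)) x); [exact Hdl | apply Dw; lra]. }
assert (Lv : Clim (locally v) Psi (Psi v)) by (eapply Clim_deriv, HP, Hv).
assert (LB : Clim pinf (fun W => k * Psi W)%C (g + k * Psi v)).
{ intros eps He.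
  assert (He2 : 0 < eps / 2) by lra.
  destruct (Lim' _ He2) as (d & Hd & Hdd).
  assert (Hk1 : 0 < eps / 2 / Cmod k).
  { apply Rdiv_lt_0_compat; [lra | apply Cmod_gt_0, Nk]. }
  destruct (Lv _ Hk1) as [r Hr].
  exists (v - ln d); intros W HW.
  (* The endpoint for which [- ln (u y)] is exactly [W]; the other endpoint is an auxiliary point
     near 1, replaced by 1 at the cost of [eps / 2]. *)
  set (u := exp (v - W)).
  assert (Hu : 0 < u < d).
  { split; [apply exp_pos |]; unfold u; rewrite <- (exp_ln d) by lra; apply exp_increasing; lra. }
  assert (Eu : - ln (u * y) = W).
  { rewrite ln_mult by lra; unfold u; rewrite ln_exp; unfold v; ring. }
  set (r1 := Rmin (r / 2) (Rmin d (/ 2) / 2)).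
  assert (Hr1 : 0 < r1 /\ r1 < r /\ r1 < d).
  { unfold r1; generalize (Rmin_l (r / 2) (Rmin d (/ 2) / 2)) (Rmin_r (r / 2) (Rmin d (/ 2) / 2))
     (Rmin_l d (/ 2)) (Rmin_r d (/ 2)) (cond_pos r); intros.
    assert (0 < Rmin d (/ 2)) by (apply Rmin_glb_lt; lra).
    split; [apply Rmin_glb_lt; lra | lra]. }
  set (w := exp (- r1)).
  assert (Hw : 1 - d < w < 1).
  { unfold w; split; [generalize (exp_ineq1_le (- r1)); lra | apply exp_opp_lt_1; lra]. }
  assert (Ew : - ln (w * y) = v + r1).
  { rewrite ln_mult by (try apply exp_pos; lra); unfold w; rewrite ln_exp; unfold v; ring. }
  specialize (Hdd u w Hu Hw); unfold F in Hdd; rewrite Eu, Ew in Hdd.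
  assert (Hvr : Cmod (Psi (v + r1) - Psi v) < eps / 2 / Cmod k).
  { apply Hr; unfold ball; simpl; unfold AbsRing_ball, abs, minus, plus, opp; simpl.
    apply Rabs_def1; lra. }
  replace (k * Psi W - (g + k * Psi v))%C with
    ((- k * Psi (v + r1)%R - - k * Psi W - g) + k * (Psi (v + r1)%R - Psi v))%C by ring.
  eapply Rle_lt_trans; [apply Cmod_triangle |]; rewrite (Cmod_mult k).
  apply Rmult_lt_compat_l with (r := Cmod k) in Hvr; [| apply Cmod_gt_0, Nk].
  replace (Cmod k * (eps / 2 / Cmod k)) with (eps / 2) in Hvr
    by (field; apply Rgt_not_eq, Cmod_gt_0, Nk).
  lra. }
exists (/ k * (g + k * Psi v))%C; split.
- apply Clim_ext_ev with (fun W => / k * (k * Psi W))%C.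
  + apply filter_forall; intros W; field; exact Nk.
  + apply Clim_mult_l, LB.
- field; exact Nk.
Qed.

(** The joint limit gives separate limits of [K] at 0 and at infinity: freezing one endpoint makes
    the other a Cauchy family. *)
Lemma lerch_outer_integral (h K : R -> C) (g : R -> C) (I : C) :
  (forall y, 0 < y < 1 -> g y = (h (- ln y)%R / RtoC y)%C) ->
  smooth_pos h -> (forall v, 0 < v -> Cderiv K v (h v)) ->
  is_RInt_gen (V := C_R_NormedModule) g (at_right 0) (at_left 1) I ->
  exists K0 KI, Clim (at_right 0) K K0 /\ Clim pinf K KI /\ I = (KI - K0)%C.
Proof.
intros Hg Hh HK H.
assert (Lim : forall eps, 0 < eps -> exists d, 0 < d < 1 /\
    forall u w, 0 < u < d -> 1 - d < w < 1 -> Cmod (- K (- ln w)%R - - K (- ln u)%R - I) < eps).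
{ apply (is_RInt_gen_primitive g (fun y => h (- ln y)%R / RtoC y)%C (fun y => - K (- ln y)%R)%C);
   [exact Hg | | | exact H].
  - intros y Hy; eapply Cderiv_eq.
    + apply Cderiv_opp; eapply (Cderiv_comp K (fun t => - ln t) y).
      * apply HK, opp_ln_pos, Hy.
      * apply is_derive_opp_ln; lra.
    + rewrite RtoC_opp, RtoC_inv by lra; field; apply RtoC_neq_0; lra.
  - intros y Hy; destruct (Hh _ (opp_ln_pos y Hy)) as [dh Hdh].
    unfold Cdiv; eexists; apply Cderiv_mult.
    + eapply (Cderiv_comp h (fun t => - ln t) y); [exact Hdh | apply is_derive_opp_ln; lra].
    + apply Cderiv_inv; [apply Cderiv_id | apply RtoC_neq_0; lra]. }
assert (Lim2 : forall eps, 0 < eps -> exists d N, 0 < d /\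
   forall p V, 0 < p < d -> N < V -> Cmod (K V - K p - I) < eps).
{ intros eps He; destruct (Lim eps He) as (d & Hd & Hdd).
  exists d, (- ln d); split; [lra |]; intros p V Hp HV.
  specialize (Hdd (exp (- V)) (exp (- p))).
  rewrite !ln_exp, !Ropp_involutive in Hdd.
  replace (K V - K p - I)%C with (- K p - - K V - I)%C by ring.
  apply Hdd.
  - split; [apply exp_pos |]; rewrite <- (exp_ln d) by lra; apply exp_increasing; lra.
  - split; [generalize (exp_ineq1_le (- p)); lra | apply exp_opp_lt_1; lra]. }
destruct (Clim_cauchy (F := at_right 0) K) as [K0 HK0].
{ intros eps He; destruct (Lim2 (eps / 2)) as (d & N & Hd & HdN); [lra |].
  exists (fun v => 0 < v < d); split; [apply at_right_pos, Hd |]; intros u v Hu Hv.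
  assert (X1 := HdN u (N + 1) Hu ltac:(lra)); assert (X2 := HdN v (N + 1) Hv ltac:(lra)).
  replace (K u - K v)%C with ((K (N + 1)%R - K v - I) - (K (N + 1)%R - K u - I))%C by ring.
  eapply Rle_lt_trans; [apply Cmod_triangle_minus | lra]. }
destruct (Clim_cauchy (F := pinf) K) as [KI HKI].
{ intros eps He; destruct (Lim2 (eps / 2)) as (d & N & Hd & HdN); [lra |].
  exists (fun v => N < v); split; [apply pinf_gt |]; intros u v Hu Hv.
  assert (X1 := HdN (d / 2) u ltac:(lra) Hu); assert (X2 := HdN (d / 2) v ltac:(lra) Hv).
  replace (K u - K v)%C with ((K u - K (d / 2)%R - I) - (K v - K (d / 2)%R - I))%C by ring.
  eapply Rle_lt_trans; [apply Cmod_triangle_minus | lra]. }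
exists K0, KI; split; [exact HK0 | split; [exact HKI |]].
assert (E : (KI - K0 - I = 0)%C).
{ apply Cmod_eq_0, Rle_antisym; [| apply Cmod_ge_0].
  apply le_epsilon; intros eps He; rewrite Rplus_0_l.
  destruct (Lim2 eps He) as (d & N & Hd & HdN).
  apply (Clim_norm_le (F := pinf) (fun V => K V - K0 - I)%C).
  { apply Clim_minus; [apply Clim_minus; [exact HKI | apply Clim_const] | apply Clim_const]. }
  exists N; intros V HV.
  apply (Clim_norm_le (F := at_right 0) (fun p => K V - K p - I)%C).
  { apply Clim_minus; [apply Clim_minus; [apply Clim_const | exact HK0] | apply Clim_const]. }
  generalize (at_right_pos d Hd); apply filter_imp; intros p Hp; apply Rlt_le, HdN; assumption. }
replace I with (KI - K0 - (KI - K0 - I))%C by ring; rewrite E; ring.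
Qed.

(** * Expansion of the geometric series and identification of the limits *)

(** The left side stands for the integral at shift [a] itself, which need not converge when
    [Re a = 0]; the genuine integrals [l n] begin at [a + 1], where each splits off one more term of
    the series. *)
Lemma lerch_remainder (z s a G : C) (l : nat -> C) (N : nat) :
  Cmod z <= 1 -> 0 < Re s -> 0 <= Re a -> is_int (gker s 1) G ->
  (forall n, is_int (lker z s (a + 1 + RtoC (INR n))) (l n)) ->
  (G / Defs.Cpow a s + z * l 0%nat =
   G * sum_n (G := C_AbelianMonoid) (fun k => z ^ k / Defs.Cpow (RtoC (INR k) + a) s) N
     + z ^ S N * l N)%C.
Proof.
intros Hz Hs Ha HG Hl; induction N as [| N IH].
- rewrite (sum_O (G := C_AbelianMonoid)); simpl.
  replace (0 + a)%C with a by ring; unfold Cdiv; ring.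
- rewrite sum_n_S, IH.
  assert (E : l N = (G / Defs.Cpow (a + 1 + RtoC (INR N)) s + z * l (S N))%C).
  { apply is_int_unique with (lker z s (a + 1 + RtoC (INR N))); [apply Hl |].
    apply lker_int_split; try assumption.
    - generalize (pos_INR N); unfold Re in *; simpl; lra.
    - replace (a + 1 + RtoC (INR N) + 1)%C with (a + 1 + RtoC (INR (S N)))%C
        by (rewrite S_INR, RtoC_plus; ring).
      apply Hl. }
  rewrite E at 1.
  replace (RtoC (INR (S N)) + a)%C with (a + 1 + RtoC (INR N))%C
    by (rewrite S_INR, RtoC_plus; ring).
  change (z ^ S (S N))%C with (z * z ^ S N)%C; unfold Cdiv; ring.
Qed.

Lemma lerch_gamma_double_integral (z s a L G I : C) :
  is_Lerch z s a L -> is_Gamma s G -> is_dblint01 (lerch_integrand z s a) I -> (L * G)%C = I.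
Proof.
intros [Na HL] [Ns HG] [g [Hg HI]].
assert (Hz := lerch_series_Cmod_le z s a L HL).
assert (Ns0 : s <> 0).
{ specialize (Ns 0%nat); intros E; apply Ns; rewrite E; simpl; f_equal; ring. }
assert (Na0 : a <> 0).
{ specialize (Na 0%nat); intros E; apply Na; rewrite E; simpl; ring. }
destruct (antiderivative_exists _ (smooth_lerch_ker z a Hz)) as [Psi HP].
(* The sample point [1/2] produces [B]; uniqueness of limits then shows that every other [y] gives
   the same one. *)
destruct (lerch_inner_integral z s a Psi (/ 2) (g (/ 2)) Hz Ns0) as [B [HB _]];
  [lra | exact HP | apply Hg; lra |].
set (h := fun v : R => (s * Rcpow v (s - 1) * (B - Psi v))%C).
assert (Hh : smooth_pos h).
{ apply smooth_mult; [apply smooth_mult; [apply smooth_const | apply smooth_Rcpow] |].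
  apply smooth_plus; [apply smooth_const | apply smooth_opp].
  intros v Hv; eexists; apply HP, Hv. }
destruct (antiderivative_exists h Hh) as [K HK].
destruct (lerch_outer_integral h K g I) as (K0 & KI & HK0 & HKI & ->); [| exact Hh | exact HK | exact HI |].
{ intros y Hy.
  destruct (lerch_inner_integral z s a Psi y (g y) Hz Ns0 Hy HP) as [B' [HB' ->]]; [apply Hg, Hy |].
  unfold h; rewrite (Clim_unique _ _ _ HB HB').
  unfold Cdiv; ring. }
assert (Ha := lerch_ker_primitive_Re_nonneg z a Psi B Hz Na0 HP HB).
destruct (den_order_exists z Hz) as [m Hm].
assert (Hs := lerch_order_lt_Re_s z s a m Psi B K K0 Hz Ns0 Hm HP HK HK0).
assert (Hs0 : 0 < Re s) by (destruct Hm as [[-> | ->] _]; lra).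
destruct (gker_int_exists s 1 Hs0) as [G' HG']; [simpl; lra |].
assert (EG : G' = G).
{ apply (Clim_unique (F := eventually) _ _ _ (Gauss_limit s G' Hs0 HG')).
  apply Clim_of_filterlim, HG. }
subst G'.
assert (Re1 : forall r : R, 0 <= r -> 0 < Re (a + 1 + RtoC r)) by (intros r; unfold Re in *; simpl; lra).
set (J1 := fun r => epsilon (inhabits (RtoC 0)) (is_int (lker z s (a + 1 + RtoC r)))).
assert (HJ1 : forall r, 0 <= r -> is_int (lker z s (a + 1 + RtoC r)) (J1 r)).
{ intros r Hr; apply epsilon_spec, (lker_int_exists z s m); auto. }
set (J := fun e : R => (G / Defs.Cpow (a + RtoC e) s + z * J1 e)%C).
assert (HJ : forall e, 0 < e -> is_int (lker z s (a + RtoC e)) (J e)).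
{ intros e He; unfold J; apply lker_int_split; auto.
  - unfold Re in *; simpl; lra.
  - replace (a + RtoC e + 1)%C with (a + 1 + RtoC e)%C by ring; apply HJ1; lra. }
(* The same family [J] is evaluated twice as [e -> 0+]: by Abel summation it tends to the double
   integral, by continuity to the first series term plus the integral at [a + 1]. *)
assert (L1 := lerch_abel_limit z s a m Psi B K K0 KI J Hz Ns0 Ha Hm Hs HP HB HK HK0 HKI HJ).
assert (L2 : Clim (at_right 0) J (G / Defs.Cpow a s + z * J1 0)).
{ unfold J, Cdiv; apply Clim_plus; apply Clim_mult_l; [apply Cpow_inv_lim_right; assumption |].
  apply lker_int_lim_right with z s m (a + 1)%C; auto.
  - unfold Re in *; simpl; lra.
  - replace (a + 1)%C with (a + 1 + RtoC 0)%C by ring; apply HJ1; lra.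
  - intros e He; apply HJ1; lra. }
rewrite (Clim_unique _ _ _ L1 L2).
assert (HJn : forall n, is_int (lker z s (a + 1 + RtoC (INR n))) (J1 (INR n))).
{ intros n; apply HJ1, pos_INR. }
apply (Clim_unique (F := eventually) (fun _ => G / Defs.Cpow a s + z * J1 0)%C); [| apply Clim_const].
apply Clim_ext_ev with (fun N =>
  G * sum_n (G := C_AbelianMonoid) (fun k => z ^ k / Defs.Cpow (RtoC (INR k) + a) s) N
     + z ^ S N * J1 (INR N))%C.
{ apply filter_forall; intros N; symmetry.
  apply (lerch_remainder z s a G (fun n => J1 (INR n)) N); assumption. }
replace (L * G)%C with (G * L + 0)%C by ring.
apply Clim_plus; [apply Clim_mult_l, Clim_sum_n, HL |].
assert (L3 : Clim eventually (fun n => J1 (INR n)) 0).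
{ apply lker_int_shift_lim with z s m (a + 1)%C; auto; unfold Re in *; simpl; lra. }
intros eps He; generalize (L3 eps He); apply filter_imp; intros N HN.
replace (z ^ S N * J1 (INR N) - 0)%C with (z ^ S N * (J1 (INR N) - 0))%C by ring.
rewrite Cmod_mult, Cmod_pow.
assert (Cmod z ^ S N <= 1).
{ eapply Rle_trans; [apply (pow_incr _ 1); split; [apply Cmod_ge_0 | exact Hz] |].
  rewrite pow1; lra. }
generalize (Cmod_ge_0 (J1 (INR N) - 0)); nra.
Qed.

(** * The zeta function as the case [z = a = 1] *)

Lemma Cpow_RtoC (x : R) (s : C) : 0 < x -> Defs.Cpow x s = Rcpow x s.
Proof.
intros Hx; unfold Defs.Cpow, Rcpow; do 2 f_equal.
unfold CLog, Carg; simpl; destruct (Rlt_dec 0 x); [| lra].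
rewrite Cmod_R, Rabs_pos_eq by lra.
unfold Rdiv; rewrite Rmult_0_l, atan_0; reflexivity.
Qed.

Lemma is_zeta_Lerch (s Z : C) : is_zeta s Z -> is_Lerch 1 s 1 Z.
Proof.
assert (E : forall k, (RtoC (INR k) + 1)%C = RtoC (INR (S k))).
{ intros k; rewrite S_INR, RtoC_plus; reflexivity. }
assert (P : forall k, 0 < INR (S k)) by (intros k; apply lt_0_INR; lia).
intros H; split.
- intros k; rewrite E; apply RtoC_neq_0; specialize (P k); lra.
- assert (T : forall k, (/ Rcpow (INR (S k)) s = 1 ^ k / Defs.Cpow (RtoC (INR k) + 1) s)%C).
  { intros k; rewrite E, Cpow_RtoC, Cpow_1_l by apply P; unfold Cdiv; ring. }
  apply is_series_ext with (1 := T), H.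
Qed.

Lemma zeta_integrand_Lerch (s : C) x y : zeta_integrand s x y = lerch_integrand 1 s 1 x y.
Proof.
unfold zeta_integrand, lerch_integrand.
replace (1 - 1)%C with (RtoC 0) by ring.
rewrite Rcpow_0, Cmult_1_r, Cmult_1_l; reflexivity.
Qed.

Theorem theorem3p3 :
  forall z s a : C,
    (forall L G I : C,
        is_Lerch z s a L -> is_Gamma s G ->
        is_dblint01 (lerch_integrand z s a) I ->
        (L * G)%C = I) /\
    (forall Z G I : C,
        is_zeta s Z -> is_Gamma s G ->
        is_dblint01 (zeta_integrand s) I ->
        (Z * G)%C = I).
Proof.
intros z s a; split.
- intros L G I; apply lerch_gamma_double_integral.
- intros Z G I HZ HG [g [Hg HI]].
  apply (lerch_gamma_double_integral 1 s 1); [apply is_zeta_Lerch, HZ | exact HG |].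
  exists g; split; [| exact HI]; intros y Hy.
  eapply is_RInt_gen_ext; [| apply Hg, Hy].
  apply filter_forall; intros ab x _; apply zeta_integrand_Lerch.
Qed.
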